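(* For every $\lambda\in\mathfrak a_\Theta^*$ one has $q_{\pi,\Theta}(F_\pi;\lambda)\,M_\Theta(\lambda)=0$, where $$q_{\pi,\Theta}(x;\lambda)=\prod_{(\mu,C)\in\Omega_{\pi,\Theta}}\bigl(x-\mu(\lambda)-C\bigr),\qquad \Omega_{\pi,\Theta}=\{(\varpi|_{\mathfrak a_\Theta},D_\pi(\varpi));\ \varpi\in\overline{\mathcal W}_\Theta(\pi)\}.$$
   Context: $\mathfrak g$ is a finite-dimensional reductive Lie algebra over $\mathbb C$ and $(\pi,V)$ is a faithful irreducible finite-dimensional representation of $\mathfrak g$; $N=\dim V$. Choose a basis of $V$, identify $V\simeq\mathbb C^N$ and $\mathfrak g$ with $\pi(\mathfrak g)\subset\mathfrak{gl}_N=M(N,\mathbb C)$. Put $\langle X,Y\rangle=\operatorname{Trace}XY$ on $\mathfrak{gl}_N$ (it is non-degenerate on $\mathfrak g$), let $p:\mathfrak{gl}_N\to\mathfrak g$ be the orthogonal projection, $E_{ij}$ the matrix units, and $F_\pi=(p(E_{ij}))_{1\le i,j\le N}\in M(N,U(\mathfrak g))$. For $q\in\mathbb C[x]$, $q(F_\pi)_{ij}\in U(\mathfrak g)$ are the entries of $q(F_\pi)$, and for a $\mathfrak g$-module $M$, $q(F_\pi)M=0$ means that every entry $q(F_\pi)_{ij}$ annihilates $M$. $\mathfrak a$ is a Cartan subalgebra of $\mathfrak g$, $\Sigma(\mathfrak g)$ the root system, $\Sigma(\mathfrak g)^+$ a positive system with simple roots $\Psi(\mathfrak g)$, $X_\alpha$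 root vectors, $\rho$ half the sum of the positive roots. The form $\langle\ ,\ \rangle$ on $\mathfrak a$ identifies $\mathfrak a^*\simeq\mathfrak a$ and gives a symmetric bilinear form $\langle\ ,\ \rangle$ on $\mathfrak a^*$. $\Theta\subsetneq\Psi(\mathfrak g)$ is fixed. $\mathfrak a_\Theta=\{H\in\mathfrak a;\alpha(H)=0\ \forall\alpha\in\Theta\}$; $\mathfrak g_\Theta$ is the centralizer of $\mathfrak a_\Theta$ in $\mathfrak g$; $\mathfrak m_\Theta=\{X\in\mathfrak g_\Theta;\langle X,H\rangle=0\ \forall H\in\mathfrak a_\Theta\}$; $\Sigma(\mathfrak g_\Theta)=\{\alpha\in\Sigma(\mathfrak g);\alpha|_{\mathfrak a_\Theta}=0\}$, $\Sigma(\mathfrak g_\Theta)^+=\Sigma(\mathfrak g_\Theta)\cap\Sigma(\mathfrak g)^+$; $\mathfrak n_\Theta=\sum_{\alpha\in\Sigma(\mathfrak g)^+\setminus\Sigma(\mathfrak g_\Theta)}\mathbb CX_\alpha$; $\mathfrak p_\Theta=\mathfrak g_\Theta+\mathfrak n_\Theta=\mathfrak m_\Theta+\mathfrak a_\Theta+\mathfrak n_\Theta$. For $\lambda\in\mathfrak a_\Theta^*$, $\lambda_\Theta$ is the character of $\mathfrak p_\Theta$ with $\lambda_\Theta(X+H)=\lambda(H)$ for $X\in\mathfrak m_\Theta+\mathfrak n_\Theta$, $H\in\mathfrak a_\Theta$ (also its restriction to $\mathfrak a$), $J_\Theta(\lambda)=\sum_{X\in\mathfrak p_\Theta}U(\mathfrak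 g)(X-\lambda_\Theta(X))$, and $M_\Theta(\lambda)=U(\mathfrak g)/J_\Theta(\lambda)$. $\mathcal W(\pi)$ is the set of weights of $\pi$, $\bar\pi$ its lowest weight, $D_\pi(\varpi)=\frac12\langle\bar\pi-\varpi,\bar\pi+\varpi-2\rho\rangle$ for $\varpi\in\mathcal W(\pi)$, and $\overline{\mathcal W}_\Theta(\pi)$ is the set of lowest weights (with respect to $\Sigma(\mathfrak g_\Theta)^+$) of the irreducible components of $\pi|_{\mathfrak g_\Theta}$. For $\varpi\in\mathfrak a^*$, $\varpi|_{\mathfrak a_\Theta}$ is regarded as a linear function on $\mathfrak a_\Theta^*$ by $\varpi|_{\mathfrak a_\Theta}(\lambda)=\langle\lambda_\Theta,\varpi\rangle$. $\Omega_{\pi,\Theta}$ is a set (no repeated elements). *)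

(* Defs.v *)
From HB Require Import structures.
From mathcomp Require Import all_boot all_order all_algebra finmap.
From mathcomp Require Import all_classical reals.
From mathcomp Require Import generic_quotient ring_quotient complex.

Set Implicit Arguments.
Unset Strict Implicit.
Unset Printing Implicit Defensive.

Import GRing.Theory.
Local Open Scope ring_scope.
Local Open Scope classical_set_scope.

HB.mixin Record Vector_isLieAlgebra (K : fieldType) (g : Type)
    of Vector K g := {
  lie : g -> g -> g;
  lie_linearl : forall z, linear (lie^~ z);
  lie_linearr : forall z, linear (lie z);
  liexx : forall x, lie x x = 0;
  lie_jacobi : forall x y z,
    lie x (lie y z) + lie y (lie z x) + lie z (lie x y) = 0
}.

#[short(type="lieAlgType")]
HB.structure Definition LieAlgebra (K : fieldType) :=
  {g of Vector_isLieAlgebra K g & Vector K g}.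

HB.instance Definition _ (K : fieldType) (g : lieAlgType K) (x : g) :=
  GRing.isLinear.Build K g g _ (lie x) (lie_linearr x).

(* U(g) is the unital associative K-algebra generated by the symbols [UVar x],
   x in g, subject to K-linearity of [UVar] and to the relations
   [x, y] = xy - yx.  It is obtained as the quotient of the algebraic
   expressions [uterm] in these symbols by the congruence [ueq] generated by
   the axioms of K-algebras and these relations. *)

Inductive uterm (K : fieldType) (g : lieAlgType K) : Type :=
| UVar of g
| UScal of K
| UAdd of uterm g & uterm g
| UMul of uterm g & uterm g.

Arguments UVar {K g}.
Arguments UScal {K} g.
Arguments UAdd {K g}.
Arguments UMul {K g}.

Inductive ueq (K : fieldType) (g : lieAlgType K) :
    uterm g -> uterm g -> Prop :=
| ueq_refl t : ueq t t
| ueq_sym t u : ueq t u -> ueq u t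
| ueq_trans u t v : ueq t u -> ueq u v -> ueq t v
| ueq_add t t' u u' : ueq t t' -> ueq u u' -> ueq (UAdd t u) (UAdd t' u')
| ueq_mul t t' u u' : ueq t t' -> ueq u u' -> ueq (UMul t u) (UMul t' u')
| ueq_addA t u v : ueq (UAdd t (UAdd u v)) (UAdd (UAdd t u) v)
| ueq_addC t u : ueq (UAdd t u) (UAdd u t)
| ueq_add0 t : ueq (UAdd (UScal g 0) t) t
| ueq_addN t : ueq (UAdd (UMul (UScal g (-1)) t) t) (UScal g 0)
| ueq_mulA t u v : ueq (UMul t (UMul u v)) (UMul (UMul t u) v)
| ueq_mul1l t : ueq (UMul (UScal g 1) t) t
| ueq_mul1r t : ueq (UMul t (UScal g 1)) t
| ueq_mulDl t u v : ueq (UMul (UAdd t u) v) (UAdd (UMul t v) (UMul u v))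
| ueq_mulDr t u v : ueq (UMul t (UAdd u v)) (UAdd (UMul t u) (UMul t v))
| ueq_scalD c d : ueq (UScal g (c + d)) (UAdd (UScal g c) (UScal g d))
| ueq_scalM c d : ueq (UScal g (c * d)) (UMul (UScal g c) (UScal g d))
| ueq_scalC c t : ueq (UMul (UScal g c) t) (UMul t (UScal g c))
| ueq_var c x y :
    ueq (UVar (c *: x + y)) (UAdd (UMul (UScal g c) (UVar x)) (UVar y))
| ueq_lie x y :
    ueq (UAdd (UVar (lie x y)) (UMul (UVar y) (UVar x)))
        (UMul (UVar x) (UVar y)).

HB.instance Definition _ (K : fieldType) (g : lieAlgType K) :=
  gen_eqMixin (uterm g).
HB.instance Definition _ (K : fieldType) (g : lieAlgType K) :=
  gen_choiceMixin (uterm g).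

Section UniversalEnvelopingAlgebra.
Local Open Scope quotient_scope.
Variables (K : fieldType) (g : lieAlgType K).
Implicit Types (t u v : uterm g) (c d : K) (x y : g).

Definition ueqb t u : bool := `[< ueq t u >].

Lemma ueqb_equiv : equiv_class_of ueqb.
Proof.
split=> [t|t u|u t v].
- exact/asboolP/ueq_refl.
- by apply/asboolP/asboolP; apply: ueq_sym.
- by move=> /asboolP tu /asboolP uv; apply/asboolP/(ueq_trans tu uv).
Qed.

Canonical ueqb_equiv_rel := EquivRelPack ueqb_equiv.
Canonical ueqb_encModRel := defaultEncModRel ueqb.

Definition Ug := {eq_quot ueqb}.
HB.instance Definition _ := Choice.on Ug.
HB.instance Definition _ := EqQuotient.on Ug.

Lemma Ug_eqP t u : \pi_Ug t = \pi_Ug u <-> ueq t u.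
Proof.
split=> [/eqmodP/asboolP //|tu]; apply/eqmodP; exact/asboolP.
Qed.

Lemma Ug_pi (z : Ug) : exists t, z = \pi_Ug t.
Proof. by exists (repr z); rewrite reprK. Qed.

Definition Uadd (z w : Ug) : Ug := \pi_Ug (UAdd (repr z) (repr w)).
Definition Umul (z w : Ug) : Ug := \pi_Ug (UMul (repr z) (repr w)).
Definition Uscalar c : Ug := \pi_Ug (UScal g c).
Definition Uopp (z : Ug) : Ug := Umul (Uscalar (-1)) z.

Lemma ueq_repr t : ueq (repr (\pi_Ug t)) t.
Proof. by apply/Ug_eqP; rewrite reprK. Qed.

Lemma Uadd_pi t u : Uadd (\pi_Ug t) (\pi_Ug u) = \pi_Ug (UAdd t u).
Proof. by apply/Ug_eqP/ueq_add; apply: ueq_repr. Qed.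

Lemma Umul_pi t u : Umul (\pi_Ug t) (\pi_Ug u) = \pi_Ug (UMul t u).
Proof. by apply/Ug_eqP/ueq_mul; apply: ueq_repr. Qed.

Lemma UaddA : associative Uadd.
Proof.
move=> z w s; have [[[t ->] [u ->]] [v ->]] := (Ug_pi z, Ug_pi w, Ug_pi s).
by rewrite !Uadd_pi; apply/Ug_eqP/ueq_addA.
Qed.

Lemma UaddC : commutative Uadd.
Proof.
move=> z w; have [[t ->] [u ->]] := (Ug_pi z, Ug_pi w).
by rewrite !Uadd_pi; apply/Ug_eqP/ueq_addC.
Qed.

Lemma Uadd0 : left_id (Uscalar 0) Uadd.
Proof.
by move=> z; have [t ->] := Ug_pi z; rewrite Uadd_pi; apply/Ug_eqP/ueq_add0.
Qed.

Lemma UaddN : left_inverse (Uscalar 0) Uopp Uadd.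
Proof.
move=> z; have [t ->] := Ug_pi z.
by rewrite /Uopp Umul_pi Uadd_pi; apply/Ug_eqP/ueq_addN.
Qed.

HB.instance Definition _ := GRing.isZmodule.Build Ug UaddA UaddC Uadd0 UaddN.

Lemma UaddE t u : \pi_Ug t + \pi_Ug u = \pi_Ug (UAdd t u).
Proof. exact: Uadd_pi. Qed.

Lemma UmulA : associative Umul.
Proof.
move=> z w s; have [[[t ->] [u ->]] [v ->]] := (Ug_pi z, Ug_pi w, Ug_pi s).
by rewrite !Umul_pi; apply/Ug_eqP/ueq_mulA.
Qed.

Lemma Umul1l : left_id (Uscalar 1) Umul.
Proof.
by move=> z; have [t ->] := Ug_pi z; rewrite Umul_pi; apply/Ug_eqP/ueq_mul1l.
Qed.

Lemma Umul1r : right_id (Uscalar 1) Umul.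
Proof.
by move=> z; have [t ->] := Ug_pi z; rewrite Umul_pi; apply/Ug_eqP/ueq_mul1r.
Qed.

Lemma UmulDl : left_distributive Umul +%R.
Proof.
move=> z w s; have [[[t ->] [u ->]] [v ->]] := (Ug_pi z, Ug_pi w, Ug_pi s).
by rewrite UaddE !Umul_pi UaddE; apply/Ug_eqP/ueq_mulDl.
Qed.

Lemma UmulDr : right_distributive Umul +%R.
Proof.
move=> z w s; have [[[t ->] [u ->]] [v ->]] := (Ug_pi z, Ug_pi w, Ug_pi s).
by rewrite UaddE !Umul_pi UaddE; apply/Ug_eqP/ueq_mulDr.
Qed.

Fixpoint uaug t : K :=
  match t with
  | UVar _ => 0
  | UScal c => c
  | UAdd t u => uaug t + uaug u
  | UMul t u => uaug t * uaug u
  end.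

Lemma uaug_ueq t u : ueq t u -> uaug t = uaug u.
Proof.
elim=> {t u} //=.
- by move=> t u v _ -> _ ->.
- by move=> t t' u u' _ -> _ ->.
- by move=> t t' u u' _ -> _ ->.
- by move=> *; rewrite addrA.
- by move=> *; rewrite addrC.
- by move=> *; rewrite add0r.
- by move=> *; rewrite mulN1r addNr.
- by move=> *; rewrite mulrA.
- by move=> *; rewrite mul1r.
- by move=> *; rewrite mulr1.
- by move=> *; rewrite mulrDl.
- by move=> *; rewrite mulrDr.
- by move=> *; rewrite mulrC.
- by move=> *; rewrite mulr0 addr0.
- by move=> *; rewrite mulr0 addr0.
Qed.

Lemma Uone_neq0 : Uscalar 1 != 0.
Proof. by apply/eqP => /Ug_eqP/uaug_ueq /= /eqP; rewrite oner_eq0. Qed.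

HB.instance Definition _ := GRing.Zmodule_isNzRing.Build Ug
  UmulA Umul1l Umul1r UmulDl UmulDr Uone_neq0.

Lemma UmulE t u : \pi_Ug t * \pi_Ug u = \pi_Ug (UMul t u).
Proof. exact: Umul_pi. Qed.

Definition Uscale c (z : Ug) : Ug := Uscalar c * z.

Lemma UscalarM c d : Uscalar (c * d) = Uscalar c * Uscalar d.
Proof. by rewrite UmulE; apply/Ug_eqP/ueq_scalM. Qed.

Lemma UscalarD c d : Uscalar (c + d) = Uscalar c + Uscalar d.
Proof. by rewrite UaddE; apply/Ug_eqP/ueq_scalD. Qed.

Lemma UscalarC c (z : Ug) : Uscalar c * z = z * Uscalar c.
Proof.
have [t ->] := Ug_pi z.
by rewrite !UmulE; apply/Ug_eqP/ueq_scalC.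
Qed.

Lemma UscaleA c d (z : Ug) : Uscale c (Uscale d z) = Uscale (c * d) z.
Proof. by rewrite /Uscale UscalarM mulrA. Qed.

Lemma Uscale1 : left_id 1 Uscale.
Proof. by move=> z; rewrite /Uscale [LHS]mul1r. Qed.

Lemma UscaleDr : right_distributive Uscale +%R.
Proof. by move=> c z w; rewrite /Uscale mulrDr. Qed.

Lemma UscaleDl (z : Ug) : {morph Uscale^~ z : c d / c + d}.
Proof. by move=> c d; rewrite /Uscale UscalarD mulrDl. Qed.

HB.instance Definition _ := GRing.Zmodule_isLmodule.Build K Ug
  UscaleA Uscale1 UscaleDr UscaleDl.

Lemma UscaleAl c (z w : Ug) : c *: (z * w) = (c *: z) * w.
Proof. by rewrite [LHS]mulrA. Qed.

HB.instance Definition _ := GRing.Lmodule_isLalgebra.Build K Ug UscaleAl.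

Lemma UscaleAr c (z w : Ug) : c *: (z * w) = z * (c *: w).
Proof.
by rewrite -[c *: w]/(Uscalar c * w) mulrA -UscalarC -mulrA.
Qed.

HB.instance Definition _ := GRing.Lalgebra_isAlgebra.Build K Ug UscaleAr.

Definition Uinj x : Ug := \pi_Ug (UVar x).

Lemma Uinj_linear : linear Uinj.
Proof.
move=> c x y.
rewrite -[c *: Uinj x]/(Umul (\pi_Ug (UScal g c)) (\pi_Ug (UVar x))).
by rewrite Umul_pi UaddE; apply/Ug_eqP/ueq_var.
Qed.

HB.instance Definition _ := GRing.isLinear.Build K g Ug _ Uinj Uinj_linear.

Lemma Uinj_lie x y : Uinj (lie x y) = Uinj x * Uinj y - Uinj y * Uinj x.
Proof.
apply/eqP; rewrite eq_sym subr_eq eq_sym; apply/eqP.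
rewrite UmulE UaddE UmulE.
exact/Ug_eqP/ueq_lie.
Qed.

Lemma Ug_ind (P : Ug -> Prop) :
  (forall x, P (Uinj x)) -> (forall c, P c%:A) ->
  (forall z w, P z -> P w -> P (z + w)) ->
  (forall z w, P z -> P w -> P (z * w)) ->
  forall z, P z.
Proof.
move=> Px Pc PD PM z; have [t ->] := Ug_pi z.
elim: t => [x|c|t Pt u Pu|t Pt u Pu]; first exact: Px.
- have -> : \pi_Ug (UScal g c) = c%:A :> Ug by rewrite [RHS]mulr1.
  exact: Pc.
- by rewrite -UaddE; apply: PD.
- by rewrite -UmulE; apply: PM.
Qed.

Lemma Ug_universal (A : algType K) (f : {linear g -> A}) :
  (forall x y, f (lie x y) = f x * f y - f y * f x) ->
  exists2 h : {lrmorphism Ug -> A}, forall x, h (Uinj x) = f x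
    & forall h' : {lrmorphism Ug -> A},
        (forall x, h' (Uinj x) = f x) -> h' =1 h.
Proof.
move=> flie.
pose fix ev (t : uterm g) : A :=
  match t with
  | UVar x => f x | UScal c => c%:A
  | UAdd t u => ev t + ev u | UMul t u => ev t * ev u
  end.
have evP t u : ueq t u -> ev t = ev u.
  elim=> {t u} //=.
  - by move=> t u v _ -> _ ->.
  - by move=> t t' u u' _ -> _ ->.
  - by move=> t t' u u' _ -> _ ->.
  - by move=> *; rewrite addrA.
  - by move=> *; rewrite addrC.
  - by move=> *; rewrite scale0r add0r.
  - by move=> *; rewrite scaleN1r mulN1r addNr scale0r.
  - by move=> *; rewrite mulrA.
  - by move=> *; rewrite scale1r mul1r.
  - by move=> *; rewrite scale1r mulr1.
  - by move=> *; rewrite mulrDl.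
  - by move=> *; rewrite mulrDr.
  - by move=> *; rewrite scalerDl.
  - by move=> *; rewrite -scalerAl mul1r scalerA.
  - by move=> *; rewrite -scalerAl -scalerAr mul1r mulr1.
  - by move=> *; rewrite linearP -scalerAl mul1r.
  - by move=> *; rewrite flie subrK.
pose h (z : Ug) := ev (repr z).
have hpi t : h (\pi_Ug t) = ev t by apply/evP/ueq_repr.
have hD z w : h (z + w) = h z + h w.
  have [[t ->] [u ->]] := (Ug_pi z, Ug_pi w).
  by rewrite UaddE !hpi.
have hM z w : h (z * w) = h z * h w.
  have [[t ->] [u ->]] := (Ug_pi z, Ug_pi w).
  by rewrite UmulE !hpi.
have hlin : linear h.
  move=> c z w; rewrite hD [c *: z]/(Uscalar c * z) hM hpi /=.
  by rewrite -scalerAl mul1r.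
have hmon : monoid_morphism h by split=> //; rewrite [LHS]hpi /= scale1r.
pose hL := GRing.isLinear.Build K Ug A _ h hlin.
pose hR := GRing.isMonoidMorphism.Build Ug A h hmon.
pose H : {lrmorphism Ug -> A} := HB.pack h hL hR.
exists H => [x|h' h'x z]; first exact: hpi.
elim/Ug_ind: z => [x|c|z w IHz IHw|z w IHz IHw].
- by rewrite h'x [RHS]hpi.
- by rewrite (rmorph_alg h') (rmorph_alg H).
- by rewrite (rmorphD h') (rmorphD H); congr (_ + _).
- by rewrite (rmorphM h') (rmorphM H); congr (_ * _).
Qed.

End UniversalEnvelopingAlgebra.

Arguments Ug {K} g.

Section LeftIdealQuotient.
Local Open Scope quotient_scope.
Variables (U : nzRingType) (S : set U).

Definition lideal : {pred U} := fun z =>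
  `[< exists n (c s : 'I_n -> U),
        (forall i, S (s i)) /\ z = \sum_(i < n) c i * s i >].

Lemma lidealM u z : z \in lideal -> u * z \in lideal.
Proof.
move=> /asboolP[n [c [s [Ss ->]]]]; apply/asboolP.
exists n, (fun i => u * c i), s; split=> //.
by rewrite mulr_sumr; apply: eq_bigr => i _; rewrite mulrA.
Qed.

Lemma lideal_zmod_closed : zmod_closed lideal.
Proof.
split.
  apply/asboolP; exists 0%N, (fun=> 0), (fun=> 0).
  split; last by rewrite big_ord0.
  by case.
move=> z w zI /(lidealM (-1)) /asboolP[m [d [r [Sr wE]]]].
case/asboolP: zI => n [c [s [Ss ->]]]; apply/asboolP.
exists (n + m)%N,
  (fun i : 'I_(n + m) =>
     match fintype.split i with inl j => c j | inr j => d j end),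
  (fun i : 'I_(n + m) =>
     match fintype.split i with inl j => s j | inr j => r j end).
split; first by move=> i; case: (fintype.split i).
rewrite -[- w]mulN1r wE big_split_ord /=.
congr (_ + _); apply: eq_bigr => i _.
  by rewrite (unsplitK (inl i)).
by rewrite (unsplitK (inr i)).
Qed.

HB.instance Definition _ := GRing.isZmodClosed.Build U lideal
  lideal_zmod_closed.

Definition lquot := Quotient.quot lideal.
HB.instance Definition _ := GRing.Zmodule.on lquot.
HB.instance Definition _ := EqQuotient.on lquot.

Lemma lquot_eqP x y : \pi_lquot x = \pi_lquot y <-> x - y \in lideal.
Proof.
by split=> [/eqP|h]; [|apply/eqP]; rewrite -(Quotient.idealrBE lideal).
Qed.

Lemma lquot_piD x y : \pi_lquot (x + y) = \pi_lquot x + \pi_lquot y.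
Proof. exact: (raddfD \pi_(Quotient.quot lideal)). Qed.

Definition lquot_scale (u : U) (m : lquot) : lquot := \pi_lquot (u * repr m).

Lemma lquot_scale_pi u x : lquot_scale u (\pi_lquot x) = \pi_lquot (u * x).
Proof.
by apply/lquot_eqP; rewrite -mulrBr lidealM //; apply/lquot_eqP; rewrite reprK.
Qed.

Lemma lquot_scaleA u v m :
  lquot_scale u (lquot_scale v m) = lquot_scale (u * v) m.
Proof. by rewrite -[m]reprK (lquot_scale_pi v) !lquot_scale_pi mulrA. Qed.

Lemma lquot_scale1 : left_id 1 lquot_scale.
Proof. by move=> m; rewrite -[m]reprK lquot_scale_pi mul1r. Qed.

Lemma lquot_scaleDr : right_distributive lquot_scale +%R.
Proof.
move=> u m n; rewrite -[m]reprK -[n]reprK -lquot_piD !lquot_scale_pi.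
by rewrite mulrDr lquot_piD.
Qed.

Lemma lquot_scaleDl m : {morph lquot_scale^~ m : u v / u + v}.
Proof.
by move=> u v; rewrite -[m]reprK !lquot_scale_pi mulrDl lquot_piD.
Qed.

HB.instance Definition _ := GRing.Zmodule_isLmodule.Build U lquot
  lquot_scaleA lquot_scale1 lquot_scaleDr lquot_scaleDl.

End LeftIdealQuotient.

Section Setting.
Variables (K : fieldType) (g : lieAlgType K) (N : nat).
Implicit Types (x y : g) (k a : {vspace g}) (W : {vspace 'cV[K]_N}).

Definition ideal_of k := forall x y, y \in k -> lie x y \in k.

Definition reductive := forall k, ideal_of k ->
  exists k', [/\ ideal_of k', (k + k')%VS = fullv & (k :&: k')%VS = 0%VS].

Definition centralizer k : {vspace g} :=
  (\bigcap_(i < \dim k) lker (linfun (lie (vbasis k)`_i)))%VS.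

Lemma centralizerP k x :
  reflect (forall h, h \in k -> lie h x = 0) (x \in centralizer k).
Proof.
rewrite memvE; apply: (iffP subv_bigcapP) => [xC h hk|xC i _].
  pose f := GRing.isLinear.Build K g g _ (lie^~ x) (lie_linearl x).
  pose F : {linear g -> g} := HB.pack (lie^~ x) f.
  rewrite (coord_vbasis hk) -[LHS]/(F _) linear_sum big1 // => i _.
  rewrite linearZ /=; have := xC i isT; rewrite -memvE memv_ker lfunE /=.
  by move=> /eqP ->; rewrite scaler0.
by rewrite -memvE memv_ker lfunE /= xC // vbasis_mem // mem_nth // size_tuple.
Qed.

Definition diagonalizable_endo (f : g -> g) :=
  exists b : seq g,
    basis_of fullv b /\ forall x, x \in b -> exists c : K, f x = c *: x.

(* For a reductive Lie algebra over an algebraically closed field of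
   characteristic 0: a maximal abelian subalgebra whose elements act
   semisimply in the adjoint representation. *)
Definition cartan_subalgebra a :=
  [/\ forall h h', h \in a -> h' \in a -> lie h h' = 0,
      forall x, (forall h, h \in a -> lie h x = 0) -> x \in a
    & forall h, h \in a -> diagonalizable_endo (lie h)].

Variable pi : 'Hom(g, 'M[K]_N).

Definition representation :=
  forall x y, pi (lie x y) = pi x *m pi y - pi y *m pi x.

Definition faithful := injective pi.

Definition submodule_of k W :=
  forall x v, x \in k -> v \in W -> pi x *m v \in W.

Definition irreducible_for k W :=
  [/\ submodule_of k W, W <> 0%VS
    & forall W', (W' <= W)%VS -> submodule_of k W' -> W' = 0%VS \/ W' = W].

Definition trform x y : K := \tr (pi x *m pi y).

Lemma trformC x y : trform x y = trform y x.
Proof. exact: mxtrace_mulC. Qed.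

Lemma trform_linear x : linear (trform x : g -> K^o).
Proof.
move=> c y z.
by rewrite /trform linearP /= mulmxDr -scalemxAr mxtraceD mxtraceZ.
Qed.

HB.instance Definition _ x :=
  GRing.isLinear.Build K g K^o _ (trform x : g -> K^o) (trform_linear x).

Definition orthogonal k : {vspace g} :=
  (\bigcap_(i < \dim k) lker (linfun (trform (vbasis k)`_i : g -> K^o)))%VS.

Lemma orthogonalP k x :
  reflect (forall h, h \in k -> trform x h = 0) (x \in orthogonal k).
Proof.
rewrite memvE; apply: (iffP subv_bigcapP) => [xC h hk|xC i _].
  rewrite (coord_vbasis hk) -[LHS]/((trform x : {linear g -> K^o}) _).
  rewrite linear_sum big1 // => i _.
  rewrite linearZ /=; have := xC i isT; rewrite -memvE memv_ker lfunE /=.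
  by rewrite trformC => /eqP ->; rewrite scaler0.
rewrite -memvE memv_ker lfunE /= trformC xC // vbasis_mem // mem_nth //.
by rewrite size_tuple.
Qed.

(* The orthogonal projection of gl_N onto pi(g) for the form Trace XY, read as
   a map into g through the faithful representation pi. *)
Definition orthogonal_projection (p : 'Hom('M[K]_N, g)) :=
  forall A y, \tr ((A - pi (p A)) *m pi y) = 0.

Variable a : {vspace g}.

Definition dual k := 'Hom(subvs_of k, K^o).

Definition root_vector (alpha : dual a) x :=
  x != 0 /\ forall h : subvs_of a, lie (vsval h) x = (alpha h : K) *: x.

Definition root_system : set (dual a) :=
  [set alpha | alpha != 0 /\ exists x, root_vector alpha x].

Definition nat_comb (Psi : seq (dual a)) (alpha : dual a) :=
  exists c : dual a -> nat, alpha = \sum_(beta <- Psi) beta *+ c beta.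

Definition simple_system (Psi : {fset dual a}) :=
  [/\ free Psi, forall alpha, alpha \in Psi -> root_system alpha
    & forall alpha, root_system alpha ->
        nat_comb Psi alpha \/ nat_comb Psi (- alpha)].

Definition positive_roots (Psi : {fset dual a}) : set (dual a) :=
  [set alpha | root_system alpha /\ nat_comb Psi alpha].

Definition rho (Psi : {fset dual a}) : dual a :=
  2^-1 *: \sum_(alpha \in positive_roots Psi) alpha.

(* The isomorphism a -> a^* given by the trace form, its inverse and the
   induced form on a^*. *)
Definition flat : 'Hom(subvs_of a, dual a) :=
  linfun (fun h => linfun (fun h' => trform (vsval h) (vsval h') : K^o)).

Lemma flatE h h' : flat h h' = trform (vsval h) (vsval h').
Proof.
have lin1 (u : subvs_of a) :
    linear (fun v' : subvs_of a => trform (vsval u) (vsval v') : K^o).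
  by move=> c x y; rewrite !linearP.
pose F1 u := GRing.isLinear.Build K (subvs_of a) K^o _ _ (lin1 u).
pose G1 u : {linear subvs_of a -> K^o} :=
  HB.pack (fun v' : subvs_of a => trform (vsval u) (vsval v') : K^o) (F1 u).
have lin2 : linear (fun u : subvs_of a => linfun (G1 u)).
  move=> c x y; apply/lfunP => z; rewrite add_lfunE scale_lfunE !lfunE /=.
  by rewrite trformC !linearP /= ![trform (vsval z) _]trformC.
pose F2 := GRing.isLinear.Build K (subvs_of a) (dual a) _ _ lin2.
pose G2 : {linear subvs_of a -> dual a} :=
  HB.pack (fun u : subvs_of a => linfun (G1 u)) F2.
have -> : flat = linfun G2 by [].
by rewrite !lfunE.
Qed.

Definition sharp (alpha : dual a) : g := vsval ((flat^-1)%VF alpha).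

Definition dform (alpha beta : dual a) : K := trform (sharp alpha) (sharp beta).

Definition weight_vector (varpi : dual a) (v : 'cV[K]_N) :=
  v != 0 /\ forall h : subvs_of a, pi (vsval h) *m v = (varpi h : K) *: v.

Variable X : dual a -> g.

(* The root vector X_{-alpha} is X (- alpha); P is the set of positive roots of
   the algebra under which W is irreducible. *)
Definition lowest_weight (P : set (dual a)) W (varpi : dual a) :=
  exists v, [/\ v \in W, weight_vector varpi v
    & forall alpha, P alpha -> pi (X (- alpha)) *m v = 0].

Variables Psi Theta : {fset dual a}.

Definition aT : {vspace g} :=
  (linfun (@vsval _ _ a) @: \bigcap_(alpha : Theta) lker (val alpha))%VS.

Lemma aTP x : x \in aT <->
  exists2 h : subvs_of a, x = vsval h &
    forall alpha, alpha \in Theta -> alpha h = 0.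
Proof.
split=> [/memv_imgP[h hT ->]|[h -> hT]].
  exists h; first by rewrite lfunE.
  move=> alpha alphaT; apply/eqP; rewrite -memv_ker.
  move: hT; rewrite memvE => /subv_bigcapP/(_ [` alphaT]%fset isT).
  by rewrite -memvE.
apply/memv_imgP; exists h; last by rewrite lfunE.
rewrite memvE; apply/subv_bigcapP => alpha _; rewrite -memvE memv_ker.
by apply/eqP/hT/valP.
Qed.

Definition gT : {vspace g} := centralizer aT.

Definition mT : {vspace g} := (gT :&: orthogonal aT)%VS.

Definition rootsT : set (dual a) :=
  [set alpha | root_system alpha /\
     forall h : subvs_of a, vsval h \in aT -> alpha h = 0].

Definition positive_rootsT : set (dual a) := rootsT `&` positive_roots Psi.

Definition nT : {vspace g} :=
  \big[addv/0%VS]_(alpha \in positive_roots Psi `\` rootsT) <[X alpha]>%VS.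

Definition pT : {vspace g} := (gT + nT)%VS.

(* lambda_Theta, as a linear form on g; only its values on pT = aT + (mT + nT)
   matter. *)
Definition lamT (lam : dual aT) : 'Hom(g, K^o) :=
  (lam \o linfun (vsproj aT) \o daddv_pi aT (mT + nT))%VF.

Definition lamT_a (lam : dual aT) : dual a :=
  (lamT lam \o linfun (@vsval _ _ a))%VF.

Definition JT (lam : dual aT) : set (Ug g) :=
  [set u | exists2 x, x \in pT & u = Uinj x - (lamT lam x : K)%:A].

Definition MT (lam : dual aT) := lquot (JT lam).

Definition Fpi (p : 'Hom('M[K]_N, g)) : 'M[Ug g]_N :=
  \matrix_(i, j) Uinj (p (delta_mx i j)).

Definition eval_mx (q : {poly K}) (F : 'M[Ug g]_N) : 'M[Ug g]_N :=
  \sum_(k < size q) map_mx ( *:%R q`_k) (F ^+ k).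

Definition lowest_weightsT : set (dual a) :=
  [set varpi | exists2 W, irreducible_for gT W
                        & lowest_weight positive_rootsT W varpi].

Definition Dpi (pibar varpi : dual a) : K :=
  2^-1 * dform (pibar - varpi) (pibar + varpi - 2 *: rho Psi).

Definition restrT (varpi : dual a) : 'Hom(dual aT, K^o) :=
  linfun (fun lam => dform (lamT_a lam) varpi : K^o).

Lemma restrTE varpi lam : restrT varpi lam = dform (lamT_a lam) varpi.
Proof.
have lin : linear (fun lam => dform (lamT_a lam) varpi : K^o).
  move=> c x y; rewrite /dform.
  have -> : lamT_a (c *: x + y) = c *: lamT_a x + lamT_a y.
    apply/lfunP => h.
    by rewrite !(add_lfunE, scale_lfunE, comp_lfunE).
  rewrite /sharp (linearP (flat^-1)%VF) (linearP (@vsval _ _ a)).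
  rewrite ![trform _ (vsval ((flat^-1)%VF varpi))]trformC.
  exact: trform_linear.
pose F := GRing.isLinear.Build K (dual aT) K^o _ _ lin.
pose G : {linear dual aT -> K^o} :=
  HB.pack (fun lam => dform (lamT_a lam) varpi : K^o) F.
have -> : restrT varpi = linfun G by [].
by rewrite lfunE.
Qed.

Definition Omega (pibar : dual a) : set ('Hom(dual aT, K^o) * K) :=
  [set (restrT varpi, Dpi pibar varpi) | varpi in lowest_weightsT].

Definition q_pi_Theta (pibar : dual a) (lam : dual aT) : {poly K} :=
  \big[*%R/1]_(mC \in Omega pibar) ('X - (mC.1 lam : K)%:P - mC.2%:P).

End Setting.

(* Main.v *)
From HB Require Import structures.
From mathcomp Require Import all_boot all_order all_algebra finmap.
From mathcomp Require Import all_classical reals complex.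
From mathcomp Require Import generic_quotient ring_quotient ring.
Require Import Defs.

(** Let D(y) = y - pi(y)^T, for y in g, act on columns over U(g): this is the diagonal
action of g on the tensor product of the dual of V and U(g). Up to sign F_pi is the
split Casimir element of this tensor product, so it commutes with every D(y)
([F_act_diag_act]). The columns that q(F_pi) sends into J_Theta(lambda) are therefore
stable under the D(y), and they are all the columns as soon as they include the
scalar ones ([killed_generate]).

On a scalar column v, expanding the entries of F_pi along a and the root vectors gives,
modulo J_Theta(lambda),
  F v = Z^T v + sum_b D(X_(-b)) pi(X_b)^T v / <X_b, X_(-b)>,   Z = pi(H_lambda) + T,
where b runs over the roots of n_Theta, H_lambda represents lambda, and T is the image
in End V of the canonical element of n_Theta tensored with its opposite
([F_act_tensor1]). Let H_0 in a_Theta take the value 1 at the simple roots outside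
Theta. The eigenspaces of pi(H_0)^T cut the scalar columns into layers, and the second
term comes from lower layers. By induction on the layers ([layer_step],
[killed_columns]) it is enough that on the eigenspace of pi(H_0) for e the operator Z
be killed by the product of the x - mu(lambda) - C over the (mu, C) in Omega such that
mu(lambda_0) = e, where lambda_0 corresponds to H_0. Every element of Omega belongs to
one layer, which is why it needs to occur only once.

The operator Z commutes with g_Theta. Comparing the Casimir element of g, which is a
scalar on V, with its expression on a lowest weight vector for g_Theta of weight w shows
that Z acts on this vector by w(H_lambda) + D_pi(w) ([nil_casimir_low]). To conclude one
needs that Z is semisimple and that w is the lowest weight of an irreducible
g_Theta-module. Both follow from one fact, proved without complete reducibility: if w
and w - b are weights of lowest weight vectors for g_Theta, where b is a sum of roots in
Theta, and D_pi takes the same value at both, then b = 0 ([low_weights_separated]),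
because the simple roots c in Theta satisfy <c, w> <= 0 by sl2-theory and
<c, 2 rho> = <c, c> > 0 ([two_rho_simple], [root_length_gt0]). See [layer_poly_weight]
and [low_weight_irreducible].

The root theory that this uses is derived from the trace form. It is nondegenerate
because p exists ([trform_nondegenerate]), the Cartan subalgebra acts diagonally on V
because the span of the weight vectors is a submodule ([V_weight_basis]), and a single
computation with a raising and a lowering operator ([sl2_lowest_weight]) excludes
isotropic roots, gives one-dimensional root spaces and the integrality of weights. *)

Set Implicit Arguments.
Unset Strict Implicit.
Unset Printing Implicit Defensive.

Import Order.TTheory GRing.Theory Num.Theory.
Local Open Scope ring_scope.

(** * Polynomials in a linear map *)
Section PolynomialAction.
Variables (K : fieldType) (V : lmodType K).
Implicit Types (p q : {poly K}) (f g : {linear V -> V}) (v w : V).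

(** Written with iterates so that it applies alike to matrices on V and to F_pi acting on
columns over U(g). *)
Definition polyact q (f : V -> V) v := \sum_(k < size q) q`_k *: iter k f v.

Lemma polyact_widen q (f : V -> V) v n : (size q <= n)%N ->
  polyact q f v = \sum_(k < n) q`_k *: iter k f v.
Proof.
move=> le_n; rewrite /polyact (big_ord_widen n (fun k => q`_k *: iter k f v) le_n).
rewrite big_mkcond; apply: eq_bigr => k _; case: ltnP => // le_k.
by rewrite nth_default ?scale0r.
Qed.

Lemma polyactD p q (f : V -> V) v : polyact (p + q) f v = polyact p f v + polyact q f v.
Proof.
pose n := maxn (size p) (size q).
rewrite (@polyact_widen p f v n) ?leq_maxl // (@polyact_widen q f v n) ?leq_maxr //.
rewrite (@polyact_widen (p + q) f v n) ?size_polyD // -big_split.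
by apply: eq_bigr => k _; rewrite coefD scalerDl.
Qed.

Lemma polyactC c (f : V -> V) v : polyact c%:P f v = c *: v.
Proof. by rewrite (@polyact_widen _ f v 1) ?size_polyC_leq1 // big_ord1 coefC. Qed.

Lemma polyactMX q (f : V -> V) v : polyact (q * 'X) f v = polyact q f (f v).
Proof.
have le : (size (q * 'X)%R <= (size q).+1)%N.
  by apply: leq_trans (size_polyMleq _ _) _; rewrite size_polyX addn2.
rewrite (polyact_widen f v le) big_ord_recl coefMX scale0r add0r.
by apply: eq_bigr => k _; rewrite coefMX /= -iterS iterSr.
Qed.

Lemma polyact_comm q (f : V -> V) g v :
  (forall w, g (f w) = f (g w)) -> g (polyact q f v) = polyact q f (g v).
Proof.
move=> fg; rewrite linear_sum; apply: eq_bigr => k _; rewrite linearZ; congr (_ *: _).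
by elim: (nat_of_ord k) => //= j <-.
Qed.

Lemma polyactM p q f v : polyact (p * q) f v = polyact p f (polyact q f v).
Proof.
elim/poly_ind: p v => [|p c IH] v; first by rewrite mul0r /polyact size_poly0 !big_ord0.
rewrite mulrDl -mulrA (mulrC 'X) mulrA !polyactD !polyactMX IH mul_polyC; congr (_ + _).
  by congr (polyact p f _); rewrite (@polyact_comm q f f).
rewrite polyactC (@polyact_widen (c *: q) f v (size q)) ?size_scale_leq // /polyact scaler_sumr.
by apply: eq_bigr => k _; rewrite coefZ scalerA.
Qed.

Lemma polyact_linear q f c v w : polyact q f (c *: v + w) = c *: polyact q f v + polyact q f w.
Proof.
rewrite /polyact scaler_sumr -big_split; apply: eq_bigr => k _ /=.
rewrite !scalerA mulrC -scalerA -scalerDr; congr (_ *: _).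
by elim: (nat_of_ord k) => //= j ->; rewrite linearP.
Qed.

Lemma polyact0r q f : polyact q f 0 = 0.
Proof. by have := polyact_linear q f (-1) 0 0; rewrite !scaleN1r oppr0 addr0 addNr. Qed.

Lemma polyactDr q f v w : polyact q f (v + w) = polyact q f v + polyact q f w.
Proof. by have := polyact_linear q f 1 v w; rewrite !scale1r. Qed.

Lemma polyactZr q f c v : polyact q f (c *: v) = c *: polyact q f v.
Proof. by have := polyact_linear q f c v 0; rewrite polyact0r !addr0. Qed.

Lemma polyact_stable (P : V -> Prop) q (f : V -> V) v : P 0 ->
  (forall v w, P v -> P w -> P (v + w)) -> (forall c v, P v -> P (c *: v)) ->
  (forall v, P v -> P (f v)) -> P v -> P (polyact q f v).
Proof.
move=> P0 PD PZ Pf Pv; apply: big_ind => // k _; apply: PZ.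
by elim: (nat_of_ord k) => //= j; apply: Pf.
Qed.

Lemma polyact_XsubC c f v : polyact ('X - c%:P) f v = f v - c *: v.
Proof. by rewrite polyactD -polyCN polyactC scaleNr -['X]mul1r polyactMX polyactC scale1r. Qed.

End PolynomialAction.

(** * Sums and counts over sequences *)
Lemma sum_subset (T : eqType) (W : nmodType) (r s : seq T) (F : T -> W) :
  uniq r -> uniq s -> {subset s <= r} ->
  (forall x, x \in r -> x \notin s -> F x = 0) ->
  \sum_(x <- r) F x = \sum_(x <- s) F x.
Proof.
move=> ur us sr F0; rewrite (bigID (mem s)) /= [X in _ + X]big_seq_cond.
rewrite [X in _ + X]big1 ?addr0 => [|x /andP[xr xs]]; last exact: F0.
rewrite -big_filter; apply: perm_big; apply: uniq_perm; rewrite ?filter_uniq //.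
by move=> x; rewrite mem_filter; case: (boolP (x \in s)) => // /sr.
Qed.

Lemma ltn_count (T : eqType) (P Q : pred T) (s : seq T) x :
  subpred P Q -> x \in s -> Q x -> ~~ P x -> (count P s < count Q s)%N.
Proof.
move=> PQ xs Qx nPx; rewrite -(size_filter Q) -(count_predC P) -!size_filter.
rewrite -filter_predI (eq_filter (a2 := P)) => [|y]; last first.
  by rewrite /=; case: (boolP (P y)) => // /PQ ->.
by rewrite -addn1 leq_add2l size_filter -has_count; apply/hasP; exists x; rewrite ?mem_filter ?Qx.
Qed.

(** * Eigenvectors, sl2 and traces *)
Section LinearAlgebra.
Variables (K : numFieldType) (vT : vectType K).
Implicit Types (W : {vspace vT}) (P : vT -> Prop).

(** Take a subspace of maximal dimension on which [P] holds: a vector satisfying [P]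
outside it could be added to it. *)
Lemma vspace_of_pred P :
    P 0 -> (forall c x y, P x -> P y -> P (c *: x + y)) ->
  exists W : {vspace vT}, forall v, v \in W <-> P v.
Proof.
move=> P0 Plin.
pose Q n := `[< exists W : {vspace vT}, \dim W = n /\ forall v, v \in W -> P v >].
have Q0 : exists n, Q n.
  exists 0%N; apply/asboolP; exists 0%VS; split; first exact: dimv0.
  by move=> v; rewrite memv0 => /eqP ->.
have Qb n : Q n -> (n <= \dim (fullv : {vspace vT}))%N.
  by move=> /asboolP[W [<- _]]; rewrite dimvS ?subvf.
case: (ex_maxnP Q0 Qb) => n /asboolP[W [dW WP]] nmax.
exists W => v; split=> [/WP //|Pv]; apply: contrapT => vW.
have : Q (\dim (W + <[v]>)%VS).
  apply/asboolP; exists (W + <[v]>)%VS; split=> // u /memv_addP[w /WP Pw [_ /vlineP[c ->] ->]].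
  by rewrite addrC; apply: Plin.
move=> /nmax; rewrite -dW leqNgt => /negP; apply.
rewrite (ltn_leqif (dimv_leqif_sup (addvSl W <[v]>))); apply/negP => sW.
by apply: vW; rewrite memvE (subv_trans (addvSr W _) sW).
Qed.

(** A free family of maximal length inside [P] spans every vector satisfying [P]. *)
Lemma exists_basis_in P :
    (forall W, (forall v, P v -> v \in W) -> W = fullv) ->
  exists b : seq vT, basis_of fullv b /\ forall x, x \in b -> P x.
Proof.
move=> Pspan.
pose Q n := `[< exists b : seq vT, [/\ size b = n, free b & forall x, x \in b -> P x] >].
have Q0 : exists n, Q n by exists 0%N; apply/asboolP; exists [::]; rewrite nil_free.
have Qb n : Q n -> (n <= \dim (fullv : {vspace vT}))%N.
  by move=> /asboolP[b [<- /eqP <- _]]; rewrite dimvS ?subvf.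
case: (ex_maxnP Q0 Qb) => n /asboolP[b [sb fb bP]] nmax.
exists b; split=> //; rewrite basisEfree fb subvf /=.
rewrite (_ : fullv = <<b>>)%VS ?(eqnP fb) //; apply/esym/Pspan => v Pv.
apply: contrapT => /negP vb; have : Q (size (v :: b)).
  apply/asboolP; exists (v :: b); split=> // [|x]; first by rewrite free_cons vb.
  by rewrite inE => /predU1P[-> //|/bP].
by move=> /nmax /=; rewrite sb ltnn.
Qed.

(** Applying [f h - ev k h] to the sum removes the summand of index [k] and multiplies
the one of index [i0] by a nonzero scalar, for a suitable [h]; so the number of
summands can be decreased. For [W = 0] this is the independence of weight vectors. *)
Lemma weight_component (I : eqType) (H : Type) (ev : I -> H -> K)
    (f : H -> {linear vT -> vT}) (W : {vspace vT}) (s : seq I) (x : I -> vT) i0 :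
    (forall i j, i != j -> exists h, ev i h != ev j h) ->
    (forall h v, v \in W -> f h v \in W) ->
    uniq s -> (forall i, i \in s -> forall h, f h (x i) = ev i h *: x i) ->
    \sum_(i <- s) x i \in W -> i0 \in s -> x i0 \in W.
Proof.
move=> sep fW us xw.
have [n] := ubnP (size s); elim: n => // n IH in s x us xw *.
case: (s) us xw => [|i [|j r]] //.
  by rewrite big_seq1 inE => _ _ _ xW /eqP ->.
move=> us xw sn xW i0s.
have red k : k \in [:: i, j & r] -> k != i0 -> x i0 \in W.
  move=> ks ki0; have [h hne] := sep _ _ ki0.
  pose y l := (ev l h - ev k h) *: x l.
  have := IH (rem k [:: i, j & r]) y.
  rewrite rem_uniq // => /(_ isT); have yw l : l \in rem k [:: i, j & r] ->
      forall h', f h' (y l) = ev l h' *: y l.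
    by move=> /mem_rem ls h'; rewrite /y linearZ /= xw // !scalerA mulrC.
  move=> /(_ yw); rewrite size_rem // => /(_ sn).
  have -> : \sum_(l <- rem k [:: i, j & r]) y l =
            f h (\sum_(l <- [:: i, j & r]) x l) - ev k h *: \sum_(l <- [:: i, j & r]) x l.
    have -> : \sum_(l <- rem k [:: i, j & r]) y l = \sum_(l <- [:: i, j & r]) y l.
      by rewrite [RHS](big_rem k ks) /= /y subrr scale0r add0r.
    rewrite linear_sum scaler_sumr -sumrB; apply: eq_big_seq => l ls.
    by rewrite xw // /y scalerBl.
  move=> IHk; have : y i0 \in W.
    apply: IHk; first by rewrite rpredB ?rpredZ ?fW.
    by rewrite -[_ \in _]/(i0 \in rem k [:: i, j & r]) mem_rem_uniq // inE eq_sym ki0.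
  by rewrite rpredZeq subr_eq0 [_ == _]eq_sym (negPf hne).
have [ei|ne] := eqVneq i i0; last by apply: red ne; rewrite inE eqxx.
apply: (red j); first by rewrite !inE eqxx orbT.
by rewrite -ei; move: us; rewrite /= inE negb_or eq_sym => /andP[/andP[]].
Qed.

Lemma weight_eq0 (I : eqType) (H : Type) (ev : I -> H -> K)
    (f : H -> {linear vT -> vT}) (s : seq I) (x : I -> vT) i0 :
    (forall i j, i != j -> exists h, ev i h != ev j h) ->
    uniq s -> (forall i, i \in s -> forall h, f h (x i) = ev i h *: x i) ->
    \sum_(i <- s) x i = 0 -> i0 \in s -> x i0 = 0.
Proof.
move=> sep us xw x0 i0s; apply/eqP; rewrite -memv0.
apply: (weight_component (W := 0%VS) sep _ us xw) => //.
  by move=> h v; rewrite !memv0 => /eqP ->; rewrite linear0.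
by rewrite x0 mem0v.
Qed.

Lemma weight_decomposition (I : eqType) (H : Type) (ev : I -> H -> K)
    (f : H -> {linear vT -> vT}) (b : seq vT) (lab : vT -> I) (v : vT) :
    basis_of fullv b ->
    (forall x, x \in b -> forall h, f h x = ev (lab x) h *: x) ->
  exists y : I -> vT, (forall i h, f h (y i) = ev i h *: y i) /\
    v = \sum_(i <- undup (map lab b)) y i.
Proof.
move=> bb bw; have := memvf v; rewrite -(span_basis bb) => /(@coord_span _ _ _ (in_tuple b)) vE.
pose c (i : I) (k : 'I_(size b)) : vT :=
  if lab b`_k == i then coord (in_tuple b) k v *: b`_k else 0.
exists (fun i => \sum_k c i k); split.
  move=> i h; rewrite linear_sum scaler_sumr; apply: eq_bigr => k _; rewrite /c.
  case: eqP => [<-|_]; last by rewrite linear0 scaler0.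
  by rewrite linearZ /= bw ?mem_nth // !scalerA mulrC.
rewrite exchange_big {1}vE; apply: eq_bigr => k _ /=.
rewrite (bigD1_seq (lab b`_k)) ?undup_uniq //=; last first.
  by rewrite mem_undup map_f // mem_nth.
rewrite {1}/c eqxx big1 ?addr0 //= => i; rewrite /c eq_sym => /negPf ->.
by [].
Qed.

(** The components of a joint eigenvector of [fs] along the eigenspaces of one more
map [f] are again joint eigenvectors of [fs], because the joint eigenspaces of [fs]
are stable under [f]. *)
Lemma joint_eigenbasis (fs : seq 'End(vT)) :
    {in fs &, forall f h : 'End(vT), forall v, f (h v) = h (f v)} ->
    (forall f : 'End(vT), f \in fs -> exists b : seq vT,
       basis_of fullv b /\ forall x, x \in b -> exists c : K, f x = c *: x) ->
  exists b : seq vT, basis_of fullv b /\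
    forall x, x \in b -> forall f : 'End(vT), f \in fs -> exists c : K, f x = c *: x.
Proof.
elim: fs => [|f fs IH] comm diag.
  by exists (vbasis fullv); rewrite vbasisP.
have [||b [bb bP]] := IH.
- by move=> h k hfs kfs; apply: comm; rewrite inE ?hfs ?kfs orbT.
- by move=> h hfs; apply: diag; rewrite inE hfs orbT.
apply: exists_basis_in => W WP; apply/eqP; rewrite eqEsubv subvf andTb.
rewrite -(span_basis bb); apply/span_subvP => x xb.
have /choice[d dP] (h : 'End(vT)) : exists c : K, h \in fs -> h x = c *: x.
  case: (boolP (h \in fs)) => [hfs|_]; last by exists 0.
  by have [c e] := bP _ xb _ hfs; exists c.
have [Wd WdP] : exists Wd : {vspace vT}, forall v, v \in Wd <->
    (forall h : 'End(vT), h \in fs -> h v = d h *: v).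
  apply: vspace_of_pred => [h _|c u v hu hv h hfs].
    by rewrite linear0 scaler0.
  by rewrite linearP /= hu // hv // scalerDr !scalerA mulrC.
have fWd v : v \in Wd -> f v \in Wd.
  move=> /WdP vW; apply/WdP => h hfs.
  by rewrite comm ?inE ?eqxx ?hfs ?orbT // vW // linearZ.
have [b' [bb' b'P]] := diag f (mem_head _ _).
have /choice[l lP] (y : vT) : exists c : K, y \in b' -> f y = c *: y.
  case: (boolP (y \in b')) => [yb|_]; last by exists 0.
  by have [c e] := b'P _ yb; exists c.
have [y [yw xE]] := @weight_decomposition K unit (fun c _ => c) (fun=> f) b' l x bb'
  (fun z zb _ => lP z zb).
rewrite xE big_seq; apply: rpred_sum => c cl; apply: WP => h.
rewrite inE => /predU1P[->|hfs]; first by exists c; apply: (yw c tt).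
exists (d h); suff yW : y c \in Wd by apply: (proj1 (WdP (y c)) yW).
have sep (i j : K) : i != j -> exists _ : unit, i != j by exists tt.
apply: (weight_component (ev := fun c _ => c) (f := fun=> f) sep (fun=> fWd)
  (undup_uniq _) _ _ cl) => [i _ ?|]; first exact: (yw i tt).
by rewrite -xE; apply/WdP => k kfs; apply: dP.
Qed.

(** For an sl2-triple this is the classical formula for f e^(k+1) v. It is stated for
any [t] because the case [t = 0], where [e] and [f] generate a Heisenberg algebra,
is the one that excludes isotropic roots. *)
Lemma lowering_raised (e f : {linear vT -> vT}) (v : vT) (m t : K) :
    f v = 0 ->
    (forall k, e (f (iter k e v)) - f (e (iter k e v)) =
               (m + k%:R * t) *: iter k e v) ->
  forall k, f (iter k.+1 e v) = - (k.+1%:R * (m + k%:R * t / 2)) *: iter k e v.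
Proof.
move=> fv0 comm; elim=> [|k IH].
  have := comm 0%N; rewrite /= fv0 linear0 sub0r => /eqP.
  rewrite eqr_oppLR => /eqP ->; rewrite -scaleNr; congr (_ *: _); ring.
have := comm k.+1; rewrite IH linearZ /= => E.
rewrite -[LHS](subKr (- (k.+1%:R * (m + k%:R * t / 2)) *: e (iter k e v))) E.
rewrite -scalerBl; congr (_ *: _).
by field.
Qed.

(** At the last [k] such that e^k v is nonzero the scalar of [lowering_raised] vanishes. *)
Lemma sl2_lowest_weight (e f : {linear vT -> vT}) (v : vT) (m t : K) :
    v != 0 -> f v = 0 ->
    (forall k, e (f (iter k e v)) - f (e (iter k e v)) =
               (m + k%:R * t) *: iter k e v) ->
    (exists k, iter k e v = 0) ->
  exists k : nat, m = - (k%:R * t / 2).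
Proof.
move=> v0 fv0 comm [k0 ek0].
have ex : exists k, iter k e v == 0 by exists k0; apply/eqP.
case: (ex_minnP ex) => [[|k]]; first by rewrite /= (negPf v0).
move=> /eqP ek1 kmin; exists k.
have := lowering_raised fv0 comm k; rewrite ek1 linear0 => /esym/eqP.
rewrite scaler_eq0 => /orP[|/kmin]; last by rewrite ltnn.
by rewrite oppr_eq0 mulf_eq0 pnatr_eq0 /= addr_eq0 => /eqP.
Qed.

Lemma span_stable (b : seq vT) (f : {linear vT -> vT}) (W : {vspace vT}) :
  (forall x, x \in b -> f x \in W) -> forall v, v \in <<b>>%VS -> f v \in W.
Proof.
move=> fb v /(@coord_span _ _ _ (in_tuple b)) ->; rewrite linear_sum.
by apply: rpred_sum => i _; rewrite linearZ /= rpredZ // fb // mem_nth.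
Qed.

(** The left-hand side is the trace of the commutator of the restrictions of [e] and
[f] to [U]. *)
Lemma commutator_trace0 (s : seq (vT * K)) (e f : {linear vT -> vT})
    (U := <<unzip1 s>>%VS) :
    free (unzip1 s) -> (forall v, v \in U -> e v \in U) ->
    (forall v, v \in U -> f v \in U) ->
    (forall u, u \in s -> e (f u.1) - f (e u.1) = u.2 *: u.1) ->
  \sum_(u <- s) u.2 = 0.
Proof.
move=> fs eU fU ef.
pose bt := map_tuple fst (in_tuple s); have fb : free bt := fs.
pose mx (h : vT -> vT) : 'M[K]_(size s) := \matrix_(i, j) coord bt j (h bt`_i).
have cE v : v \in U -> v = \sum_i coord bt i v *: bt`_i by move=> /(@coord_span _ _ _ bt).
have bU (i : 'I_(size s)) : bt`_i \in U by rewrite memv_span // mem_nth // size_tuple.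
have mxM (h k : {linear vT -> vT}) : (forall v, v \in U -> h v \in U) ->
    mx (k \o h) = mx h *m mx k.
  move=> hU; apply/matrixP => i j; rewrite !mxE /= {1}(cE (h bt`_i)) ?hU //.
  rewrite (linear_sum k) (linear_sum (coord bt j)) /=; apply: eq_bigr => l _.
  by rewrite !mxE !linearZ.
have : \tr (mx f *m mx e - mx e *m mx f) = 0.
  by rewrite raddfB /= mxtrace_mulC subrr.
move=> tr0; rewrite -[RHS]tr0 -!mxM // /mxtrace (big_nth (0, 0)) big_mkord.
apply: eq_bigr => i _.
rewrite !mxE -linearB /=; have <- : (s`_i).1 = bt`_i by rewrite (nth_map (0, 0)).
rewrite ef ?mem_nth // linearZ /= (_ : (s`_i).1 = bt`_i) ?coord_free ?eqxx ?mulr1 //.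
by rewrite (nth_map (0, 0)).
Qed.

End LinearAlgebra.

(** * Weight vectors of an abelian subalgebra *)
Section Weights.
Variables (K : numFieldType) (g : lieAlgType K) (a : {vspace g}).
Implicit Types (h : subvs_of a) (al nu : dual a).

Lemma dualP nu nu' : (forall h, nu h = nu' h :> K) -> nu = nu'.
Proof. by move=> e; apply/lfunP => h; apply: e. Qed.

Lemma dual_sep nu nu' : nu != nu' -> exists h, (nu h : K) != nu' h.
Proof.
move=> ne; apply: contrapT => nex; move/eqP: ne; apply; apply: dualP => h.
by apply: contrapT => /eqP e; apply: nex; exists h.
Qed.

Lemma dualD nu nu' h : ((nu + nu') h : K) = (nu h : K) + nu' h.
Proof. by rewrite add_lfunE. Qed.
Lemma dualN nu h : ((- nu) h : K) = - (nu h : K).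
Proof. by rewrite opp_lfunE. Qed.
Lemma dualMn nu n h : ((nu *+ n) h : K) = (nu h : K) *+ n.
Proof. by elim: n => [|n IH]; rewrite ?mulr0n ?lfunE // !mulrS dualD IH. Qed.
Lemma dual_sum (I : Type) (r : seq I) (P : pred I) (F : I -> dual a) h :
  ((\sum_(i <- r | P i) F i) h : K) = \sum_(i <- r | P i) (F i h : K).
Proof. by rewrite sum_lfunE. Qed.

Section Module.
Variables (vT : vectType K) (act : g -> {linear vT -> vT}).

Definition has_weight nu (v : vT) := forall h, act (vsval h) v = (nu h : K) *: v.

Hypothesis act_lie : forall x y v,
  act (lie x y) v = act x (act y v) - act y (act x v).

Lemma has_weight0 nu : has_weight nu 0. Proof. by move=> h; rewrite linear0 scaler0. Qed.

Lemma has_weightZ nu c v : has_weight nu v -> has_weight nu (c *: v).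
Proof. by move=> w h; rewrite linearZ /= w !scalerA mulrC. Qed.

Lemma has_weight_inj nu nu' v : v != 0 -> has_weight nu v -> has_weight nu' v -> nu = nu'.
Proof.
move=> v0 w w'; apply: dualP => h; apply/eqP; rewrite -subr_eq0.
have : ((nu h : K) - nu' h) *: v == 0 by rewrite scalerBl -w -w' subrr.
by rewrite scaler_eq0 (negPf v0) orbF.
Qed.

Lemma has_weight_act al nu x v :
  (forall h, lie (vsval h) x = (al h : K) *: x) -> has_weight nu v ->
  (forall c y w, act (c *: y) w = c *: act y w) ->
  has_weight (nu + al) (act x v).
Proof.
move=> wx wv actZ h; have := act_lie (vsval h) x v; rewrite wx actZ wv linearZ /=.
by move/eqP; rewrite eq_sym subr_eq => /eqP ->; rewrite dualD scalerDl addrC.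
Qed.

Hypothesis actZ : forall c y w, act (c *: y) w = c *: act y w.

Variable b : seq vT.
Hypothesis b_basis : basis_of fullv b.
Hypothesis b_wt : forall x, x \in b -> exists nu, has_weight nu x.

Lemma has_weight_label : exists lab : vT -> dual a, forall x, x \in b -> has_weight (lab x) x.
Proof.
suff /choice[lab labP] : forall x, exists nu, x \in b -> has_weight nu x by exists lab.
move=> x; case: (boolP (x \in b)) => [xb|_]; last by exists 0.
by have [nu w] := b_wt xb; exists nu.
Qed.

Lemma has_weight_decomp : exists2 ws : seq (dual a), uniq ws &
  forall v, exists y : dual a -> vT, (forall nu, has_weight nu (y nu)) /\
    v = \sum_(nu <- ws) y nu.
Proof.
have [lab labP] := has_weight_label; exists (undup (map lab b)); first exact: undup_uniq.
move=> v; have [y [yw vE]] := weight_decomposition (I := dual a)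
  (ev := fun nu h => (nu h : K)) (f := fun h => act (vsval h)) v b_basis labP.
by exists y.
Qed.

Lemma has_weight_finite : exists ws : seq (dual a), forall nu v, v != 0 -> has_weight nu v -> nu \in ws.
Proof.
have [ws uws dec] := has_weight_decomp; exists ws => nu v v0 wv.
apply: contraNT v0 => nuws; have [y [yw vE]] := dec v.
rewrite -oppr_eq0; apply/eqP; pose x i := if i == nu then - v else y i.
have -> : - v = x nu by rewrite /x eqxx.
apply: (weight_eq0 (ev := fun nu h => (nu h : K)) (f := fun h => act (vsval h))
   (s := nu :: ws) (x := x)) => /=; rewrite ?nuws ?mem_head //.
- exact: dual_sep.
- move=> i _ h; rewrite /x; case: eqP => [->|_]; last exact: yw.
  by rewrite linearN /= wv scalerN.
rewrite big_cons {1}/x eqxx {1}vE addrC; apply/eqP; rewrite subr_eq0; apply/eqP.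
apply: eq_big_seq => i iws; rewrite /x; case: eqP => // ei.
by move: nuws; rewrite -ei iws.
Qed.

Lemma has_weight_iter al nu x v k :
  (forall h, lie (vsval h) x = (al h : K) *: x) -> has_weight nu v ->
  has_weight (nu + al *+ k) (iter k (act x) v).
Proof.
move=> wx wv; elim: k => [|k IH]; first by rewrite mulr0n addr0.
by rewrite /= mulrSr addrA; apply: has_weight_act.
Qed.

(** The weights [nu + al *+ k] are pairwise distinct, and only finitely many occur. *)
Lemma has_weight_nilp al nu x v : al != 0 ->
  (forall h, lie (vsval h) x = (al h : K) *: x) -> has_weight nu v ->
  exists k, iter k (act x) v = 0.
Proof.
move=> al0 wx wv; have [ws wsP] := has_weight_finite.
apply: contrapT => nz.
have sub : {subset [seq nu + al *+ k | k <- iota 0 (size ws).+1] <= ws}.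
  move=> _ /mapP[k _ ->]; apply: (wsP _ (iter k (act x) v)); last exact: has_weight_iter.
  by apply/eqP => e; apply: nz; exists k.
suff u : uniq [seq nu + al *+ k | k <- iota 0 (size ws).+1].
  by have := uniq_leq_size u sub; rewrite size_map size_iota ltnn.
rewrite map_inj_uniq ?iota_uniq // => i j /addrI /eqP.
have [h] := dual_sep al0; rewrite lfunE => ah.
move=> /eqP /(congr1 (fun f : dual a => f h : K)); rewrite !dualMn.
rewrite -(mulr_natl (al h : K) i) -(mulr_natl (al h : K) j).
by move=> /(mulIf ah)/eqP; rewrite eqr_nat => /eqP.
Qed.

Variables (al : dual a) (x y : g) (hh : subvs_of a).
Hypothesis al0 : al != 0.
Hypothesis wx : forall h, lie (vsval h) x = (al h : K) *: x.
Hypothesis wy : forall h, lie (vsval h) y = ((- al) h : K) *: y.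
Hypothesis xy : lie x y = vsval hh.

Lemma sl2_lowest nu v : v != 0 -> has_weight nu v -> act y v = 0 ->
  exists k : nat, (nu hh : K) = - (k%:R * (al hh : K) / 2).
Proof.
move=> v0 wv yv; apply: (sl2_lowest_weight v0 yv _ (has_weight_nilp al0 wx wv)) => k.
by rewrite -act_lie xy (has_weight_iter k wx wv) dualD dualMn mulr_natl.
Qed.

(** Lower [v] as far as possible and apply [sl2_lowest] to the vector obtained. *)
Lemma sl2_integral nu v : v != 0 -> has_weight nu v ->
  exists z : int, (nu hh : K) = z%:~R * ((al hh : K) / 2).
Proof.
move=> v0 wv.
have nal0 : - al != 0 by rewrite oppr_eq0.
have ex : exists k, iter k (act y) v == 0.
  by have [k e] := has_weight_nilp nal0 wy wv; exists k; apply/eqP.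
case: (ex_minnP ex) => [[|k]]; first by rewrite /= (negPf v0).
move=> /eqP /= yk kmin.
have yk0 : iter k (act y) v != 0.
  by apply/negP => /kmin; rewrite ltnn.
have [j] := sl2_lowest yk0 (has_weight_iter k wy wv) yk.
rewrite dualD dualMn dualN => e.
exists ((k + k)%:Z - j%:Z); rewrite intrB -!pmulrn natrD.
have -> : (nu hh : K) = - (j%:R * (al hh : K) / 2) - (- (al hh : K)) *+ k.
  by rewrite -e addrK.
by rewrite -mulr_natl; field.
Qed.

End Module.
End Weights.

(** * The adjoint representation *)
Section LieBasics.
Variables (K : numFieldType) (g : lieAlgType K).

Definition ad (x : g) : {linear g -> g} := lie x.

Lemma ad_scale c (x y : g) : ad (c *: x) y = c *: ad x y.
Proof.
have := lie_linearl y c x 0; have := lie_linearl y 1 0 0.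
by rewrite /ad /= !scale1r !addr0 => /eqP; rewrite -subr_eq subrr eq_sym => /eqP ->; rewrite addr0.
Qed.

Lemma lieDl (x y z : g) : lie (x + y) z = lie x z + lie y z.
Proof. by have := lie_linearl z 1 x y; rewrite /= !scale1r. Qed.

Lemma lieC (x y : g) : lie x y = - lie y x.
Proof.
apply/eqP; rewrite -subr_eq0 opprK; apply/eqP.
have := liexx (x + y); rewrite lieDl (linearD (ad x)) (linearD (ad y)) /= /ad !liexx.
by rewrite add0r addr0.
Qed.

Lemma ad_bracket (x y v : g) : ad (lie x y) v = ad x (ad y v) - ad y (ad x v).
Proof.
rewrite /ad /=; have := lie_jacobi x y v.
rewrite (lieC v (lie x y)) (lieC v x) (linearN (ad y)) /= /ad => /eqP.
by rewrite subr_eq0 => /eqP <-.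
Qed.

Variable a : {vspace g}.

Lemma dual_of_coords (c : 'I_(\dim a) -> K) :
  exists nu : dual a, forall h : subvs_of a,
    (nu h : K) = \sum_i coord (vbasis a) i (vsval h) * c i.
Proof.
pose f (h : subvs_of a) : K^o := \sum_i coord (vbasis a) i (vsval h) * c i.
have fl : linear f.
  move=> k u v; rewrite /f scaler_sumr -big_split /=; apply: eq_bigr => i _.
  by rewrite !linearP /= mulrDl -mulrA.
pose F : {linear subvs_of a -> K^o} := HB.pack f (GRing.isLinear.Build _ _ _ _ f fl).
by exists (linfun F) => h; rewrite lfunE.
Qed.

(** The eigenvalues of the elements of a basis of [a] on a joint eigenvector extend to a
linear form on [a]. *)
Lemma cartan_weight_basis : cartan_subalgebra a ->
  exists b : seq g, basis_of fullv b /\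
    forall x, x \in b -> exists nu : dual a, has_weight ad nu x.
Proof.
move=> [abel _ diag].
pose fs := [seq linfun (ad h) | h <- vbasis a : seq g].
have [||b [bb bP]] := @joint_eigenbasis K g fs.
- move=> _ _ /mapP[h /vbasis_mem ha ->] /mapP[k /vbasis_mem ka ->] v.
  rewrite !lfunE /=; have := ad_bracket h k v; rewrite abel // -(scale0r (0 : g)) ad_scale scale0r.
  by move/eqP; rewrite eq_sym subr_eq0 => /eqP.
- move=> _ /mapP[h /vbasis_mem ha ->]; have [b [bb bP]] := diag h ha.
  by exists b; split=> // x /bP[c e]; exists c; rewrite lfunE.
exists b; split=> // x xb.
have /choice[c cP] (i : 'I_(\dim a)) : exists c : K, ad (vbasis a)`_i x = c *: x.
  have [|c] := bP x xb (linfun (ad (vbasis a)`_i)).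
    by apply: (map_f (fun h => linfun (ad h))); rewrite mem_nth ?size_tuple.
  by rewrite lfunE; exists c.
have [nu nuP] := dual_of_coords c; exists nu => h.
have lx : linear (fun y => lie y x) by apply: lie_linearl.
pose F : {linear g -> g} := HB.pack (fun y => lie y x) (GRing.isLinear.Build _ _ _ _ _ lx).
rewrite nuP -[LHS]/(F (vsval h)) {1}(coord_vbasis (subvsP h)) linear_sum scaler_suml.
by apply: eq_bigr => i _; rewrite linearZ /= -[lie _ _]/(ad _ _) cP scalerA.
Qed.

End LieBasics.

(** * The trace form *)
Section TraceForm.
Variables (K : numFieldType) (g : lieAlgType K) (N : nat).
Variables (pi : 'Hom(g, 'M[K]_N)) (p : 'Hom('M[K]_N, g)).
Hypothesis pi_rep : representation pi.
Hypothesis pi_faithful : faithful pi.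
Hypothesis p_proj : orthogonal_projection pi p.

Local Notation B := (trform pi).

Lemma trformDr x y z : B x (y + z) = B x y + B x z.
Proof. exact: (linearD (trform pi x : {linear g -> K^o})). Qed.
Lemma trformZr x c z : B x (c *: z) = c * B x z.
Proof. by rewrite /trform linearZ /= -scalemxAr mxtraceZ. Qed.
Lemma trformNr x z : B x (- z) = - B x z.
Proof. exact: (linearN (trform pi x : {linear g -> K^o})). Qed.
Lemma trform_sumr x (I : Type) (r : seq I) (P : pred I) (F : I -> g) :
  B x (\sum_(i <- r | P i) F i) = \sum_(i <- r | P i) B x (F i).
Proof. exact: (linear_sum (trform pi x : {linear g -> K^o})). Qed.
Lemma trformDl x y z : B (x + y) z = B x z + B y z.
Proof. by rewrite !(trformC _ _ z) trformDr. Qed.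
Lemma trformZl x c z : B (c *: x) z = c * B x z.
Proof. by rewrite !(trformC _ _ z) trformZr. Qed.
Lemma trformNl x z : B (- x) z = - B x z.
Proof. by rewrite !(trformC _ _ z) trformNr. Qed.
Lemma trform_suml x (I : Type) (r : seq I) (P : pred I) (F : I -> g) :
  B (\sum_(i <- r | P i) F i) x = \sum_(i <- r | P i) B (F i) x.
Proof. by rewrite trformC trform_sumr; apply: eq_bigr => i _; rewrite trformC. Qed.

Lemma trform_projection A y : B (p A) y = \tr (A *m pi y).
Proof.
by apply/esym/eqP; rewrite -subr_eq0 -raddfB /= -mulmxBl; apply/eqP/p_proj.
Qed.

Lemma tr_delta_mul (i j : 'I_N) (A : 'M[K]_N) : \tr (delta_mx i j *m A) = A j i.
Proof.
rewrite /mxtrace (bigD1 i) //= big1 ?addr0 => [|k ki].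
  rewrite mxE (bigD1 j) //= big1 ?addr0 => [|l lj]; first by rewrite mxE !eqxx mul1r.
  by rewrite mxE (negPf lj) andbF mul0r.
by rewrite mxE big1 // => l _; rewrite mxE (negPf ki) mul0r.
Qed.

(** If [x] is orthogonal to g then Tr(A pi(x)) = <p(A), x> = 0 for every matrix A, so
pi(x) = 0: nondegeneracy is forced by the existence of the projection [p]. *)
Lemma trform_nondegenerate x : (forall y, B x y = 0) -> x = 0.
Proof.
move=> x0; apply: pi_faithful; rewrite linear0; apply/matrixP => j i.
by rewrite -tr_delta_mul -trform_projection trformC x0 mxE.
Qed.

Lemma trform_inv x y z : B (lie x y) z = B x (lie y z).
Proof.
rewrite /trform !pi_rep mulmxBl mulmxBr !raddfB /= !mulmxA; congr (_ - _).
by rewrite -(mulmxA (pi y)) [LHS]mxtrace_mulC.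
Qed.

End TraceForm.

(** * Roots and weights *)
Section Roots.
Variables (K : numClosedFieldType) (g : lieAlgType K) (N : nat).
Variables (pi : 'Hom(g, 'M[K]_N)) (p : 'Hom('M[K]_N, g)) (a : {vspace g}).
Hypothesis pi_rep : representation pi.
Hypothesis pi_faithful : faithful pi.
Hypothesis p_proj : orthogonal_projection pi p.
Hypothesis a_cartan : cartan_subalgebra a.

Local Notation B := (trform pi).
Implicit Types (al be ga nu mu : dual a) (h : subvs_of a) (x y z : g) (v w : 'cV[K]_N).

Definition ad_weight al x := has_weight (@ad K g) al x.

Definition actV (x : g) : {linear 'cV[K]_N -> 'cV[K]_N} := mulmx (pi x).
Definition pi_weight nu v := has_weight actV nu v.

Lemma actV_lie x y v : actV (lie x y) v = actV x (actV y v) - actV y (actV x v).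
Proof. by rewrite /actV /= pi_rep mulmxBl !mulmxA. Qed.

Lemma actVZ c y w : actV (c *: y) w = c *: actV y w.
Proof. by rewrite /actV /= linearZ /= -scalemxAl. Qed.

Lemma ad_weight_lie al be x y : ad_weight al x -> ad_weight be y -> ad_weight (al + be) (lie x y).
Proof.
by move=> wx wy; rewrite addrC; apply: (has_weight_act (@ad_bracket K g) wx wy); apply: ad_scale.
Qed.

Lemma pi_weight_act al nu x v : ad_weight al x -> pi_weight nu v -> pi_weight (nu + al) (pi x *m v).
Proof. by move=> wx wv; apply: (has_weight_act actV_lie wx wv); apply: actVZ. Qed.

Lemma ad_weight_decomp : exists2 ws : seq (dual a), uniq ws &
  forall x, exists y : dual a -> g, (forall al, ad_weight al (y al)) /\
    x = \sum_(al <- ws) y al.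
Proof.
by have [b [bb bw]] := cartan_weight_basis a_cartan; apply: has_weight_decomp bb bw.
Qed.

Lemma ad_weight_finite : exists ws : seq (dual a), forall al x, x != 0 -> ad_weight al x -> al \in ws.
Proof.
by have [b [bb bw]] := cartan_weight_basis a_cartan; apply: has_weight_finite bb bw.
Qed.

Lemma ad_weight0_cartan x : ad_weight 0 x <-> x \in a.
Proof.
have [abel amax _] := a_cartan; split=> [w|xa h]; last first.
  by rewrite /ad /= abel ?subvsP // lfunE scale0r.
apply: amax => h ha; have := w (Subvs ha); rewrite lfunE scale0r /=.
by rewrite /ad.
Qed.

Lemma trform_ad_weight al be x y : ad_weight al x -> ad_weight be y -> al + be != 0 -> B x y = 0.
Proof.
move=> wx wy /dual_sep[h]; rewrite dualD lfunE => ne.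
have := trform_inv pi_rep x (vsval h) y.
rewrite lieC -[lie _ x]/(ad _ x) -[lie _ y]/(ad _ y) wx wy trformNl trformZl trformZr.
move=> /eqP; rewrite -subr_eq0 -opprD -mulrDl oppr_eq0 mulf_eq0 (negPf ne).
by move/eqP.
Qed.

(** The form is nondegenerate, and only the component of weight [- al] of an element of
g can have a nonzero pairing with [x]. *)
Lemma ad_weight_dual al x : x != 0 -> ad_weight al x -> exists y, ad_weight (- al) y /\ B x y = 1.
Proof.
move=> x0 wx; have [ws uws dec] := ad_weight_decomp.
have [z Bz] : exists z, B x z != 0.
  apply: contrapT => nz; move/eqP: x0; apply.
  apply: (trform_nondegenerate pi_faithful p_proj) => y.
  by apply: contrapT => /eqP e; apply: nz; exists y.
have [y [yw zE]] := dec z.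
have orth be : be != - al -> B x (y be) = 0.
  by move=> ne; apply: (trform_ad_weight wx (yw be)); rewrite addrC addr_eq0.
have Byz : B x z = B x (y (- al)).
  have [alw|nalw] := boolP (- al \in ws).
    by rewrite zE trform_sumr (bigD1_seq (- al)) //= big1 ?addr0.
  case/eqP: Bz; rewrite zE trform_sumr big_seq; apply: big1 => be bews.
  by apply: orth; apply: contraNneq nalw => <-.
exists ((B x z)^-1 *: y (- al)); split; first exact: (has_weightZ _ (yw _)).
by rewrite trformZr -Byz mulVf.
Qed.

Lemma cartan_nondegenerate (x : g) : x \in a -> (forall h, B x (vsval h) = 0) -> x = 0.
Proof.
move=> /ad_weight0_cartan wx x0; apply: contrapT => /eqP nx.
have [y [wy]] := ad_weight_dual nx wx; move: wy; rewrite oppr0 => /ad_weight0_cartan ya.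
by rewrite (x0 (Subvs ya)) => /eqP; rewrite eq_sym oner_eq0.
Qed.

(** The element of [a] that represents [al]; [sharp] is its image in g. *)
Definition sharpv al : subvs_of a := ((flat pi a)^-1)%VF al.

Lemma sharpvP al h : B (vsval (sharpv al)) (vsval h) = al h.
Proof.
rewrite -flatE /sharpv limg_lfunVK //; suff -> : limg (flat pi a) = fullv by rewrite memvf.
have inj : lker (flat pi a) == 0%VS.
  rewrite -subv0; apply/subvP => u; rewrite memv_ker memv0 => /eqP fu.
  apply/eqP/subvs_inj; rewrite linear0; apply: cartan_nondegenerate (subvsP u) _.
  by move=> h'; rewrite -flatE fu lfunE.
apply/eqP; rewrite eqEdim subvf limg_dim_eq ?(eqP inj) ?capv0 // !dimvf.
by rewrite /dim /= muln1.
Qed.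

(** Both sides lie in [a], on which the form is nondegenerate, so it is enough to pair
them with an element of [a]. *)
Lemma lie_opposite al x y : ad_weight al x -> ad_weight (- al) y ->
  lie x y = B x y *: vsval (sharpv al).
Proof.
move=> wx wy; apply/eqP; rewrite -subr_eq0; apply/eqP.
apply: cartan_nondegenerate => [|h].
  by rewrite rpredB ?rpredZ ?subvsP //; apply/ad_weight0_cartan; rewrite -(subrr al); apply: ad_weight_lie.
rewrite trformDl trformNl trformZl sharpvP trform_inv // lieC trformNr -[lie _ y]/(ad _ y) wy.
by rewrite trformZr dualN mulNr opprK mulrC subrr.
Qed.

Variables (X : dual a -> g) (pibar : dual a).
Hypothesis X_root : forall al, root_system al -> root_vector al (X al).
Hypothesis irr : irreducible_for pi fullv fullv.
Hypothesis pibar_wt : exists v, weight_vector pi pibar v.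

(** The span of the weight vectors is stable under g, since a root vector maps weight
vectors to weight vectors, and it contains a vector of weight [pibar]; as V is
irreducible it is all of V. *)
Lemma V_weight_basis : exists b : seq 'cV[K]_N,
  basis_of fullv b /\ forall v, v \in b -> exists nu, pi_weight nu v.
Proof.
apply: exists_basis_in => W WP.
have [S SP] : exists S : {vspace 'cV[K]_N}, forall v, v \in S <->
    forall W : {vspace 'cV[K]_N}, (forall u, (exists nu, pi_weight nu u) -> u \in W) -> v \in W.
  apply: vspace_of_pred => [U UP|c u v hu hv U UP]; first exact: mem0v.
  by rewrite rpredD ?rpredZ ?hu ?hv.
suff Sfull : S = fullv by apply/vspaceP => v; rewrite memvf; apply: (proj1 (SP v)); rewrite ?Sfull ?memvf.
have [_ _ /(_ S (subvf _))[]] := irr; last by [].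
- move=> x v _ /SP vS; apply/SP => U UP.
  have [U' U'P] : exists U' : {vspace 'cV[K]_N}, forall v, v \in U' <->
      forall x, pi x *m v \in U.
    apply: vspace_of_pred => [y|c u w hu hw y]; first by rewrite mulmx0 mem0v.
    by rewrite mulmxDr -scalemxAr rpredD ?rpredZ.
  apply: (proj1 (U'P v)); apply: vS => u [nu wu]; apply/U'P => y.
  have [ws _ dec] := ad_weight_decomp; have [z [zw ->]] := dec y.
  rewrite linear_sum mulmx_suml; apply: rpred_sum => al _.
  by apply: UP; exists (nu + al); apply: pi_weight_act.
have [v [v0 wv]] := pibar_wt => S0; case/eqP: v0; apply/eqP; rewrite -memv0 -S0.
by apply/SP => U UP; apply: UP; exists pibar.
Qed.

Lemma V_diagonal : exists (P : 'M[K]_N) (nus : 'I_N -> dual a),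
  P \in unitmx /\ forall h, pi (vsval h) *m P = P *m diag_mx (\row_j (nus j h : K)).
Proof.
have [b [bb bw]] := V_weight_basis.
have [lab labP] := has_weight_label bw.
have sb : size b = N.
  rewrite -(size_basis (X := in_tuple b) bb) dimvf; exact: muln1.
pose P := \matrix_(i, j) b`_j i 0 : 'M[K]_N; exists P, (fun j => lab b`_j).
have Pu (u : 'cV[K]_N) : P *m u = \sum_j u j 0 *: b`_j.
  apply/colP => i; rewrite !mxE summxE; apply: eq_bigr => j _.
  by rewrite !mxE mulrC.
split; last first.
  move=> h; apply/matrixP => i j; rewrite mul_mx_diag !mxE.
  have /labP/(_ h)/matrixP/(_ i 0) : b`_j \in b by rewrite mem_nth ?sb.
  rewrite /actV /= !mxE => e; rewrite (mulrC (b`_j i 0) (lab b`_j h : K)) -[RHS]e.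
  apply: eq_bigr => k _.
  by rewrite !mxE.
rewrite -unitmx_tr -row_free_unit; apply: inj_row_free => u uP.
have : P *m u^T = 0 by rewrite -[P]trmxK -trmx_mul uP trmx0.
rewrite Pu => e0; apply/rowP => j; rewrite mxE.
have /freeP fb : free (in_tuple b) := basis_free bb.
have := fb (fun i => u^T (cast_ord sb i) 0) _ (cast_ord (esym sb) j).
rewrite cast_ordKV mxE => -> //; rewrite -[RHS]e0.
rewrite (reindex (cast_ord sb)) //=; exists (cast_ord (esym sb)) => i _.
  exact: cast_ordK.
exact: cast_ordKV.
Qed.

Local Notation is_root := (@root_system K g a).
Local Notation H al := (vsval (sharpv al)).

Lemma trform_weights : exists nus : 'I_N -> dual a,
  (forall h h', B (vsval h) (vsval h') = \sum_j (nus j h : K) * nus j h') /\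
  (forall h, (forall j, nus j h = 0 :> K) -> h = 0) /\
  (forall j, exists v, v != 0 /\ pi_weight (nus j) v).
Proof.
have [P [nus [Pu PE]]] := V_diagonal; exists nus; split; [|split].
- move=> h h'.
  have D (k : subvs_of a) : pi (vsval k) = P *m diag_mx (\row_j (nus j k : K)) *m invmx P.
    by rewrite -PE mulmxK.
  rewrite /trform !D -!mulmxA mxtrace_mulC !mulmxA mulmxKV // mulmxKV //.
  rewrite mulmx_diag mxtrace_diag; apply: eq_bigr => j _; by rewrite !mxE.
- move=> h h0; apply: subvs_inj; apply: pi_faithful; rewrite !linear0.
  rewrite -[LHS](mulmxK Pu) PE.
  suff -> : \row_j (nus j h : K) = 0 by rewrite (linear0 (@diag_mx K N)) mulmx0 mul0mx.
  by apply/rowP => j; rewrite !mxE h0.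
move=> j; exists (col j P); split.
  apply/eqP => e; have : invmx P *m col j P = 0 by rewrite e mulmx0.
  rewrite colE mulmxA mulVmx // mul1mx => /colP/(_ j); rewrite !mxE !eqxx => /eqP.
  by rewrite oner_eq0.
move=> h; rewrite /actV /= colE mulmxA PE -colE; apply/colP => i.
by rewrite mul_mx_diag -colE !mxE mulrC.
Qed.

Lemma root_ad_weight al : is_root al -> ad_weight al (X al).
Proof. by move=> /X_root[]. Qed.

Lemma root_X_neq0 al : is_root al -> X al != 0.
Proof. by move=> /X_root[]. Qed.

Lemma rootP al x : al != 0 -> x != 0 -> ad_weight al x -> is_root al.
Proof. by move=> al0 x0 wx; split=> //; exists x. Qed.

(** If [al] were isotropic, [sl2_integral] would make every weight vanish at
[sharpv al], which would then act by zero on the faithful module V. *)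
Lemma root_length_neq0 al : is_root al -> (al (sharpv al) : K) != 0.
Proof.
move=> ral; have [al0 _] := ral; have wx := root_ad_weight ral.
have [y [wy Bxy]] := ad_weight_dual (root_X_neq0 ral) wx.
have xy : lie (X al) y = H al by rewrite (lie_opposite wx wy) Bxy scale1r.
apply/eqP => iso; have [nus [_ [nus0 nusw]]] := trform_weights.
have [b [bb bw]] := V_weight_basis.
have HE : sharpv al = 0.
  apply: nus0 => j; have [v [v0 wv]] := nusw j.
  have [z ->] := sl2_integral actV_lie actVZ bb bw al0 wx wy xy v0 wv.
  by rewrite iso mul0r mulr0.
move/eqP: al0; apply; apply: dualP => h.
by rewrite -sharpvP HE linear0 lfunE trformC /trform linear0 mulmx0 mxtrace0.
Qed.

(** A vector of weight [al] orthogonal to [y] commutes with [y]. It is therefore a lowest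
weight vector of weight [al] for the sl2-triple of [al], whereas [sl2_lowest] makes
lowest weights nonpositive multiples of [al]; so it is zero. *)
Lemma root_multiplicity1 al x : is_root al -> ad_weight al x -> exists c, x = c *: X al.
Proof.
move=> ral wx; have [al0 _] := ral; have wX := root_ad_weight ral.
have [y [wy BXy]] := ad_weight_dual (root_X_neq0 ral) wX.
have Xy : lie (X al) y = H al by rewrite (lie_opposite wX wy) BXy scale1r.
exists (B x y); apply/eqP; rewrite -subr_eq0; apply: contrapT => /negP z0.
have wz : ad_weight al (x - B x y *: X al).
  by move=> h; rewrite linearB /= wx linearZ /= wX scalerBr !scalerA mulrC.
have yz : ad y (x - B x y *: X al) = 0.
  rewrite -[LHS]/(lie y _) lieC (lie_opposite wz wy) trformDl trformNl trformZl BXy.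
  by rewrite mulr1 subrr scale0r oppr0.
have [b [bb bw]] := cartan_weight_basis a_cartan.
have [k] := sl2_lowest (@ad_bracket K g) (@ad_scale K g) bb bw al0 wX Xy z0 wz yz.
set t : K := al _ => e; have : (k.+2)%:R * t = 0.
  have -> : (k.+2)%:R * t = 2 * t + k%:R * t by rewrite -mulrDl -natrD add2n.
  by rewrite {1}e; field.
by move=> /eqP; rewrite mulf_eq0 pnatr_eq0 /= (negPf (root_length_neq0 ral)).
Qed.

Lemma rootN al : is_root al -> is_root (- al).
Proof.
move=> ral; have [al0 _] := ral.
have [y [wy BXy]] := ad_weight_dual (root_X_neq0 ral) (root_ad_weight ral).
apply: (rootP (x := y)) => //; first by rewrite oppr_eq0.
by apply: contra_eq_neq BXy => ->; rewrite /trform linear0 mulmx0 mxtrace0 eq_sym oner_eq0.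
Qed.

(** The [X al] are arbitrary root vectors, so these factors appear in every expansion
in dual bases of the trace form. *)
Definition root_pairing al := B (X al) (X (- al)).

Lemma root_pairingN al : root_pairing (- al) = root_pairing al.
Proof. by rewrite /root_pairing opprK trformC. Qed.

Lemma root_pairing_neq0 al : is_root al -> root_pairing al != 0.
Proof.
move=> ral; have [y [wy BXy]] := ad_weight_dual (root_X_neq0 ral) (root_ad_weight ral).
have [c yE] := root_multiplicity1 (rootN ral) wy.
apply/eqP => e; move: BXy; rewrite yE trformZr -/(root_pairing al) e mulr0 => /eqP.
by rewrite eq_sym oner_eq0.
Qed.

Lemma lie_root_opposite al : is_root al -> lie (X al) (X (- al)) = root_pairing al *: H al.
Proof. by move=> ral; apply: lie_opposite; apply: root_ad_weight => //; apply: rootN. Qed.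

Lemma ad_weight_coeff al x : is_root al -> ad_weight al x -> x = (B x (X (- al)) / root_pairing al) *: X al.
Proof.
move=> ral wx; have [c ->] := root_multiplicity1 ral wx.
by rewrite trformZl mulfK // root_pairing_neq0.
Qed.

Lemma root_finite : finite_set is_root.
Proof.
have [ws wsP] := ad_weight_finite; apply: (sub_finite_set _ (finite_seq ws)).
by move=> al ral; apply: wsP (root_X_neq0 ral) (root_ad_weight ral).
Qed.

Definition roots : seq (dual a) := fset_set is_root.

Lemma rootsP al : al \in roots <-> is_root al.
Proof.
by rewrite -[al \in _]/(al \in fset_set is_root) in_fset_set ?inE //; apply: root_finite.
Qed.

Lemma roots_uniq : uniq roots. Proof. exact: fset_uniq. Qed.

Lemma ad_weight_expansion al x : ad_weight al x ->
  exists h, x = vsval h + \sum_(be <- roots) (B x (X (- be)) / root_pairing be) *: X be.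
Proof.
move=> wx.
have orth be : be != al -> is_root be -> B x (X (- be)) = 0.
  move=> ne rbe; apply: (trform_ad_weight wx (root_ad_weight (rootN rbe))).
  by rewrite subr_eq0 eq_sym.
have [ral|nral] := pselect (is_root al).
  exists 0; rewrite linear0 add0r (bigD1_seq al) ?roots_uniq //=; last exact/rootsP.
  rewrite -ad_weight_coeff // big_seq_cond big1 ?addr0 // => be /andP[/rootsP rbe ne].
  by rewrite orth // mul0r scale0r.
have sum0 : \sum_(be <- roots) (B x (X (- be)) / root_pairing be) *: X be = 0.
  rewrite big_seq big1 // => be /rootsP rbe; rewrite orth ?mul0r ?scale0r //.
  by apply/eqP => e; apply: nral; rewrite -e.
rewrite sum0; have [al0|al0] := eqVneq al 0.
  by move: wx; rewrite al0 => /ad_weight0_cartan xa; exists (Subvs xa); rewrite addr0.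
exists 0; rewrite linear0 addr0; apply: contrapT => /eqP x0.
by apply: nral; apply: rootP wx.
Qed.

Lemma g_root_expansion x :
  exists h, x = vsval h + \sum_(be <- roots) (B x (X (- be)) / root_pairing be) *: X be.
Proof.
have [ws _ dec] := ad_weight_decomp; have [y [yw ->]] := dec x.
have /choice[h hP] al := ad_weight_expansion (yw al).
exists (\sum_(al <- ws) h al); rewrite linear_sum.
rewrite [X in _ = _ + X](eq_bigr (fun be => \sum_(al <- ws)
  (B (y al) (X (- be)) / root_pairing be) *: X be)) => [|be _]; last first.
  by rewrite trform_suml mulr_suml scaler_suml.
by rewrite exchange_big -big_split; apply: eq_bigr => al _; apply: hP.
Qed.

(** Let [t] be the value at stake. The weights take values [z t / 2], with [z] an
integer, at [sharpv al]; computing [t] as a trace over V gives [t = t^2 S / 4], where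
[S] is a sum of squares of integers. *)
Lemma root_length_gt0 al : is_root al -> 0 < (al (sharpv al) : K).
Proof.
move=> ral; have [al0 _] := ral; have wx := root_ad_weight ral.
have [y [wy Bxy]] := ad_weight_dual (root_X_neq0 ral) wx.
have xy : lie (X al) y = H al by rewrite (lie_opposite wx wy) Bxy scale1r.
have [nus [BE [_ nusw]]] := trform_weights; have [b [bb bw]] := V_weight_basis.
have /choice[z zE] j : exists z : int, (nus j (sharpv al) : K) = z%:~R * ((al (sharpv al) : K) / 2).
  have [v [v0 wv]] := nusw j.
  exact: (sl2_integral actV_lie actVZ bb bw al0 wx wy xy v0 wv).
have t0 := root_length_neq0 ral; have := sharpvP al (sharpv al); rewrite BE.
under eq_bigr => j _ do rewrite zE.
set t : K := al (sharpv al) in t0 *; pose S : K := \sum_j (z j)%:~R ^+ 2.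
have -> : \sum_j (z j)%:~R * (t / 2) * ((z j)%:~R * (t / 2)) = t * (t / 4 * S).
  rewrite mulr_sumr mulr_sumr; apply: eq_bigr => j _; by field.
move=> tE; have {}tE : t / 4 * S = 1 by apply: (mulfI t0); rewrite mulr1.
have S0 : 0 < S.
  rewrite lt_neqAle; apply/andP; split.
    by apply: contra_eq_neq tE => <-; rewrite mulr0 eq_sym oner_eq0.
  by apply: sumr_ge0 => j _; rewrite -rmorphXn /= ler0z sqr_ge0.
have : 0 < t / 4 * S by rewrite tE.
by rewrite pmulr_lgt0 // pmulr_lgt0 // invr_gt0 ltr0n.
Qed.

Lemma dformE al be : dform pi al be = al (sharpv be).
Proof. by rewrite /dform -sharpvP. Qed.

Lemma dformC al be : dform pi al be = dform pi be al.
Proof. exact: trformC. Qed.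

Lemma sharpv_sym al be : (al (sharpv be) : K) = be (sharpv al).
Proof. by rewrite -!dformE dformC. Qed.

Lemma flat_Hv al : flat pi a (sharpv al) = al.
Proof. by apply: dualP => h; rewrite flatE sharpvP. Qed.

Lemma sharpvD al be : sharpv (al + be) = sharpv al + sharpv be. Proof. exact: linearD. Qed.
Lemma sharpvN al : sharpv (- al) = - sharpv al. Proof. exact: linearN. Qed.

(** * Positive roots *)
Variable Psi : {fset dual a}.
Hypothesis Psi_simple : simple_system Psi.

Lemma Psi_free : free Psi. Proof. by case: Psi_simple. Qed.
Lemma Psi_root al : al \in Psi -> is_root al. Proof. by case: Psi_simple => _ h _; apply: h. Qed.

(** The coordinate of index [be] is a linear form on the dual of [a]. Composed with
[flat] it is an element of the dual of [a], which the trace form represents by an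
element of [a]. *)
Lemma Psi_dual : exists e : dual a -> subvs_of a,
  forall al be, al \in Psi -> be \in Psi -> (al (e be) : K) = (al == be)%:R.
Proof.
suff /choice[e eP] : forall be, exists h : subvs_of a,
    forall al, al \in Psi -> be \in Psi -> (al h : K) = (al == be)%:R.
  by exists e => al be alP beP; apply: eP.
move=> be; case: (boolP (be \in Psi)) => [beP|_]; last by exists 0.
have lt : (index be Psi < size Psi)%N by rewrite index_mem.
pose i := Ordinal lt.
pose ps : dual a := (linfun (coord (in_tuple Psi) i : dual a -> K^o) \o flat pi a)%VF.
exists (sharpv ps) => al alP _.
have -> : (al (sharpv ps) : K) = ps (sharpv al) by rewrite -!dformE dformC.
rewrite comp_lfunE flat_Hv lfunE /=.
have ltj : (index al Psi < size Psi)%N by rewrite index_mem.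
have alE : al = (in_tuple Psi)`_(Ordinal ltj) by rewrite /= nth_index.
rewrite [X in coord _ _ X]alE coord_free ?Psi_free //; congr (_%:R : K); congr (nat_of_bool _).
apply/eqP/eqP => [[e]|e]; last by apply: val_inj; rewrite /= e.
by have := congr1 (nth 0 Psi) e; rewrite !nth_index.
Qed.

Definition pos_roots := [seq al <- roots | `[< nat_comb Psi al >]].

Lemma pos_rootsP al : al \in pos_roots <-> positive_roots Psi al.
Proof.
rewrite mem_filter; split=> [/andP[/asboolP c /rootsP r] //|[r c]].
by apply/andP; split; [exact/asboolP|exact/rootsP].
Qed.

Lemma pos_roots_uniq : uniq pos_roots. Proof. exact/filter_uniq/roots_uniq. Qed.

Lemma pos_roots_root al : al \in pos_roots -> is_root al. Proof. by move=> /pos_rootsP[]. Qed.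

Lemma pos_roots_comb al : al \in pos_roots -> nat_comb Psi al. Proof. by move=> /pos_rootsP[]. Qed.

Lemma nat_comb_eval al (c : dual a -> nat) (e : dual a -> subvs_of a) be :
  (forall al be, al \in Psi -> be \in Psi -> (al (e be) : K) = (al == be)%:R) ->
  al = \sum_(ga <- Psi) ga *+ c ga -> be \in Psi -> (al (e be) : K) = (c be)%:R.
Proof.
move=> eP -> beP; rewrite dual_sum (bigD1_seq be) ?fset_uniq //= big_seq_cond big1.
  by rewrite addr0 dualMn eP // eqxx.
by move=> ga /andP[gaP ne]; rewrite dualMn eP // (negPf ne) mul0rn.
Qed.

Lemma nat_comb_opp al : nat_comb Psi al -> nat_comb Psi (- al) -> al = 0.
Proof.
move=> [c cE] [d dE]; have [e eP] := Psi_dual.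
rewrite cE big_seq big1 // => be beP.
have := nat_comb_eval eP dE beP; rewrite dualN (nat_comb_eval eP cE beP) => /eqP.
rewrite eq_sym -subr_eq0 opprK -natrD pnatr_eq0 addn_eq0 => /andP[_ /eqP ->].
by rewrite mulr0n.
Qed.

Lemma root_split al : al \in roots -> (al \in pos_roots) (+) (- al \in pos_roots).
Proof.
move=> /rootsP ral; have [al0 _] := ral.
have [_ _ /(_ al ral)] := Psi_simple.
case: (boolP (al \in pos_roots)) => [alp _|aln c].
  apply/negP => naln; move/eqP: al0; apply.
  by apply: nat_comb_opp; apply: pos_roots_comb.
case: c => [c|c]; first by case/negP: aln; apply/pos_rootsP.
by rewrite addFb; apply/pos_rootsP; split=> //; apply: rootN.
Qed.

Lemma sum_roots (W : nmodType) (F : dual a -> W) :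
  \sum_(al <- roots) F al = \sum_(al <- pos_roots) (F al + F (- al)).
Proof.
rewrite (perm_big (pos_roots ++ [seq - al | al <- pos_roots])) /=.
  by rewrite big_cat big_map big_split.
apply: uniq_perm; first exact: roots_uniq.
  rewrite cat_uniq pos_roots_uniq map_inj_uniq ?pos_roots_uniq ?andbT; last exact: oppr_inj.
  apply/hasPn => _ /mapP[al alp ->] /=; apply/negP => naln.
  have /rootsP/root_split := pos_roots_root naln.
  by rewrite naln opprK alp.
move=> al; rewrite mem_cat; apply/idP/orP.
  move=> /root_split; case: (boolP (al \in pos_roots)) => [|_ naln]; first by left.
  by right; apply/mapP; exists (- al); rewrite ?opprK.
case=> [/pos_roots_root/rootsP //|/mapP[be /pos_roots_root/rootN rb ->]].
exact/rootsP.
Qed.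

Lemma two_rhoE : 2 *: rho Psi = \sum_(al <- pos_roots) al.
Proof.
rewrite /rho scalerA mulfV ?scale1r ?pnatr_eq0 // (fsbig_seq _ _ pos_roots_uniq).
congr (\big[_/_]_(_ \in _) _); apply/seteqP; split=> al /=; last by move=> /pos_rootsP.
by move=> h; apply/pos_rootsP.
Qed.

Lemma cartan_root_coords0 (s : seq (dual a)) (c : dual a -> K) :
  uniq s -> (forall al, al \in s -> is_root al) ->
  \sum_(al <- s) c al *: X al \in a -> forall al, al \in s -> c al = 0.
Proof.
move=> us sr /ad_weight0_cartan sa al als.
have wN := root_ad_weight (rootN (sr _ als)).
have := trform_ad_weight sa wN; rewrite add0r oppr_eq0; have [-> _ /(_ isT)] := sr _ als.
rewrite trform_suml (bigD1_seq al) //= big_seq_cond big1 ?addr0.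
  move=> /eqP; rewrite trformZl mulf_eq0 -/(root_pairing al) (negPf (root_pairing_neq0 (sr _ als))) orbF.
  by move/eqP.
move=> be /andP[bes ne]; rewrite trformZl (trform_ad_weight (root_ad_weight (sr _ bes)) wN) ?mulr0 //.
by rewrite subr_eq0.
Qed.

Lemma span_map_coords (F : dual a -> g) (s : seq (dual a)) (v : g) : uniq s ->
  v \in <<map F s>>%VS -> exists c : dual a -> K, v = \sum_(al <- s) c al *: F al.
Proof.
elim: s v => [|al s IH] v /=.
  by rewrite span_nil memv0 => _ /eqP ->; exists (fun=> 0); rewrite big_nil.
move=> /andP[als us]; rewrite span_cons => /memv_addP[_ /vlineP[k ->] [w /(IH _ us)[c ->] ->]].
exists (fun be => if be == al then k else c be); rewrite big_cons eqxx; congr (_ + _).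
apply: eq_big_seq => be bes; case: eqP => // e; by rewrite -e bes in als.
Qed.

Lemma free_cartan_roots (s : seq (dual a)) :
  uniq s -> (forall al, al \in s -> is_root al) -> free (map X s ++ vbasis a).
Proof.
elim: s => [|al s IH] /=; first by rewrite (basis_free (vbasisP a)).
move=> /andP[als us] sr; rewrite free_cons IH // ?andbT; last first.
  by move=> be bes; apply: sr; rewrite inE bes orbT.
rewrite span_cat; apply/negP => /memv_addP[u /(span_map_coords us)[c uE] [w wa XE]].
pose d be := if be == al then 1 else - c be.
have := @cartan_root_coords0 (al :: s) d; rewrite /= als us => /(_ isT sr).
rewrite big_cons /d eqxx scale1r => h; have /eqP : (1 : K) = 0.
  have := h _ al; rewrite eqxx mem_head => -> //.
  rewrite (eq_big_seq (fun be => - (c be *: X be))) => [|be bes].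
    by rewrite sumrN -uE XE addrC addKr -(span_basis (vbasisP a)).
  by case: eqP => [e|_]; [rewrite -e bes in als|rewrite scaleNr].
by rewrite oner_eq0.
Qed.

Lemma ad_weight_mem (W : {vspace g}) al x :
  ad_weight al x -> (al = 0 -> (a <= W)%VS) -> (is_root al -> X al \in W) -> x \in W.
Proof.
move=> wx aW XW; have [al0|al0] := eqVneq al 0.
  by apply: (subvP (aW al0)); apply/ad_weight0_cartan; rewrite -al0.
have [->|x0] := eqVneq x 0; first exact: mem0v.
have ral := rootP al0 x0 wx; have [c ->] := root_multiplicity1 ral wx.
by rewrite rpredZ // XW.
Qed.

(** If [al - ga] were negative, [al] and [ga - al] would have nonnegative coefficients
adding up to those of [ga], which leaves [al = ga] only. *)
Lemma sub_simple_pos ga al : ga \in Psi -> al \in pos_roots -> al != ga ->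
  is_root (al - ga) -> al - ga \in pos_roots.
Proof.
move=> gaP alp ne r; apply/negPn/negP => nalga.
have := root_split ((rootsP _).2 r); rewrite (negPf nalga) addFb opprB.
move=> /pos_roots_comb[d dE]; have [c cE] := pos_roots_comb alp.
have [e eP] := Psi_dual; have [al0 _] := pos_roots_root alp.
move/eqP: ne; apply.
have coef be : be \in Psi -> (c be + d be)%N = (be == ga).
  move=> beP; apply/eqP; rewrite -(eqr_nat K) natrD -(nat_comb_eval eP cE beP).
  by rewrite -(nat_comb_eval eP dE beP) dualD dualN addrC subrK eP // (eq_sym ga).
have cga : c ga != 0%N.
  apply: contra_neq al0 => c0; rewrite cE big_seq big1 // => be beP.
  have := coef be beP; case: eqP => [->|_ /eqP]; first by rewrite c0 mulr0n.
  by rewrite addn_eq0 => /andP[/eqP -> _]; rewrite mulr0n.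
rewrite cE (bigD1_seq ga) ?fset_uniq //= big_seq_cond big1 ?addr0.
  have := coef ga gaP; rewrite eqxx /=; case: (c ga) cga => // -[|//] _ _.
  by rewrite mulr1n.
move=> be /andP[beP bga]; have := coef be beP; rewrite (negPf bga) => /eqP.
by rewrite addn_eq0 => /andP[/eqP -> _]; rewrite mulr0n.
Qed.

Lemma nat_combD al be : nat_comb Psi al -> nat_comb Psi be -> nat_comb Psi (al + be).
Proof.
move=> [c ->] [d ->]; exists (fun ga => (c ga + d ga)%N).
by rewrite -big_split; apply: eq_bigr => ga _; rewrite mulrnDr.
Qed.

Lemma simple_pos ga : ga \in Psi -> ga \in pos_roots.
Proof.
move=> gaP; apply/pos_rootsP; split; first exact: Psi_root.
exists (fun be => nat_of_bool (be == ga)); rewrite (bigD1_seq ga) ?fset_uniq //= eqxx.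
by rewrite big1 ?addr0 // => be /negPf ->.
Qed.

Lemma pos_rootsD al be : al \in pos_roots -> be \in pos_roots -> is_root (al + be) -> al + be \in pos_roots.
Proof.
by move=> alp bep r; apply/pos_rootsP; split=> //; apply: nat_combD; apply: pos_roots_comb.
Qed.

(** Up to a factor [sharpv ga] is the commutator of [X ga] and [X (- ga)], which
preserve the span of [a], [X (- ga)] and the positive root vectors. The trace of its
adjoint action on this subspace, (2 rho - ga)(sharpv ga), is therefore zero. *)
Lemma two_rho_simple ga : ga \in Psi -> ((2 *: rho Psi) (sharpv ga) : K) = ga (sharpv ga).
Proof.
move=> gaP; have rga := Psi_root gaP; have gap := simple_pos gaP.
rewrite two_rhoE dual_sum.
(* the roots of the parabolic subalgebra of [ga], whose sum is 2 rho - ga *)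
pose s := - ga :: pos_roots.
pose t := [seq (X al, root_pairing ga * (al (sharpv ga) : K)) | al <- s] ++
          [seq (u, 0 : K) | u <- vbasis a : seq g].
have tE : unzip1 t = map X s ++ vbasis a.
  by rewrite /unzip1 /t map_cat -!map_comp; congr (_ ++ _); rewrite map_id_in.
have nga : - ga \notin pos_roots.
  by have := root_split ((rootsP _).2 rga); rewrite gap.
have sroot al : al \in s -> is_root al.
  by rewrite inE => /predU1P[->|/pos_roots_root //]; apply: rootN.
have us : uniq s by rewrite /= nga pos_roots_uniq.
have ft : free (unzip1 t) by rewrite tE; apply: free_cartan_roots.
have aU : (a <= <<unzip1 t>>)%VS.
  by rewrite tE span_cat (span_basis (vbasisP a)) addvSr.
have XU al : al \in s -> X al \in <<unzip1 t>>%VS.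
  by move=> als; rewrite tE memv_span // mem_cat map_f.
have stab de : is_root de -> de \in s ->
    (forall al, al \in s -> al != de -> is_root (al + de) -> al + de \in s) ->
    forall v : g, v \in <<unzip1 t>>%VS -> ad (X de) v \in <<unzip1 t>>%VS.
  move=> rde des sde; apply: span_stable => v.
  rewrite {1}tE mem_cat => /orP[/mapP[al als ->]|/vbasis_mem va].
    have [->|ne] := eqVneq al de; first by rewrite -[ad _ _]/(lie (X de) (X de)) liexx mem0v.
    apply: (ad_weight_mem (al := al + de)) => // [|/(sde _ als ne)/XU //].
    by rewrite addrC; apply: ad_weight_lie; apply: root_ad_weight => //; apply: sroot.
  rewrite -[ad _ _]/(lie (X de) v) lieC rpredN -[lie _ _]/(ad (vsval (Subvs va)) _).
  by rewrite (root_ad_weight rde) rpredZ // XU.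
have gas : ga \in s by rewrite inE gap orbT.
have ngas : - ga \in s by rewrite mem_head.
have not0 : ~ is_root 0 by move=> [/eqP].
have st1 := stab ga rga gas; have st2 := stab (- ga) (rootN rga) ngas.
have ef u : u \in t -> ad (X ga) (ad (X (- ga)) u.1) - ad (X (- ga)) (ad (X ga) u.1)
    = u.2 *: u.1.
  rewrite -ad_bracket lie_root_opposite // ad_scale mem_cat => /orP[] /mapP[].
    by move=> al als -> /=; rewrite (root_ad_weight (sroot _ als)) scalerA.
  move=> h /vbasis_mem ha -> /=; have [abel _ _] := a_cartan.
  by rewrite scale0r -[ad _ _]/(lie _ _) abel ?subvsP // scaler0.
have := commutator_trace0 ft (st1 _) (st2 _) ef.
rewrite big_cat /= big_cons !big_map /= dualN [X in _ + X]big1 // addr0.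
rewrite -mulr_sumr -mulrDr => tr0.
have /eqP : root_pairing ga * (- (ga (sharpv ga) : K) + \sum_(i <- pos_roots) (i (sharpv ga) : K)) = 0.
  apply: tr0 => al.
    rewrite inE => /predU1P[->|alp _]; first by rewrite addNr.
    by move=> /(pos_rootsD alp gap) alg; rewrite inE alg orbT.
  rewrite inE => /predU1P[->|alp _]; first by rewrite eqxx.
  have [->|ne] := eqVneq al ga; first by rewrite subrr.
  by move=> /(sub_simple_pos gaP alp ne) alg; rewrite inE alg orbT.
rewrite mulf_eq0 (negPf (root_pairing_neq0 rga)) /= addrC subr_eq0 => /eqP.
exact.
Qed.

(** * The parabolic subalgebra *)
Variable Theta : {fset dual a}.
Hypothesis Theta_sub : {subset Theta <= Psi}.

Local Notation inT := (@rootsT K g a Theta).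

Lemma aT_cartan x : x \in aT Theta -> x \in a.
Proof. by move=> /aTP[h -> _]; apply: subvsP. Qed.

Lemma Theta_rootsT be : be \in Theta -> inT be.
Proof.
move=> beT; split=> [|h hT]; first exact/Psi_root/Theta_sub.
by have [k /subvs_inj -> kT] := (aTP Theta (vsval h)).1 hT; apply: kT.
Qed.

Lemma rootsT_comb al : al \in pos_roots -> inT al -> nat_comb Theta al.
Proof.
move=> alp [_ alT]; have [c cE] := pos_roots_comb alp; have [e eP] := Psi_dual.
exists c; rewrite {1}cE; apply: sum_subset; rewrite ?fset_uniq // => be beP beT.
have := nat_comb_eval eP cE beP; rewrite alT => [/esym/eqP|].
  by rewrite pnatr_eq0 => /eqP ->; rewrite mulr0n.
apply/aTP; exists (e be) => // ga gaT; rewrite (eP _ _ (Theta_sub gaT) beP).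
by case: eqP => // ega; rewrite -ega gaT in beT.
Qed.

Lemma grading_element : exists H0 : subvs_of a, vsval H0 \in aT Theta /\
  forall al, al \in pos_roots -> ~ inT al -> exists n : nat, (al H0 : K) = n.+1%:R.
Proof.
have [e eP] := Psi_dual.
pose H0 := \sum_(be <- Psi | be \notin Theta) e be; exists H0.
have ev al : al \in Psi -> (al H0 : K) = (al \notin Theta)%:R.
  move=> alP; rewrite /H0 linear_sum /= big_mkcond (bigD1_seq al) ?fset_uniq //=.
  rewrite eP // eqxx big_seq_cond big1 ?addr0 => [|be /andP[beP ne]].
    by case: ifP.
  by rewrite eP // eq_sym (negPf ne); case: ifP.
split.
  by apply/aTP; exists H0 => // al alT; rewrite ev ?Theta_sub // alT.
move=> al alp nal; have [c cE] := pos_roots_comb alp.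
pose n := (\sum_(be <- Psi | be \notin Theta) c be)%N.
have nE : (al H0 : K) = n%:R.
  rewrite cE dual_sum natr_sum [RHS]big_mkcond; apply: eq_big_seq => be beP.
  by rewrite dualMn ev //; case: (be \in Theta); rewrite //= mul0rn.
case En: n => [|m]; last by exists m; rewrite nE En.
case: nal; split; first exact: pos_roots_root.
move=> h hT; rewrite cE dual_sum big_seq big1 // => be beP.
rewrite dualMn; case: (boolP (be \in Theta)) => [beT|beT].
  by rewrite (proj2 (Theta_rootsT beT)) // mul0rn.
move/eqP: En; rewrite sum_nat_seq_eq0 => /allP/(_ be beP).
by rewrite beT /= => /eqP ->; rewrite mulr0n.
Qed.

Lemma height_element : exists rh : subvs_of a,
  forall al, al \in pos_roots -> exists n : nat, (al rh : K) = n.+1%:R.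
Proof.
have [e eP] := Psi_dual; pose rh := \sum_(be <- Psi) e be; exists rh => al alp.
have ev be : be \in Psi -> (be rh : K) = 1.
  move=> beP; rewrite /rh linear_sum /= (bigD1_seq be) ?fset_uniq //= eP // eqxx.
  rewrite big_seq_cond big1 ?addr0 // => ga /andP[gaP ne].
  by rewrite eP // eq_sym (negPf ne).
have [c cE] := pos_roots_comb alp; have [al0 _] := pos_roots_root alp.
pose n := (\sum_(be <- Psi) c be)%N.
have nE : (al rh : K) = n%:R.
  rewrite {1}cE dual_sum natr_sum; apply: eq_big_seq => be beP.
  by rewrite dualMn ev.
case En: n => [|m]; last by exists m; rewrite nE En.
case/eqP: al0; rewrite cE big_seq big1 // => be beP.
move/eqP: En; rewrite sum_nat_seq_eq0 => /allP/(_ be beP) /eqP ->.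
by rewrite mulr0n.
Qed.

Lemma gTP x : x \in gT Theta <-> forall h, vsval h \in aT Theta -> lie (vsval h) x = 0.
Proof.
split=> [/centralizerP xC h hT|xC]; first exact: xC.
apply/centralizerP => z zT; have [h zE _] := (aTP Theta z).1 zT.
by rewrite zE xC // -zE.
Qed.

Lemma cartan_gT x : x \in a -> x \in gT Theta.
Proof.
by move=> xa; apply/gTP => h _; have [abel _ _] := a_cartan; rewrite abel ?subvsP.
Qed.

Lemma root_gT al : inT al -> X al \in gT Theta.
Proof.
move=> [ral alT]; apply/gTP => h hT.
by rewrite -[lie _ _]/(ad _ _) (root_ad_weight ral) alT // scale0r.
Qed.

Lemma rootsTN al : inT al -> inT (- al).
Proof.
by move=> [ral alT]; split=> [|h hT]; [apply: rootN|rewrite dualN alT ?oppr0].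
Qed.

Lemma ad_eigen_coeff0 h x c al : lie (vsval h) x = c *: x -> is_root al ->
  (al h : K) != c -> B x (X (- al)) = 0.
Proof.
move=> hx ral ne; have := trform_inv pi_rep x (vsval h) (X (- al)).
rewrite lieC hx -[lie _ _]/(ad _ _) (root_ad_weight (rootN ral)).
rewrite dualN trformNl trformZl trformZr mulNr => /oppr_inj/eqP.
by rewrite -subr_eq0 -mulrBl mulf_eq0 subr_eq0 eq_sym (negPf ne) => /eqP.
Qed.

Lemma ad_eigen_cartan0 h h' x c : lie (vsval h) x = c *: x -> c != 0 ->
  B x (vsval h') = 0.
Proof.
move=> hx ne; have [abel _ _] := a_cartan.
have := trform_inv pi_rep x (vsval h) (vsval h').
rewrite (abel (vsval h)) ?subvsP // [RHS]/trform linear0 mulmx0 mxtrace0.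
by rewrite lieC hx trformNl trformZl => /eqP; rewrite oppr_eq0 mulf_eq0 (negPf ne) => /eqP.
Qed.

Lemma trform_cartan_root al h : is_root al -> B (X al) (vsval h) = 0.
Proof.
move=> ral; have [al0 _] := ral; apply: (@trform_ad_weight al 0); rewrite ?addr0 //.
  exact: root_ad_weight.
exact/ad_weight0_cartan/subvsP.
Qed.

Lemma span_cartan_part x h h' : x = vsval h +
    \sum_(be <- roots) (B x (X (- be)) / root_pairing be) *: X be ->
  B (vsval h) (vsval h') = B x (vsval h').
Proof.
move=> xE; rewrite [in RHS]xE trformDl trform_suml big_seq big1 ?addr0 // => be /rootsP rbe.
by rewrite trformZl trform_cartan_root // mulr0.
Qed.

Lemma ad_eigen_expansion h x c : lie (vsval h) x = c *: x -> c != 0 ->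
  x = \sum_(be <- roots) (B x (X (- be)) / root_pairing be) *: X be.
Proof.
move=> hx c0; have [k xE] := g_root_expansion x.
rewrite {1}xE (_ : vsval k = 0) ?add0r //.
apply: cartan_nondegenerate (subvsP k) _ => h'.
by rewrite (span_cartan_part _ xE) (ad_eigen_cartan0 _ hx c0).
Qed.

Lemma gT_root_expansion x : x \in gT Theta -> exists h, x = vsval h +
  \sum_(be <- roots | `[< inT be >]) (B x (X (- be)) / root_pairing be) *: X be.
Proof.
move=> /gTP xC; have [h xE] := g_root_expansion x; exists h; rewrite {1}xE; congr (_ + _).
rewrite [RHS]big_mkcond; apply: eq_big_seq => be /rootsP rbe.
case: asboolP => // nbe; suff -> : B x (X (- be)) = 0 by rewrite mul0r scale0r.
apply: contrapT => Bn; apply: nbe; split=> // k kT; apply: contrapT => bk.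
apply: Bn; apply: (ad_eigen_coeff0 (h := k) (c := 0)) => //; last exact/eqP.
by rewrite scale0r xC.
Qed.

Definition nil_roots := [seq al <- pos_roots | ~~ `[< inT al >]].

Lemma nil_rootsP al : al \in nil_roots <-> al \in pos_roots /\ ~ inT al.
Proof.
rewrite mem_filter; split=> [/andP[/asboolP nal alp] //|[alp nal]].
by rewrite alp andbT; apply/asboolP.
Qed.

Lemma nil_roots_uniq : uniq nil_roots.
Proof. exact/filter_uniq/pos_roots_uniq. Qed.
Lemma nil_roots_root al : al \in nil_roots -> is_root al.
Proof. by move=> /nil_rootsP[/pos_roots_root]. Qed.

(** [H0] has positive integral eigenvalues on n_Theta, negative ones on the opposite
nilradical and commutes with g_Theta, so that it tells these three subspaces apart. *)
Lemma nil_roots_grading : exists H0 : subvs_of a,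
  [/\ vsval H0 \in aT Theta,
      forall al, al \in nil_roots -> exists n : nat, (al H0 : K) = n.+1%:R &
      forall al (n : nat), is_root al -> (al H0 : K) = n.+1%:R -> al \in nil_roots].
Proof.
have [H0 [HT HP]] := grading_element; exists H0; split=> // al.
  by move=> /nil_rootsP[]; apply: HP.
move=> n ral alE; apply/nil_rootsP; split; last first.
  by move=> [_ /(_ H0 HT)/eqP]; rewrite alE pnatr_eq0.
have := root_split ((rootsP _).2 ral); case: (boolP (al \in pos_roots)) => //= _ nal.
have [inal|nin] := pselect (inT (- al)).
  by case: inal => _ /(_ H0 HT)/eqP; rewrite dualN alE oppr_eq0 pnatr_eq0.
have [m /eqP] := HP _ nal nin; rewrite dualN alE eq_sym -subr_eq0 opprK -natrD.
by rewrite pnatr_eq0 addnS.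
Qed.

Lemma nilradical_expansion x h n : lie (vsval h) x = n.+1%:R *: x ->
  (forall al (n : nat), is_root al -> (al h : K) = n.+1%:R -> al \in nil_roots) ->
  x = \sum_(be <- nil_roots) (B x (X (- be)) / root_pairing be) *: X be.
Proof.
move=> hx hP; rewrite {1}(ad_eigen_expansion hx) ?pnatr_eq0 //.
apply: sum_subset; rewrite ?roots_uniq ?nil_roots_uniq //.
  by move=> be /nil_roots_root/rootsP.
move=> be /rootsP rbe nbe; rewrite (ad_eigen_coeff0 hx) ?mul0r ?scale0r //.
by apply: contraNneq nbe; apply: hP.
Qed.

Lemma opposite_nilradical_expansion x h n : lie (vsval h) x = - n.+1%:R *: x ->
  (forall al (n : nat), is_root al -> (al h : K) = n.+1%:R -> al \in nil_roots) ->
  x = \sum_(be <- nil_roots) (B x (X be) / root_pairing be) *: X (- be).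
Proof.
move=> hx hP; rewrite {1}(ad_eigen_expansion hx) ?oppr_eq0 ?pnatr_eq0 //.
have uN : uniq [seq - be | be <- nil_roots].
  by rewrite map_inj_uniq ?nil_roots_uniq //; apply: oppr_inj.
rewrite (sum_subset roots_uniq uN).
- by rewrite big_map; apply: eq_bigr => be _; rewrite opprK root_pairingN.
- by move=> _ /mapP[be /nil_roots_root/rootN/rootsP r ->].
move=> be /rootsP rbe nbe; rewrite (ad_eigen_coeff0 hx) ?mul0r ?scale0r //.
apply: contraNneq nbe => bh; apply/mapP; exists (- be); rewrite ?opprK //.
by apply: (hP _ n (rootN rbe)); rewrite dualN bh opprK.
Qed.

(** * Casimir elements *)
(** The image in End V of the canonical element of n_Theta tensored with the opposite
nilradical, these two spaces being dual to each other for the trace form. *)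
Definition nil_casimir : 'M[K]_N := \sum_(al <- nil_roots) (root_pairing al)^-1 *: (pi (X al) *m pi (X (- al))).

Lemma mxsumr m (A : 'M[K]_N) (I : Type) (r : seq I) (P : pred I) (F : I -> 'M[K]_(N, m)) :
  A *m (\sum_(i <- r | P i) F i) = \sum_(i <- r | P i) A *m F i.
Proof. exact: mulmx_sumr. Qed.
Lemma mxsuml m (A : 'M[K]_(N, m)) (I : Type) (r : seq I) (P : pred I) (F : I -> 'M[K]_N) :
  (\sum_(i <- r | P i) F i) *m A = \sum_(i <- r | P i) F i *m A.
Proof. exact: mulmx_suml. Qed.

Lemma piZ c x : pi (c *: x) = c *: pi x. Proof. exact: linearZ. Qed.
Lemma pi_sum (I : Type) (r : seq I) (P : pred I) (F : I -> g) :
  pi (\sum_(i <- r | P i) F i) = \sum_(i <- r | P i) pi (F i).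
Proof. exact: linear_sum. Qed.

(** The two nilradicals are dual to each other as g_Theta-modules. Thus the matrix of
ad y on the one is minus the transpose of its matrix on the other, and the two
parts of the commutator cancel. *)
Lemma nil_casimir_comm y : y \in gT Theta -> pi y *m nil_casimir = nil_casimir *m pi y.
Proof.
move=> /gTP yC; have [H0 [HT HP PH]] := nil_roots_grading.
have eig x c : lie (vsval H0) x = c *: x -> lie (vsval H0) (lie y x) = c *: lie y x.
  move=> hx; have := ad_bracket (vsval H0) y x; rewrite yC // -[lie _ x]/(ad _ x) in hx *.
  rewrite -(scale0r (0 : g)) ad_scale scale0r => /eqP; rewrite eq_sym subr_eq0 => /eqP.
  by rewrite /ad => ->; rewrite -/(ad _ _) hx linearZ.
pose A al be := B (lie y (X al)) (X (- be)).
have E1 al : al \in nil_roots -> lie y (X al) = \sum_(be <- nil_roots) (A al be / root_pairing be) *: X be.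
  move=> aln; have [n alH] := HP _ aln; apply: (nilradical_expansion (n := n) _ PH).
  by apply: eig; rewrite -alH; apply: root_ad_weight (nil_roots_root aln) _.
have E2 al : al \in nil_roots ->
    lie y (X (- al)) = \sum_(be <- nil_roots) (- A be al / root_pairing be) *: X (- be).
  move=> aln; have [n alH] := HP _ aln.
  rewrite [LHS](opposite_nilradical_expansion (n := n) _ PH); last first.
    by apply: eig; rewrite -alH -dualN; apply: root_ad_weight (rootN (nil_roots_root aln)) _.
  apply: eq_bigr => be _; congr (_ / _ *: _); rewrite lieC trformNl; congr (- _).
  by rewrite trform_inv // trformC.
apply/eqP; rewrite -subr_eq0 /nil_casimir (@mxsumr N (pi y) _ nil_roots xpredT) (@mxsuml N (pi y) _ nil_roots xpredT) -sumrB big_seq.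
have comm al : pi y *m ((root_pairing al)^-1 *: (pi (X al) *m pi (X (- al)))) -
    (root_pairing al)^-1 *: (pi (X al) *m pi (X (- al))) *m pi y =
    (root_pairing al)^-1 *: (pi (lie y (X al)) *m pi (X (- al)) + pi (X al) *m pi (lie y (X (- al)))).
  rewrite !pi_rep -scalemxAr -scalemxAl -scalerBr; congr (_ *: _).
  by rewrite mulmxBl mulmxBr !mulmxA addrA subrK.
rewrite (eq_bigr _ (fun al _ => comm al)).
pose F al be := (A al be / (root_pairing al * root_pairing be)) *: (pi (X be) *m pi (X (- al))).
rewrite (eq_bigr (fun al => \sum_(be <- nil_roots) (F al be - F be al))); last first.
  move=> al aln; rewrite {1}E1 // E2 // !pi_sum mxsuml mxsumr -big_split.
  rewrite scaler_sumr; apply: eq_bigr => be _ /=.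
  rewrite !piZ -scalemxAl -scalemxAr scalerDr !scalerA /F -scaleNr.
  congr (_ *: _ + _ *: _); first by rewrite invfM mulrCA.
  by rewrite invfM mulNr mulrN; congr (- _); rewrite mulrCA (mulrC (root_pairing al)^-1).
rewrite -big_seq; under eq_bigr => al _ do rewrite sumrB.
by rewrite sumrB [X in _ - X]exchange_big subrr.
Qed.

Lemma mulmx_delta_l (Y : 'M[K]_N) (i j : 'I_N) : Y *m delta_mx i j = \sum_k Y k i *: delta_mx k j.
Proof.
apply/matrixP => b c; rewrite summxE mxE (bigD1 i) //= big1 ?addr0; last first.
  by move=> k ki; rewrite mxE (negPf ki) mulr0.
rewrite [RHS](bigD1 b) //= big1 ?addr0; first by rewrite !mxE !eqxx.
by move=> k kb; rewrite !mxE eq_sym (negPf kb) mulr0.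
Qed.

Lemma mulmx_delta_r (Y : 'M[K]_N) (i j : 'I_N) : delta_mx i j *m Y = \sum_k Y j k *: delta_mx i k.
Proof.
apply/matrixP => b c; rewrite summxE mxE (bigD1 j) //= big1 ?addr0; last first.
  by move=> k kj; rewrite mxE (negPf kj) andbF mul0r.
rewrite [RHS](bigD1 c) //= big1 ?addr0; first by rewrite !mxE !eqxx andbT mulrC.
by move=> k kb; rewrite !mxE [c == k]eq_sym (negPf kb) andbF mulr0.
Qed.

(** Pair both sides with an element of g and use the invariance of the trace. *)
Lemma p_equivariant y A : p (pi y *m A - A *m pi y) = lie y (p A).
Proof.
apply/eqP; rewrite -subr_eq0; apply/eqP; apply: (trform_nondegenerate pi_faithful p_proj) => z.
rewrite trformDl trformNl (trform_projection p_proj).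
rewrite lieC trformNl (trform_inv pi_rep) (trform_projection p_proj) pi_rep.
have c : \tr (pi y *m A *m pi z) = \tr (A *m pi z *m pi y).
  by rewrite -mulmxA mxtrace_mulC.
by rewrite mulmxBl mulmxBr !raddfB /= !mulmxA c !opprK addrA subrK subrr.
Qed.

Lemma lie_projection_delta y i j : lie y (p (delta_mx i j)) =
  \sum_k pi y k i *: p (delta_mx k j) - \sum_k pi y j k *: p (delta_mx i k).
Proof.
have pB A C : p (A - C) = p A - p C by exact: linearB.
have pS (F : 'I_N -> 'M[K]_N) : p (\sum_k F k) = \sum_k p (F k) by exact: linear_sum.
have pZ c A : p (c *: A) = c *: p A by exact: linearZ.
rewrite -p_equivariant mulmx_delta_l mulmx_delta_r pB !pS.
by congr (_ - _); apply: eq_bigr => k _; rewrite pZ.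
Qed.

(** This is the sum of the pi(x_a) pi(x^a) over dual bases (x_a), (x^a) of the trace
form, since p(E_ij) is the sum of the pi(x_a)_ji x^a; writing it with [p] avoids the
choice of a basis of [a]. *)
Definition casimir : 'M[K]_N := \sum_i \sum_j delta_mx j i *m pi (p (delta_mx i j)).

(** The equivariance of [p] turns the commutator into sums that cancel in pairs after a
renaming of the indices. *)
Lemma casimir_comm y : pi y *m casimir = casimir *m pi y.
Proof.
pose E i j : 'M[K]_N := delta_mx i j; pose Q i j := pi (p (delta_mx i j)).
have comm i j : pi y *m Q i j - Q i j *m pi y =
    \sum_k pi y k i *: Q k j - \sum_k pi y j k *: Q i k.
  rewrite -pi_rep lie_projection_delta (linearB pi) /= !pi_sum.
  by congr (_ - _); apply: eq_bigr => k _; rewrite piZ.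
apply/eqP; rewrite -subr_eq0 /casimir mxsumr mxsuml -sumrB.
pose F i j k := pi y k i *: (E j i *m Q k j).
pose G i j k := pi y j k *: (E j i *m Q i k).
have step i j : pi y *m (E j i *m Q i j) - E j i *m Q i j *m pi y =
    \sum_k (G i k j - G i j k) + \sum_k (F i j k - F k j i).
  have -> : pi y *m (E j i *m Q i j) - E j i *m Q i j *m pi y =
     (pi y *m E j i - E j i *m pi y) *m Q i j +
     E j i *m (pi y *m Q i j - Q i j *m pi y).
    by rewrite mulmxBl mulmxBr !mulmxA addrA subrK.
  rewrite comm mulmx_delta_l mulmx_delta_r mulmxBl mulmxBr !sumrB !mxsuml !mxsumr.
  have e1 : \sum_(k < N) (pi y k j *: E k i) *m Q i j = \sum_k G i k j.
    by apply: eq_bigr => k _; rewrite -scalemxAl.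
  have e2 : \sum_(k < N) (pi y i k *: E j k) *m Q i j = \sum_k F k j i.
    by apply: eq_bigr => k _; rewrite -scalemxAl.
  have e3 : \sum_(k < N) E j i *m (pi y k i *: Q k j) = \sum_k F i j k.
    by apply: eq_bigr => k _; rewrite -scalemxAr.
  have e4 : \sum_(k < N) E j i *m (pi y j k *: Q i k) = \sum_k G i j k.
    by apply: eq_bigr => k _; rewrite -scalemxAr.
  by rewrite e1 e2 e3 e4 addrACA [X in _ = X]addrACA [- _ + - _]addrC.
apply/eqP; rewrite (eq_bigr (fun i => \sum_j (\sum_k (G i k j - G i j k) +
    \sum_k (F i j k - F k j i)))) => [|i _]; last first.
  by rewrite mxsumr mxsuml -sumrB; apply: eq_bigr => j _; apply: step.
have e1 : \sum_i \sum_j \sum_k (G i k j - G i j k) = 0.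
  apply: big1 => i _.
  under eq_bigr => j _ do rewrite sumrB.
  by rewrite sumrB [X in X - _]exchange_big subrr.
have e2 : \sum_i \sum_j \sum_k (F i j k - F k j i) = 0.
  under eq_bigr => i _ do under eq_bigr => j _ do rewrite sumrB.
  under eq_bigr => i _ do rewrite sumrB.
  rewrite sumrB; apply/eqP; rewrite subr_eq0; apply/eqP.
  rewrite exchange_big [RHS]exchange_big; apply: eq_bigr => j _ /=.
  by rewrite exchange_big.
under eq_bigr => i _ do rewrite big_split.
by rewrite big_split /= e1 e2 addr0.
Qed.

Lemma casimir_weight nu v : pi_weight nu v -> casimir *m v =
  (nu (sharpv nu) : K) *: v +
  \sum_(al <- roots) (root_pairing al)^-1 *: (pi (X (- al)) *m (pi (X al) *m v)).
Proof.
move=> wv.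
have pE i j : exists h : subvs_of a, (nu h : K) = pi (H nu) j i /\
    p (delta_mx i j) = vsval h +
      \sum_(be <- roots) (pi (X (- be)) j i / root_pairing be) *: X be.
  have [h hE] := g_root_expansion (p (delta_mx i j)); exists h; split.
    rewrite -sharpvP trformC (span_cartan_part _ hE) (trform_projection p_proj).
    exact: tr_delta_mul.
  rewrite {1}hE; congr (_ + _); apply: eq_bigr => be _.
  by rewrite (trform_projection p_proj) tr_delta_mul.
have term i j : delta_mx j i *m pi (p (delta_mx i j)) *m v =
   pi (H nu) j i *: (delta_mx j i *m v) + \sum_(be <- roots)
     (root_pairing be)^-1 *: ((pi (X (- be)) j i *: delta_mx j i) *m (pi (X be) *m v)).
  have [h [hE ->]] := pE i j.
  rewrite linearD /= pi_sum -mulmxA mulmxDl mulmxDr; congr (_ + _).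
    by have := wv h; rewrite /actV /= => ->; rewrite hE -scalemxAr.
  rewrite mxsuml mxsumr; apply: eq_bigr => be _.
  by rewrite piZ -!scalemxAl -scalemxAr scalerA mulrC.
have Esum (A : 'M[K]_N) : \sum_i \sum_j A j i *: delta_mx j i = A.
  by rewrite exchange_big [RHS]matrix_sum_delta.
rewrite /casimir mxsuml.
rewrite (eq_bigr (fun i => (\sum_j pi (H nu) j i *: delta_mx j i) *m v + \sum_(be <- roots)
     (root_pairing be)^-1 *: ((\sum_j pi (X (- be)) j i *: delta_mx j i) *m (pi (X be) *m v)))).
  rewrite big_split /= -mxsuml Esum; congr (_ + _); first exact: wv.
  rewrite exchange_big; apply: eq_bigr => be _.
  by rewrite -scaler_sumr -mxsuml Esum.
move=> i _; rewrite mxsuml (eq_bigr _ (fun j _ => term i j)) big_split /=; congr (_ + _).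
  by rewrite mxsuml; apply: eq_bigr => j _; rewrite scalemxAl.
rewrite exchange_big; apply: eq_bigr => be _; rewrite -scaler_sumr; congr (_ *: _).
by rewrite mxsuml.
Qed.

(** * Lowest weight vectors of the Levi subalgebra *)
Local Notation low v := (forall al, positive_rootsT Psi Theta al -> pi (X (- al)) *m v = 0).
Local Notation D nu := (Dpi pi Psi pibar nu).

Lemma DpiE nu : D nu = 2^-1 * ((pibar (sharpv pibar) : K) - (2 *: rho Psi) (sharpv pibar)
  - ((nu (sharpv nu) : K) - (2 *: rho Psi) (sharpv nu))).
Proof.
rewrite /Dpi dformC dformE sharpvD sharpvN; congr (_ * _).
set r2 := 2 *: rho Psi; rewrite linearB /= !dualD !dualN !linearD /= !linearN /=.
have -> : (pibar (sharpv nu) : K) = nu (sharpv pibar) by rewrite -!dformE dformC.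
ring.
Qed.

Lemma lowering_eq al v nu : is_root al -> pi_weight nu v ->
  pi (X (- al)) *m (pi (X al) *m v) =
  pi (X al) *m (pi (X (- al)) *m v) - (root_pairing al * (nu (sharpv al) : K)) *: v.
Proof.
move=> ral wv; have := wv (sharpv al); rewrite /actV /= => E.
rewrite -scalerA -E scalemxAl -piZ -lie_root_opposite // pi_rep mulmxBl opprB addrC !mulmxA.
by rewrite subrK.
Qed.

Lemma casimir_low nu v : pi_weight nu v -> casimir *m v =
  ((nu (sharpv nu) : K) - (2 *: rho Psi) (sharpv nu)) *: v +
  2 *: (\sum_(al <- pos_roots) (root_pairing al)^-1 *: (pi (X al) *m (pi (X (- al)) *m v))).
Proof.
move=> wv; rewrite (casimir_weight wv) sum_roots scalerBl -addrA; congr (_ + _).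
have -> : ((2 *: rho Psi) (sharpv nu) : K) = \sum_(al <- pos_roots) (nu (sharpv al) : K).
  by rewrite two_rhoE dual_sum; apply: eq_bigr => al _; rewrite -!dformE dformC.
rewrite scaler_suml -sumrN scaler_sumr -big_split; apply: eq_big_seq => al /pos_roots_root ral /=.
rewrite root_pairingN opprK (lowering_eq ral wv) scalerBr (scalerA (root_pairing al)^-1 (root_pairing al * _)).
rewrite mulKf ?root_pairing_neq0 //.
by rewrite addrAC -mulr2n -scaler_nat addrC.
Qed.

(** An eigenspace of [casimir] is a submodule, and V is irreducible. *)
Lemma pibar_casimir v : weight_vector pi pibar v ->
  (forall al, positive_roots Psi al -> pi (X (- al)) *m v = 0) ->
  casimir = ((pibar (sharpv pibar) : K) - (2 *: rho Psi) (sharpv pibar))%:M.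
Proof.
move=> [v0 wv] vlow; set c0 := _ - _.
have [W WP] : exists W : {vspace 'cV[K]_N}, forall u, u \in W <-> casimir *m u = c0 *: u.
  apply: vspace_of_pred => [|c u w hu hw]; first by rewrite mulmx0 scaler0.
  by rewrite mulmxDr -scalemxAr hu hw scalerDr !scalerA mulrC.
have Wfull : W = fullv.
  have [_ _ /(_ W (subvf _))[]] := irr => //.
    by move=> x u _ /WP uW; apply/WP; rewrite mulmxA -casimir_comm -mulmxA uW -scalemxAr.
  move=> W0; case/eqP: v0; apply/eqP; rewrite -memv0 -W0; apply/WP.
  rewrite (casimir_low wv) big_seq big1 ?scaler0 ?addr0 // => al /pos_rootsP alp.
  by rewrite vlow // mulmx0 scaler0.
apply/matrixP => i j; have /WP/colP/(_ i) : delta_mx j 0 \in W by rewrite Wfull memvf.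
by rewrite -colE !mxE eqxx andbT mulr_natr => ->.
Qed.

Hypothesis pibar_low : lowest_weight pi X (positive_roots Psi) fullv pibar.

Lemma nil_roots_pos : {subset nil_roots <= pos_roots}.
Proof. by move=> al /nil_rootsP[]. Qed.

(** On [v] the scalar [casimir] is the sum of a term depending only on [nu] and of twice
[nil_casimir], because the lowering operators of g_Theta kill [v]. The scalar itself
is read off the lowest weight vector of V. *)
Lemma nil_casimir_low nu v : pi_weight nu v -> low v -> nil_casimir *m v = D nu *: v.
Proof.
move=> wv vlow; have [v0 [_ wv0 v0low]] := pibar_low.
have := casimir_low wv; rewrite (pibar_casimir wv0 v0low) mul_scalar_mx.
have -> : \sum_(al <- pos_roots) (root_pairing al)^-1 *: (pi (X al) *m (pi (X (- al)) *m v)) = nil_casimir *m v.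
  rewrite mxsuml (sum_subset pos_roots_uniq nil_roots_uniq nil_roots_pos).
    by apply: eq_bigr => al _; rewrite -scalemxAl mulmxA.
  move=> al alp aln; rewrite vlow ?mulmx0 ?scaler0 //; split; last exact/pos_rootsP.
  by apply: contrapT => nT; case/negP: aln; apply/nil_rootsP.
move=> e; rewrite DpiE -scalerA scalerBl e [X in X - _]addrC addrK.
by rewrite scalerA mulVf ?scale1r ?pnatr_eq0.
Qed.

Lemma low_antidominant nu v ga : v != 0 -> pi_weight nu v -> ga \in Theta ->
  pi (X (- ga)) *m v = 0 -> (nu (sharpv ga) : K) <= 0.
Proof.
move=> v0 wv gaT vl; have [ral _] := Theta_rootsT gaT; have [al0 _] := ral.
have [b [bb bw]] := V_weight_basis.
have wy : ad_weight (- ga) ((root_pairing ga)^-1 *: X (- ga)) by apply: has_weightZ; apply: root_ad_weight; apply: rootN.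
have xy : lie (X ga) ((root_pairing ga)^-1 *: X (- ga)) = H ga.
  by rewrite -[lie _ _]/(ad _ _) linearZ /= /ad lie_root_opposite // scalerA mulVf ?scale1r ?root_pairing_neq0.
have yv : actV ((root_pairing ga)^-1 *: X (- ga)) v = 0 by rewrite actVZ /actV /= vl scaler0.
have [k ->] := sl2_lowest actV_lie actVZ bb bw al0 (root_ad_weight ral) xy v0 wv yv.
by rewrite oppr_le0 divr_ge0 ?ler0n // mulr_ge0 ?ler0n ?ltW ?root_length_gt0.
Qed.

Lemma Theta_low v ga : low v -> ga \in Theta -> pi (X (- ga)) *m v = 0.
Proof.
move=> vlow gaT; apply: vlow; split; first exact: Theta_rootsT.
exact/pos_rootsP/simple_pos/Theta_sub.
Qed.

(** If the coefficients of [be] are the [c ga], equality of the two values of [Dpi] says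
that the sum of the [c ga * (nu + (nu - be) - 2 rho) (sharpv ga)] is zero. At
[sharpv ga] both lowest weights are nonpositive and 2 rho is positive, so every
[c ga] is zero. *)
Lemma low_weights_separated nu be v w : v != 0 -> w != 0 -> pi_weight nu v -> pi_weight (nu - be) w ->
  low v -> low w -> nat_comb Theta be -> D nu = D (nu - be) -> be = 0.
Proof.
move=> v0 w0 wv ww vl wl [c beE] /eqP.
rewrite !DpiE (inj_eq (mulfI _)) ?invr_eq0 ?pnatr_eq0 // (inj_eq (addrI _)) eqr_opp.
set r2 := 2 *: rho Psi; rewrite sharpvD sharpvN !linearB /= !dualD !dualN.
have -> : (nu (sharpv be) : K) = be (sharpv nu) by rewrite -!dformE dformC.
move=> /eqP E.
have {}E : (be (sharpv nu) : K) + (nu (sharpv be) - be (sharpv be)) - r2 (sharpv be) = 0.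
  have -> : (nu (sharpv be) : K) = be (sharpv nu) by rewrite -!dformE dformC.
  by move/eqP: E; rewrite -subr_eq0 => /eqP E; rewrite -[RHS]E; ring.
have HvE (mu : dual a) : (mu (sharpv be) : K) = \sum_(ga <- Theta) (mu (sharpv ga) : K) *+ c ga.
  rewrite sharpv_sym {1}beE dual_sum; apply: eq_bigr => ga _.
  by rewrite dualMn sharpv_sym.
pose x ga : K := - ((nu (sharpv ga) : K) + (nu - be) (sharpv ga) - r2 (sharpv ga)).
have x_pos ga : ga \in Theta -> 0 < x ga.
  move=> gaT; rewrite /x opprB -[X in X - _]addr0 subr_gt0.
  apply: (@le_lt_trans _ _ 0).
    rewrite -[leRHS]addr0; apply: lerD.
      exact: low_antidominant v0 wv gaT (Theta_low vl gaT).
    exact: low_antidominant w0 ww gaT (Theta_low wl gaT).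
  by rewrite addr0 two_rho_simple ?Theta_sub // root_length_gt0 //; apply/Psi_root/Theta_sub.
have : \sum_(ga <- Theta | ga \in Theta) x ga *+ c ga == 0.
  move: E; have -> : (be (sharpv nu) : K) = nu (sharpv be) by rewrite -!dformE dformC.
  rewrite !HvE -sumrB -big_split -sumrB /= => E.
  rewrite -big_seq -oppr_eq0 -sumrN -[X in _ == X]E; apply/eqP; apply: eq_bigr => ga _.
  by rewrite -mulNrn /x opprK dualD dualN -mulrnBl -mulrnDl -mulrnBl.
rewrite psumr_eq0 => [/allP c0|ga gaT]; last by rewrite mulrn_wge0 // ltW ?x_pos.
rewrite beE big_seq big1 // => ga gaT; have := c0 ga gaT.
rewrite gaT /= mulrn_eq0 (gt_eqF (x_pos _ gaT)) orbF => /eqP ->.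
by rewrite mulr0n.
Qed.

Local Notation posT := (positive_rootsT Psi Theta).

Lemma posT_pos al : posT al -> al \in pos_roots.
Proof. by move=> [_ /pos_rootsP]. Qed.

Lemma posT_gT al : posT al -> X al \in gT Theta /\ X (- al) \in gT Theta.
Proof. by move=> [alT _]; split; apply: root_gT => //; apply: rootsTN. Qed.

(** Each application of a lowering operator [X (- al)] decreases the value of the weight
at the height element, and V has finitely many weights. *)
Lemma low_vector_below (P : 'cV[K]_N -> Prop) nu v :
    (forall u al, P u -> posT al -> P (pi (X (- al)) *m u)) ->
    P v -> v != 0 -> pi_weight nu v ->
  exists u be, [/\ P u, u != 0 & pi_weight (nu - be) u] /\
    [/\ nat_comb Theta be, low u & be = 0 -> u = v].
Proof.
move=> Pst; have [rh rhP] := height_element.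
have [b [bb bw]] := V_weight_basis; have [ws wsP] := has_weight_finite bb bw.
have [m] := ubnP (count (fun mu : dual a => (mu rh : K) < nu rh) ws).
elim: m => // m IH in nu v *; rewrite ltnS => cm Pv v0 wv.
have [vl|] := pselect (low v).
  exists v, 0; split; first by rewrite subr0.
  by split=> //; exists (fun=> 0%N); rewrite big1 // => ga _; rewrite mulr0n.
move=> /existsNP[al /not_implyP[alT /eqP v'0]]; have alp := posT_pos alT.
have [n aln] := rhP _ alp; have wv' := pi_weight_act (root_ad_weight (rootN (pos_roots_root alp))) wv.
have drop : ((nu - al) rh : K) < nu rh.
  by rewrite dualD dualN aln ltrBlDr ltrDl ltr0n.
have [||||u [be [[Pu u0 wu] [beT ul be0]]]] := IH (nu - al) (pi (X (- al)) *m v).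
- apply: leq_trans cm; apply: (@ltn_count _ _ _ _ (nu - al)) => //.
  + by move=> mu /= lt; apply: lt_trans drop.
  + exact: wsP v'0 wv'.
  + by rewrite ltxx.
- exact: Pst.
- exact: v'0.
- exact: wv'.
exists u, (al + be); split; first by rewrite opprD addrA.
have alc := rootsT_comb alp (proj1 alT).
split=> //.
  move: alc beT => [c ->] [d ->]; exists (fun ga => (c ga + d ga)%N).
  by rewrite -big_split; apply: eq_bigr => ga _; rewrite mulrnDr.
move=> /(congr1 (fun f : dual a => f rh : K)) /eqP; rewrite dualD lfunE aln.
have [c ->] := beT; rewrite dual_sum gt_eqF // ltr_wpDr ?ltr0n // big_seq.
apply: sumr_ge0 => ga /Theta_sub/simple_pos/rhP[k e].
by rewrite dualMn e mulrn_wge0.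
Qed.

Lemma V_weight_rows : exists (R : 'M[K]_N) (nus : 'I_N -> dual a), R \in unitmx /\
  forall h j, row j R *m pi (vsval h) = (nus j h : K) *: row j R.
Proof.
have [P [nus [Pu PE]]] := V_diagonal; exists (invmx P), nus.
split=> [|h j]; first by rewrite unitmx_inv.
have -> : pi (vsval h) = P *m diag_mx (\row_j (nus j h : K)) *m invmx P by rewrite -PE mulmxK.
by rewrite -row_mul !mulmxA mulVmx // mul1mx mul_diag_mx; apply/rowP => k; rewrite !mxE.
Qed.

Lemma row_weight nu mu (r : 'rV[K]_N) v : pi_weight nu v ->
  (forall h, r *m pi (vsval h) = (mu h : K) *: r) -> mu != nu -> r *m v = 0.
Proof.
move=> wv rw /dual_sep[h ne]; have e : (mu h : K) *: (r *m v) = (nu h : K) *: (r *m v).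
  by rewrite scalemxAl -rw -mulmxA; have := wv h; rewrite /actV /= => ->; rewrite scalemxAr.
apply/eqP; move/eqP: e; rewrite -subr_eq0 -scalerBl scaler_eq0 subr_eq0 (negPf ne).
by [].
Qed.

Lemma raising_row al mu (r : 'rV[K]_N) : is_root al ->
  (forall h, r *m pi (vsval h) = (mu h : K) *: r) ->
  forall h, r *m pi (X al) *m pi (vsval h) = ((mu - al) h : K) *: (r *m pi (X al)).
Proof.
move=> ral rw h; have := pi_rep (vsval h) (X al).
rewrite -[lie _ _]/(ad _ _) (root_ad_weight ral) piZ => /eqP.
rewrite eq_sym subr_eq addrC -subr_eq => /eqP e.
rewrite -mulmxA -e mulmxBr mulmxA rw -scalemxAl -scalemxAr -scalerBl.
by rewrite dualD dualN.
Qed.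

(** Let [S] be generated by [v] under the raising operators of g_Theta. It is a
g_Theta-module, and its weights other than [nu] are of the form [nu + be] with [be] a
nonzero sum of roots of Theta. A nonzero submodule contains a lowest weight vector;
since [nil_casimir] is a scalar on [S], [low_weights_separated] shows that the weight
of this vector is [nu], so that it is a multiple of [v]. *)
Lemma low_weight_irreducible nu v : v != 0 -> pi_weight nu v -> low v ->
  lowest_weightsT pi X Psi Theta nu.
Proof.
move=> v0 wv vl.
pose closed (W : {vspace 'cV[K]_N}) :=
  forall al u, posT al -> u \in W -> pi (X al) *m u \in W.
have [S SP] : exists S : {vspace 'cV[K]_N}, forall u, u \in S <->
    forall W : {vspace 'cV[K]_N}, v \in W -> closed W -> u \in W.
  apply: vspace_of_pred => [W _ _|c x y hx hy W vW cW]; first exact: mem0v.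
  by rewrite rpredD ?rpredZ //; [apply: hx|apply: hy].
have vS : v \in S by apply/SP.
have Sc : closed S.
  by move=> al u alT /SP uS; apply/SP => W vW cW; apply: (cW) => //; apply: uS.
have Smin (W : {vspace 'cV[K]_N}) : v \in W -> closed W -> (S <= W)%VS.
  by move=> vW cW; apply/subvP => u /SP; apply.
(* [bm] spans the Borel subalgebra of g_Theta that is opposite to the raising operators *)
pose bm y := y \in a \/ exists2 al, posT al & y = X (- al).
have Sbm y u : bm y -> u \in S -> pi y *m u \in S.
  have [S' S'P] : exists S' : {vspace 'cV[K]_N}, forall u, u \in S' <->
      u \in S /\ forall y, bm y -> pi y *m u \in S.
    apply: vspace_of_pred => [|c x z [xS hx] [zS hz]].
      by split=> [|y' _]; rewrite ?mulmx0 mem0v.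
    split=> [|y' y'b]; first by rewrite rpredD ?rpredZ.
    by rewrite mulmxDr -scalemxAr rpredD ?rpredZ ?hx ?hz.
  have le : (S <= S')%VS; last by move=> yb uS; have /S'P[_] := subvP le _ uS; apply.
  apply: Smin => [|al w alT /S'P[wS hw]].
    apply/S'P; split=> // y' [y'a|[al alT ->]]; last by rewrite vl ?mem0v.
    by have := wv (Subvs y'a); rewrite /actV /= => ->; rewrite rpredZ.
  have ral := pos_roots_root (posT_pos alT).
  apply/S'P; split=> [|y' y'b]; first exact: Sc.
  have -> : pi y' *m (pi (X al) *m w) = pi (X al) *m (pi y' *m w) + pi (lie y' (X al)) *m w.
    by rewrite pi_rep mulmxBl !mulmxA addrC subrK.
  rewrite rpredD //; first by apply: Sc => //; apply: hw.
  have [Wz WzP] : exists Wz : {vspace g}, forall z, z \in Wz <-> pi z *m w \in S.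
    apply: vspace_of_pred => [|c x z hx hz]; first by rewrite linear0 mul0mx mem0v.
    by rewrite linearP mulmxDl -scalemxAl rpredD ?rpredZ.
  apply/WzP; case: y'b => [y'a|[be beT ->]].
    rewrite -[y']/(vsval (Subvs y'a)) -[lie _ _]/(ad _ _) (root_ad_weight ral) rpredZ //.
    by apply/WzP; apply: Sc.
  have rbe := pos_roots_root (posT_pos beT).
  apply: (ad_weight_mem (al := - be + al)).
  - by apply: ad_weight_lie; apply: root_ad_weight => //; apply: rootN.
  - by move=> _; apply/subvP => z za; apply/WzP; apply: hw; left.
  move=> r; apply/WzP.
  have rT : inT (- be + al).
    split=> // h hT; rewrite dualD dualN.
    by rewrite (proj2 (proj1 alT)) // (proj2 (proj1 beT)) // oppr0 addr0.
  have := root_split ((rootsP _).2 r); case: (boolP (- be + al \in pos_roots)) => [ps _|_ ps].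
    by apply: Sc => //; split=> //; apply/pos_rootsP.
  apply: hw; right; exists (- (- be + al)); rewrite ?opprK //.
  by split; [exact: rootsTN|exact/pos_rootsP].
have Ssub : submodule_of pi (gT Theta) S.
  move=> y u /gT_root_expansion[h ->] uS; rewrite linearD /= mulmxDl rpredD //.
    by apply: Sbm => //; left; apply: subvsP.
  rewrite pi_sum mxsuml big_seq_cond; apply: rpred_sum => be /andP[/root_split rs /asboolP beT].
  rewrite piZ -scalemxAl rpredZ //; move: rs; case: (boolP (be \in pos_roots)) => [ps _|_ ps].
    by apply: Sc => //; split=> //; apply/pos_rootsP.
  apply: Sbm => //; right; exists (- be); rewrite ?opprK //.
  by split; [exact: rootsTN|exact/pos_rootsP].
(* the weights strictly above [nu]; whether the weights of a vector are among them is
   tested against weight row vectors *)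
pose Q mu := exists be, [/\ nat_comb Theta be, be <> 0 & mu = nu + be].
have [U UP] : exists U : {vspace 'cV[K]_N}, forall u, u \in U <->
    forall (r : 'rV[K]_N) mu, (forall h, r *m pi (vsval h) = (mu h : K) *: r) ->
      ~ Q mu -> r *m u = 0.
  apply: vspace_of_pred => [r mu _ _|c x y hx hy r mu rw nQ]; first by rewrite mulmx0.
  by rewrite mulmxDr -scalemxAr (hx r mu) // (hy r mu) // scaler0 addr0.
have posTc al : posT al -> nat_comb Theta al.
  by move=> alT; apply: rootsT_comb; [exact: posT_pos|exact: (proj1 alT)].
have SU : (S <= <[v]> + U)%VS.
  apply: Smin => [|al u alT]; first by rewrite memvE addvSl.
  have ral := pos_roots_root (posT_pos alT).
  move=> /memv_addP[_ /vlineP[c ->] [w /UP wU ->]]; rewrite mulmxDr -scalemxAr.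
  apply: (subvP (addvSr _ _)); rewrite rpredD ?rpredZ //; apply/UP => r mu rw nQ.
    rewrite mulmxA; apply: (row_weight wv (raising_row ral rw)).
    apply/eqP => e; apply: nQ; exists al; split; first exact: posTc.
      by case: ral => /eqP.
    by rewrite -e subrK.
  rewrite mulmxA; apply: (wU _ _ (raising_row ral rw)) => -[be [bec be0 e]].
  apply: nQ; exists (be + al); split.
  - have [c1 ->] := bec; have [c2 ->] := posTc _ alT.
    exists (fun ga => (c1 ga + c2 ga)%N).
    by rewrite -big_split; apply: eq_bigr => ga _; rewrite mulrnDr.
  - have [rh rhP] := height_element; have [n aln] := rhP _ (posT_pos alT).
    move=> /(congr1 (fun f : dual a => f rh : K)) /eqP; rewrite dualD lfunE aln.
    have [c' ->] := bec; rewrite dual_sum gt_eqF // ltr_wpDl ?ltr0n // big_seq.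
    apply: sumr_ge0 => ga /Theta_sub/simple_pos/rhP[k ek].
    by rewrite dualMn ek mulrn_wge0.
  by rewrite addrA -e subrK.
have Sw nu' w : w \in S -> w != 0 -> pi_weight nu' w -> (exists c, w = c *: v) \/ Q nu'.
  move=> /(subvP SU)/memv_addP[_ /vlineP[c ->] [u /UP uU wE]] w0 ww.
  have [R [nus [Ru RE]]] := V_weight_rows.
  have Rinj (x : 'cV[K]_N) : (forall j, row j R *m x = 0) -> x = 0.
    move=> Rx; rewrite -[x]mul1mx -(mulVmx Ru) -mulmxA.
    suff -> : R *m x = 0 by rewrite mulmx0.
    by apply/row_matrixP => j; rewrite row_mul Rx row0.
  have [Qn|nQ] := pselect (Q nu'); [by right|left; exists c].
  suff u0 : u = 0 by rewrite wE u0 addr0.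
  apply: Rinj => j; have rj h := RE h j.
  have [Qj|nQj] := pselect (Q (nus j)); last exact: (uU _ _ rj).
  have ne : nus j != nu' by apply/eqP => e; apply: nQ; rewrite -e.
  have nev : nus j != nu.
    case: Qj => be [_ be0 ->]; apply/eqP => e; apply: be0.
    by apply: (addrI nu); rewrite addr0.
  have := row_weight ww rj ne; rewrite wE mulmxDr -scalemxAr (row_weight wv rj nev).
  by rewrite scaler0 add0r.
(* [nil_casimir] commutes with the raising operators that generate [S] *)
have ST u : u \in S -> nil_casimir *m u = D nu *: u.
  have [E EP] : exists E : {vspace 'cV[K]_N}, forall u, u \in E <-> nil_casimir *m u = D nu *: u.
    apply: vspace_of_pred => [|c x y hx hy]; first by rewrite mulmx0 scaler0.
    by rewrite mulmxDr -scalemxAr hx hy scalerDr !scalerA mulrC.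
  move=> uS; apply/EP; apply: subvP u uS; apply: Smin => [|al x alT /EP hx].
    by apply/EP; apply: nil_casimir_low.
  apply/EP; rewrite mulmxA -(nil_casimir_comm (proj1 (posT_gT alT))) -mulmxA hx.
  by rewrite scalemxAr.
exists S; last by exists v; split.
split=> // [S0|W WS Wsub]; first by move: v0; rewrite -memv0 -S0 vS.
have [->|W0] := eqVneq W 0%VS; [by left|right].
apply/eqP; rewrite eqEsubv WS /=.
suff vW : v \in W.
  by apply: Smin => // al x alT xW; apply: Wsub => //; case: (posT_gT alT).
have [b [bb bw]] := V_weight_basis; have [ws uws dec] := has_weight_decomp bb bw.
have [y [yw yE]] := dec (vpick W).
have yW mu : mu \in ws -> y mu \in W.
  move=> muws; apply: (weight_component (ev := fun nu h => (nu h : K))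
    (f := fun h => actV (vsval h)) (s := ws) (x := y)) => //.
  - exact: dual_sep.
  - by move=> h x xW; apply: Wsub => //; apply/cartan_gT/subvsP.
  - by move=> mu' _; apply: yw.
  - by rewrite -yE memv_pick.
have [mu muws y0] : exists2 mu, mu \in ws & y mu != 0.
  apply: contrapT => nex; move: W0; rewrite -vpick0 yE big_seq big1 ?eqxx // => mu muws.
  by apply: contrapT => /eqP ne; apply: nex; exists mu.
have [|w [be [[wW w0 ww] [beT wl _]]]] := low_vector_below (P := fun w => w \in W) _ (yW _ muws) y0 (yw mu).
  by move=> u al uW alT; apply: Wsub => //; case: (posT_gT alT).
have wS := subvP WS _ wW.
case: (Sw _ _ wS w0 ww) => [[c wE]|[ga [gac ga0 nE]]].
  by move: wW; rewrite wE rpredZeq => /orP[/eqP c0|//]; rewrite wE c0 scale0r eqxx in w0.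
case: ga0; apply: (low_weights_separated (nu := mu - be) w0 v0 ww _ wl vl gac); rewrite nE addrK //.
have := ST _ wS; rewrite (nil_casimir_low ww wl) nE => /eqP.
by rewrite -subr_eq0 -scalerBl scaler_eq0 (negPf w0) orbF subr_eq0 => /eqP.
Qed.

(** * The operator on a layer *)
Section CentralShift.
Variable hc : subvs_of a.
Hypothesis hc_central : forall al, inT al -> (al hc : K) = 0.

(** The transpose of this operator is what F_pi induces on a layer of scalar columns,
modulo lower layers and the left ideal; there [hc] is the element of [a] that represents lambda. *)
Definition layer_mx : 'M[K]_N := pi (vsval hc) + nil_casimir.

Lemma layer_mx_comm al : inT al -> pi (X al) *m layer_mx = layer_mx *m pi (X al).
Proof.
move=> alT; have [ral _] := alT; rewrite /layer_mx mulmxDr mulmxDl nil_casimir_comm; last exact: root_gT.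
congr (_ + _); apply/eqP; rewrite eq_sym -subr_eq0 -pi_rep -[lie _ _]/(ad _ _).
by rewrite (root_ad_weight ral) hc_central // scale0r linear0.
Qed.

Lemma layer_mx_comm_cartan h : pi (vsval h) *m layer_mx = layer_mx *m pi (vsval h).
Proof.
rewrite /layer_mx mulmxDr mulmxDl nil_casimir_comm; last exact/cartan_gT/subvsP.
congr (_ + _); apply/eqP; rewrite -subr_eq0 -pi_rep.
by have [abel _ _] := a_cartan; rewrite abel ?subvsP // linear0.
Qed.

Definition layer_lin : {linear 'cV[K]_N -> 'cV[K]_N} := mulmx layer_mx.

Lemma layer_linE v : layer_lin v = layer_mx *m v. Proof. by []. Qed.

Lemma polyact_layer_comm (A : 'M[K]_N) (q : {poly K}) v :
  A *m layer_mx = layer_mx *m A -> A *m polyact q layer_lin v = polyact q layer_lin (A *m v).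
Proof.
move=> cA; apply: (@polyact_comm K _ q layer_lin (mulmx A : {linear 'cV[K]_N -> 'cV[K]_N}) v) => u.
by rewrite /= !layer_linE !mulmxA cA.
Qed.

Lemma polyact_layer_weight nu q v : pi_weight nu v -> pi_weight nu (polyact q layer_lin v).
Proof.
move=> wv h; rewrite /actV /= polyact_layer_comm ?layer_mx_comm_cartan //.
by have := wv h; rewrite /actV /= => ->; rewrite polyactZr.
Qed.

Lemma layer_mx_weight nu v : pi_weight nu v -> layer_mx *m v = (nu hc : K) *: v + nil_casimir *m v.
Proof. by move=> wv; rewrite mulmxDl; have := wv hc; rewrite /actV /= => ->. Qed.

(** On a lowest weight vector of weight [mu] the operator acts by a root of [q]; what has
to be shown is that it is semisimple enough, without complete reducibility.
Write T for [nil_casimir]. If [q] does not kill [v], its image contains a lowest weight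
vector [w = q(Z) x], and dropping from [q] the factor that kills [w] gives [x2] such
that [(T - d) x2 = w] is not zero but [(T - d) w = 0], where [d] is the value of [Dpi]
at the weight of [w]. A lowest weight vector below [x2] is killed by (T - d)^2, so its
weight has the same value of [Dpi]; by [low_weights_separated] it is [x2] itself, and
then [(T - d) x2 = 0]. *)
Lemma layer_poly_weight (H0 : subvs_of a) (q : {poly K}) nu v : vsval H0 \in aT Theta ->
  (forall mu, lowest_weightsT pi X Psi Theta mu -> (mu H0 : K) = nu H0 ->
     q.[(mu hc : K) + D mu] = 0) ->
  pi_weight nu v -> polyact q layer_lin v = 0.
Proof.
move=> HT qroot wv; apply: contrapT => /eqP w0.
have H0c al : posT al -> (al H0 : K) = 0 by move=> [[_ alT] _]; apply: alT.
(* the image of [q] is followed together with a preimage, used below *)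
pose P (u : 'cV[K]_N) := exists (x : 'cV[K]_N) mu, [/\ pi_weight mu x, (mu H0 : K) = nu H0 & u = polyact q layer_lin x].
have [u al [x [mu [wx mH ->]]] alT||w [be [[Pw wn0 ww] [beT wl _]]]] :=
    low_vector_below (P := P) _ _ w0 (polyact_layer_weight q wv).
- have alN := rootsTN (proj1 alT).
  exists (pi (X (- al)) *m x), (mu - al); split.
  + exact: pi_weight_act (root_ad_weight (proj1 alN)) wx.
  + by rewrite dualD dualN (H0c _ alT) oppr0 addr0.
  + by rewrite polyact_layer_comm // layer_mx_comm.
- by exists v, nu.
have [x [mu [wx mH wE]]] := Pw; move: ww; set nu' := nu - be => ww.
have muE : mu = nu'.
  by apply: (has_weight_inj wn0 _ ww); rewrite wE; apply: polyact_layer_weight.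
have lw := low_weight_irreducible wn0 ww wl.
set d := (nu' hc : K) + D nu'.
have /factor_theorem[q' qE] : root q d by apply/eqP/qroot; rewrite // -muE.
set x2 := polyact q' layer_lin x; have wx2 : pi_weight nu' x2 by rewrite -muE; apply: polyact_layer_weight.
have wE2 : w = nil_casimir *m x2 - D nu' *: x2.
  rewrite wE qE mulrC polyactM polyact_XsubC -/x2 layer_linE (layer_mx_weight wx2) /d scalerDl.
  by rewrite opprD addrACA subrr add0r.
have Tw := nil_casimir_low ww wl.
have x20 : x2 != 0.
  by apply: contra_neq wn0 => e; rewrite wE2 e mulmx0 scaler0 subrr.
(* [P2 u] says that (T - d)^2 kills [u] *)
pose P2 (u : 'cV[K]_N) := nil_casimir *m (nil_casimir *m u - D nu' *: u) = D nu' *: (nil_casimir *m u - D nu' *: u).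
have [u al Pu alT||u [ga [[Pu un0 wu] [gaT ul ga0]]]] := low_vector_below (P := P2) _ _ x20 wx2.
- have c := nil_casimir_comm (proj2 (posT_gT alT)); rewrite /P2 mulmxA -c -mulmxA scalemxAr.
  by rewrite -mulmxBr mulmxA -c -mulmxA Pu scalemxAr.
- by rewrite /P2 -wE2.
have Tu := nil_casimir_low wu ul.
have De : D nu' = D (nu' - ga).
  move: Pu; rewrite /P2 Tu -scalerBl -scalemxAr Tu !scalerA => /eqP.
  rewrite -subr_eq0 -scalerBl scaler_eq0 (negPf un0) orbF mulrC -mulrBl mulf_eq0.
  by rewrite subr_eq0 orbb eq_sym => /eqP.
have e := ga0 (low_weights_separated wn0 un0 ww wu wl ul gaT De).
by case/eqP: wn0; rewrite wE2 -e Tu -De subrr.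
Qed.

Lemma V_weight_decomp : exists ws : seq (dual a), (forall nu v, v != 0 -> pi_weight nu v -> nu \in ws) /\
  forall v, exists y : dual a -> 'cV[K]_N, (forall nu, pi_weight nu (y nu)) /\
    v = \sum_(nu <- ws) y nu.
Proof.
have [b [bb bw]] := V_weight_basis; have [ws wsP] := has_weight_finite bb bw.
have [ws' us' dec] := has_weight_decomp bb bw.
exists (undup (ws ++ ws')); split=> [nu v v0 wv|v].
  by rewrite mem_undup mem_cat (wsP _ _ v0 wv).
have [y [yw yE]] := dec v.
exists (fun nu => if nu \in ws' then y nu else 0); split.
  by move=> nu; case: ifP => _; [apply: yw|apply: has_weight0].
rewrite (sum_subset (undup_uniq _) us') => [|nu nus'|nu _ /negPf ->] //.
  by rewrite yE; apply: eq_big_seq => nu ->.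
by rewrite mem_undup mem_cat nus' orbT.
Qed.

(** Pair with the weight vectors of V: those outside the eigenspace of [H0] for [e] are
orthogonal to [r], those inside are killed by [layer_poly_weight]. *)
Lemma layer_poly_row (H0 : subvs_of a) (q : {poly K}) (e : K) (r : 'cV[K]_N) :
  vsval H0 \in aT Theta ->
  (forall mu, lowest_weightsT pi X Psi Theta mu -> (mu H0 : K) = e ->
     q.[(mu hc : K) + D mu] = 0) ->
  (pi (vsval H0))^T *m r = e *: r -> polyact q (mulmx layer_mx^T : 'cV[K]_N -> 'cV[K]_N) r = 0.
Proof.
move=> HT qroot rw.
have tr v : (polyact q (mulmx layer_mx^T) r)^T *m v = r^T *m polyact q layer_lin v.
  rewrite /polyact linear_sum mulmx_suml mulmx_sumr; apply: eq_bigr => k _.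
  rewrite linearZ /= -scalemxAl -scalemxAr; congr (_ *: _).
  elim: (nat_of_ord k) v => [|j IH] v //=; rewrite trmx_mul trmxK -mulmxA IH.
  by rewrite -iterSr iterS.
have [ws [_ dec]] := V_weight_decomp.
suff z v : (polyact q (mulmx layer_mx^T) r)^T *m v = 0.
  apply: trmx_inj; rewrite trmx0; apply/rowP => j.
  by have /matrixP/(_ 0 0) := z (delta_mx j 0); rewrite -colE [LHS]mxE => ->; rewrite !mxE.
rewrite tr; have [y [yw ->]] := dec v.
have pevS : polyact q layer_lin (\sum_(nu <- ws) y nu) = \sum_(nu <- ws) polyact q layer_lin (y nu).
  by apply: (big_morph (polyact q layer_lin)); [exact: polyactDr|exact: polyact0r].
rewrite pevS mulmx_sumr big1 // => nu _.
have [ne|ne] := eqVneq (nu H0 : K) e.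
  by rewrite (layer_poly_weight HT _ (yw nu)) ?mulmx0 // => mu lm; rewrite ne; apply: qroot.
have wz := polyact_layer_weight q (yw nu) H0; move: wz; rewrite /actV /= => wz.
have /eqP : e *: (r^T *m polyact q layer_lin (y nu)) = (nu H0 : K) *: (r^T *m polyact q layer_lin (y nu)).
  have re : r^T *m pi (vsval H0) = e *: r^T.
    by rewrite -[pi _]trmxK -trmx_mul rw linearZ.
  by rewrite (scalemxAr (nu H0 : K)) -wz mulmxA re scalemxAl.
by rewrite -subr_eq0 -scalerBl scaler_eq0 subr_eq0 eq_sym (negPf ne) => /eqP.
Qed.

End CentralShift.

(** * The character of the parabolic subalgebra *)
(** The value is an integral multiple of half the positive number [al (sharpv al)]. *)
Lemma weight_coroot_conj nu v al : v != 0 -> pi_weight nu v -> is_root al ->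
  ((nu (sharpv al) : K)^*)%R = nu (sharpv al).
Proof.
move=> v0 wv ral; have [al0 _] := ral; have wx := root_ad_weight ral.
have [y [wy Bxy]] := ad_weight_dual (root_X_neq0 ral) wx.
have xy : lie (X al) y = H al by rewrite (lie_opposite wx wy) Bxy scale1r.
have [b [bb bw]] := V_weight_basis.
have [z ->] := sl2_integral actV_lie actVZ bb bw al0 wx wy xy v0 wv.
rewrite rmorphM /= rmorph_int; congr (_ * _); apply: geC0_conj.
by rewrite divr_ge0 ?ler0n // ltW // root_length_gt0.
Qed.

(** If [x] is orthogonal to a_Theta, it is a combination of the [sharpv be] for [be] in
Theta. The weights are real at these elements, so the pairing of [x] with the
combination that has the conjugate coefficients is the sum of the |nu(x)|^2 over the
weights; and it is zero because [x] lies in a_Theta. *)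
Lemma aT_nondegenerate x : x \in aT Theta ->
  (forall y, y \in aT Theta -> B x y = 0) -> x = 0.
Proof.
move=> /[dup] xT /aTP[h xE hT] x0; have [e eP] := Psi_dual.
pose c be : K := B x (vsval (e be)).
have hE : x = \sum_(be <- Theta) c be *: H be.
  apply/eqP; rewrite -subr_eq0; apply/eqP; apply: cartan_nondegenerate => [|k].
    by rewrite rpredB ?(aT_cartan xT) ?rpred_sum // => be _; rewrite rpredZ ?subvsP.
  rewrite trformDl trformNl trform_suml.
  have : B x (vsval (k - \sum_(be <- Theta) (be k : K) *: e be)) = 0.
    apply: x0; apply/aTP; eexists; first by [].
    move=> ga gaT; rewrite linearB linear_sum /= (bigD1_seq ga) ?fset_uniq //=.
    rewrite big_seq_cond big1 ?addr0 => [|be /andP[beT ne]].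
      by rewrite linearZ /= eP ?Theta_sub // eqxx -[_ *: _]/(_ * _ : K) mulr1 subrr.
    by rewrite linearZ /= eP ?Theta_sub // eq_sym (negPf ne) scaler0.
  have -> : vsval (k - \sum_(be <- Theta) (be k : K) *: e be) =
      vsval k - \sum_(be <- Theta) (be k : K) *: vsval (e be).
    by rewrite linearB linear_sum; congr (_ - _); apply: eq_bigr => be _; rewrite linearZ.
  rewrite trformDr trformNr trform_sumr => E; rewrite -[RHS]E; congr (_ - _).
  apply: eq_bigr => be _ /=.
  by rewrite trformZl sharpvP trformZr mulrC.
have [nus [BE [nus0 nusw]]] := trform_weights.
(* the element conjugate to [x] *)
pose xb := \sum_(be <- Theta) (c be)^* *: sharpv be.
have hE' : h = \sum_(be <- Theta) c be *: sharpv be.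
  apply: subvs_inj; rewrite -xE hE linear_sum; apply: eq_bigr => be _.
  by rewrite linearZ.
have xbE j : (nus j xb : K) = (nus j h : K)^*.
  rewrite hE' /xb !linear_sum rmorph_sum; apply: eq_big_seq => be beT /=.
  have [v [v0 wv]] := nusw j.
  rewrite !linearZ /= rmorphM /= (weight_coroot_conj v0 wv) //.
  by have [] := Theta_rootsT beT.
have : B (vsval xb) (vsval h) = 0.
  rewrite /xb linear_sum trform_suml big_seq big1 // => be beT.
  by rewrite linearZ /= trformZl sharpvP hT // mulr0.
rewrite BE => /eqP; rewrite psumr_eq0 => [/allP j0|j _]; last first.
  by rewrite xbE mulrC -normCK exprn_ge0.
suff h0 : h = 0 by rewrite xE h0 linear0.
apply: nus0 => j; have := j0 j (mem_index_enum j).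
by rewrite /= xbE mulrC -normCK sqrf_eq0 normr_eq0 => /eqP.
Qed.

Lemma nT_span : nT X Psi Theta = <<map X nil_roots>>%VS.
Proof.
rewrite span_def big_map [RHS](fsbig_seq _ _ nil_roots_uniq) /nT.
congr (\big[_/_]_(_ \in _) _); apply/seteqP; split=> al /=.
  by move=> [/pos_rootsP alp nT]; apply/nil_rootsP.
by move=> /nil_rootsP[/pos_rootsP alp nT].
Qed.

(** This is what makes [lamT], defined by a projection along m_Theta + n_Theta, vanish on
m_Theta + n_Theta. *)
Lemma aT_cap_mTnT : (aT Theta :&: (mT pi Theta + nT X Psi Theta) = 0)%VS.
Proof.
apply/eqP; rewrite -subv0; apply/subvP => x /memv_capP[xa /memv_addP[m mm [n nn xE]]].
rewrite memv0; apply/eqP.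
have [H0 [HT HP _]] := nil_roots_grading.
move: mm; rewrite memv_cap => /andP[mg /orthogonalP mo].
have n0 : n = 0.
  have ng : n \in gT Theta.
    by rewrite (_ : n = x - m) ?rpredB //; [rewrite cartan_gT ?aT_cartan|rewrite xE addrC addKr].
  move: nn; rewrite nT_span => /(span_map_coords nil_roots_uniq)[c nE].
  rewrite nE big_seq big1 // => be ben; have rbe := nil_roots_root ben.
  have hn : lie (vsval H0) n = 0 *: n by rewrite scale0r; apply: (gTP n).1.
  have [k bek] := HP _ ben; have := ad_eigen_coeff0 hn rbe.
  rewrite bek pnatr_eq0 => /(_ isT); rewrite nE trform_suml (bigD1_seq be) ?nil_roots_uniq //=.
  rewrite big_seq_cond big1 ?addr0 => [|al /andP[aln ne]].
    rewrite trformZl => /eqP; rewrite mulf_eq0 -/(root_pairing be) (negPf (root_pairing_neq0 rbe)) orbF.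
    by move=> /eqP ->; rewrite scale0r.
  rewrite trformZl (trform_ad_weight (root_ad_weight (nil_roots_root aln)) (root_ad_weight (rootN rbe))) ?mulr0 //.
  by rewrite subr_eq0.
by apply: aT_nondegenerate => // y yT; rewrite xE n0 addr0 mo.
Qed.

Section Character.
Variable lam : dual (aT Theta).
Local Notation lamTh := (lamT pi X Psi lam).

Lemma lamT_mTnT x : x \in (mT pi Theta + nT X Psi Theta)%VS -> lamTh x = 0.
Proof.
move=> xV; rewrite /lamT !comp_lfunE.
have := @daddv_pi_add K g (aT Theta) (mT pi Theta + nT X Psi Theta) x aT_cap_mTnT.
rewrite (@daddv_pi_id K g (mT pi Theta + nT X Psi Theta) (aT Theta)) //; last first.
  by rewrite capvC aT_cap_mTnT.
rewrite memvE (subv_trans _ (addvSr _ _)) // => /(_ isT) e.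
set d := daddv_pi _ _ _ in e *; have -> : d = 0 by apply: (addIr x); rewrite add0r.
by rewrite !linear0.
Qed.

Lemma lamT_aT x (xT : x \in aT Theta) : lamTh x = lam (Subvs xT).
Proof.
rewrite /lamT !comp_lfunE daddv_pi_id ?aT_cap_mTnT // lfunE; congr (lam _).
by apply: val_inj; rewrite /= vsprojK.
Qed.

Definition hlam : subvs_of a := sharpv (lamT_a pi X Psi lam).

Lemma hlamP h : B (vsval hlam) (vsval h) = lamTh (vsval h).
Proof.
rewrite sharpvP; have -> : (lamT_a pi X Psi lam) h = lamTh (linfun (@vsval _ _ a) h).
  exact: comp_lfunE.
by have -> : linfun (@vsval _ _ a) h = vsval h by exact: lfunE.
Qed.

Lemma root_lamT al : inT al -> lamTh (X al) = 0.
Proof.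
move=> alT; apply: lamT_mTnT; rewrite memvE (subv_trans _ (addvSl _ _)) // -memvE.
rewrite memv_cap root_gT //=; apply/orthogonalP => y /aTP[h -> _].
by apply: trform_cartan_root; have [] := alT.
Qed.

Lemma nil_roots_lamT al : al \in nil_roots -> lamTh (X al) = 0.
Proof.
move=> aln; apply: lamT_mTnT; rewrite memvE (subv_trans _ (addvSr _ _)) // -memvE.
by rewrite nT_span memv_span // map_f.
Qed.

Lemma hlam_central al : inT al -> (al hlam : K) = 0.
Proof.
move=> [ral alT]; rewrite sharpv_sym -sharpvP hlamP; apply: lamT_mTnT.
rewrite memvE (subv_trans _ (addvSl _ _)) // -memvE memv_cap cartan_gT ?subvsP //=.
apply/orthogonalP => y yT; have [h yE _] := (aTP Theta y).1 yT.
by rewrite yE sharpvP alT // -yE.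
Qed.

Lemma restrT_hlam nu : (restrT pi X Psi Theta nu lam : K) = nu hlam.
Proof. by rewrite restrTE dformE sharpv_sym. Qed.

Lemma hlam_aT : vsval hlam \in aT Theta.
Proof. by apply/aTP; exists hlam => // al /Theta_rootsT; apply: hlam_central. Qed.

End Character.

(** Take for [lam0] the form that [H0] represents on a_Theta. Functions on the dual of a_Theta can thus be
sorted by the eigenvalue of [H0] that they stand for. *)
Lemma restrT_grading (H0 : subvs_of a) : vsval H0 \in aT Theta ->
  exists lam0 : dual (aT Theta), forall nu, (restrT pi X Psi Theta nu lam0 : K) = nu H0.
Proof.
move=> HT; pose f (u : subvs_of (aT Theta)) : K^o := B (vsval H0) (vsval u).
have fl : linear f.
  move=> c u v; have e : vsval (c *: u + v) = c *: vsval u + vsval v by apply: linearP.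
  by rewrite /f e trformDr trformZr.
pose F : {linear subvs_of (aT Theta) -> K^o} :=
  HB.pack f (GRing.isLinear.Build _ _ _ _ f fl).
exists (linfun F) => nu; rewrite restrT_hlam; congr (nu _ : K).
apply: subvs_inj; apply/eqP; rewrite -subr_eq0; apply/eqP; apply: aT_nondegenerate.
  by rewrite rpredB // hlam_aT.
move=> y yT; have [k yE _] := (aTP Theta y).1 yT.
have kT : vsval k \in aT Theta by rewrite -yE.
by rewrite yE trformDl trformNl hlamP (lamT_aT _ kT) lfunE subrr.
Qed.

(** * Columns over the enveloping algebra *)
Section Enveloping.
Variable lam : dual (aT Theta).
Local Notation lamTh := (lamT pi X Psi lam).
Local Notation J := (JT pi X Psi lam).
Local Notation col := {ffun 'I_N -> Ug g}.
Local Notation U := (@Uinj K g).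
Implicit Types (c d : col) (u : Ug g).

(** Columns are functions so that they form a vector space over K, to which [polyact]
applies. *)
Definition F_act c : col := [ffun i => \sum_j U (p (delta_mx i j)) * c j].

Lemma F_act_linear : linear F_act.
Proof.
move=> k c d; apply/ffunP => i; rewrite !ffunE scaler_sumr -big_split.
by apply: eq_bigr => j _; rewrite !ffunE mulrDr scalerAr.
Qed.
HB.instance Definition _ := GRing.isLinear.Build K col col _ F_act F_act_linear.

(** The diagonal action of g on the tensor product of the dual of V and U(g). *)
Definition diag_act y c : col := [ffun i => U y * c i - \sum_j pi y j i *: c j].

Lemma diag_act_linear y : linear (diag_act y).
Proof.
move=> k c d; apply/ffunP => i; rewrite !ffunE mulrDr scalerBr scaler_sumr scalerAr.
rewrite (eq_bigr (fun j => k *: (pi y j i *: c j) + pi y j i *: d j)).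
  by rewrite big_split opprD addrACA.
by move=> j _; rewrite !ffunE scalerDr !scalerA mulrC.
Qed.
HB.instance Definition _ y := GRing.isLinear.Build K col col _ (diag_act y) (diag_act_linear y).

Definition tensor u v : col := [ffun i => v i 0 *: u].

Lemma U_projection y i j : U y * U (p (delta_mx i j)) = U (p (delta_mx i j)) * U y +
  (\sum_k pi y k i *: U (p (delta_mx k j)) - \sum_k pi y j k *: U (p (delta_mx i k))).
Proof.
have UB x z : U (x - z) = U x - U z by apply: linearB.
have US (F : 'I_N -> g) : U (\sum_k F k) = \sum_k U (F k) by apply: linear_sum.
have UZ k x : U (k *: x) = k *: U x by apply: linearZ.
apply/eqP; rewrite addrC -subr_eq -Uinj_lie lie_projection_delta UB !US.
by apply/eqP; congr (_ - _); apply: eq_bigr => k _; rewrite UZ.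
Qed.

(** Up to sign F_pi is the split Casimir element acting on the tensor product of the dual
of V and U(g), and this commutes with the diagonal action. *)
Lemma F_act_diag_act y c : F_act (diag_act y c) = diag_act y (F_act c).
Proof.
apply/ffunP => i; rewrite !ffunE mulr_sumr.
pose f j k := pi y j k *: (U (p (delta_mx i k)) * c j).
pose h j k := pi y k i *: (U (p (delta_mx k j)) * c j).
have -> : \sum_j pi y j i *: F_act c j = \sum_j \sum_k h j k.
  rewrite exchange_big; apply: eq_bigr => k _; rewrite ffunE scaler_sumr.
  by apply: eq_bigr.
rewrite (eq_bigr (fun j => U (p (delta_mx i j)) * (U y * c j) - \sum_k f k j)).
  rewrite sumrB [X in _ - X]exchange_big.
  rewrite [X in _ = X - _](eq_bigr (fun j => U (p (delta_mx i j)) * (U y * c j) +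
     (\sum_k h j k - \sum_k f j k))).
    by rewrite big_split sumrB /= addrA [RHS]addrAC addrK.
  move=> j _; rewrite mulrA U_projection mulrDl mulrA; congr (_ + _).
  rewrite mulrBl !mulr_suml; congr (_ - _); apply: eq_bigr => k _; exact: esym (scalerAl _ _ _).
move=> j _; rewrite ffunE mulrBr mulr_sumr; congr (_ - _).
by apply: eq_bigr => k _; rewrite /f scalerAr.
Qed.

Definition inJ c := forall i, c i \in lideal J.

Lemma lidealZ k (z : Ug g) : z \in lideal J -> k *: z \in lideal J.
Proof. by move=> zJ; rewrite -mulr_algl; apply: lidealM. Qed.

Lemma inJ0 : inJ 0. Proof. by move=> i; rewrite ffunE rpred0. Qed.
Lemma inJD c d : inJ c -> inJ d -> inJ (c + d).
Proof. by move=> hc hd i; rewrite ffunE rpredD. Qed.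
Lemma inJZ k c : inJ c -> inJ (k *: c).
Proof. by move=> hc i; rewrite ffunE lidealZ. Qed.
Lemma inJ_F_act c : inJ c -> inJ (F_act c).
Proof. by move=> hc i; rewrite ffunE rpred_sum // => j _; apply: lidealM. Qed.
Lemma inJ_diag_act y c : inJ c -> inJ (diag_act y c).
Proof.
move=> hc i; rewrite ffunE rpredB ?lidealM // rpred_sum // => j _; exact: lidealZ.
Qed.

Definition killed (q : {poly K}) c := inJ (polyact q F_act c).

Lemma killed0 q : killed q 0. Proof. by rewrite /killed polyact0r; apply: inJ0. Qed.
Lemma killedD q c d : killed q c -> killed q d -> killed q (c + d).
Proof. by rewrite /killed polyactDr; apply: inJD. Qed.
Lemma killedZ q k c : killed q c -> killed q (k *: c).
Proof. by rewrite /killed polyactZr; apply: inJZ. Qed.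
Lemma killed_sum q (I : Type) (r : seq I) (P : pred I) (F : I -> col) :
  (forall i, P i -> killed q (F i)) -> killed q (\sum_(i <- r | P i) F i).
Proof.
by move=> h; apply: big_ind => //; [exact: killed0|move=> c d; apply: killedD].
Qed.
Lemma killed_F_act q c : killed q c -> killed q (F_act c).
Proof. by rewrite /killed -(@polyact_comm K _ q F_act F_act) //; apply: inJ_F_act. Qed.
Lemma killed_diag_act q y c : killed q c -> killed q (diag_act y c).
Proof.
rewrite /killed -(@polyact_comm K _ q F_act (diag_act y)); first exact: inJ_diag_act.
by move=> d; rewrite /= F_act_diag_act.
Qed.
Lemma killed_inJ q c : inJ c -> killed q c.
Proof.
move=> hc; apply: (polyact_stable (P := inJ)) => //; [exact: inJ0|exact: inJD|exact: inJZ|].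
exact: inJ_F_act.
Qed.
Lemma killedM q r c : killed q c -> killed (r * q) c.
Proof. by move=> h; rewrite /killed polyactM; apply: killed_inJ. Qed.

Lemma tensorD u v w : tensor u (v + w) = tensor u v + tensor u w.
Proof. by apply/ffunP => i; rewrite !ffunE mxE scalerDl. Qed.
Lemma tensorZ u k v : tensor u (k *: v) = k *: tensor u v.
Proof. by apply/ffunP => i; rewrite !ffunE mxE scalerA. Qed.
Lemma tensor0 u : tensor u 0 = 0.
Proof. by apply/ffunP => i; rewrite !ffunE mxE scale0r. Qed.
Lemma tensor_sum u (I : Type) (r : seq I) (P : pred I) (F : I -> 'cV[K]_N) :
  tensor u (\sum_(i <- r | P i) F i) = \sum_(i <- r | P i) tensor u (F i).
Proof. by apply: big_morph; [exact: tensorD|exact: tensor0]. Qed.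

Lemma diag_act_tensor y u v : diag_act y (tensor u v) = tensor (U y * u) v - tensor u ((pi y)^T *m v).
Proof.
apply/ffunP => i; rewrite !ffunE mxE scaler_suml scalerAr; congr (_ - _).
by apply: eq_bigr => j _; rewrite !ffunE mxE scalerA.
Qed.

(** The killed columns are stable under [diag_act y], which by [diag_act_tensor] maps
[tensor u v] to [tensor (y u) v] up to another column with the same [u]. *)
Lemma killed_generate q : (forall v, killed q (tensor 1 v)) -> forall u v, killed q (tensor u v).
Proof.
move=> h1; suff gen (z : Ug g) : forall u, (forall v, killed q (tensor u v)) ->
    forall v, killed q (tensor (z * u) v).
  by move=> u v; rewrite -[u]mulr1; apply: gen.
elim/Ug_ind: z => [y|k|z w hz hw|z w hz hw] u hu v.
- have := killed_diag_act y (hu v); rewrite diag_act_tensor => h.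
  rewrite -[tensor (_ * u) v](subrK (tensor u ((pi y)^T *m v))).
  by apply: killedD.
- by rewrite mulr_algl (_ : tensor _ v = k *: tensor u v); [apply: killedZ|apply/ffunP => i; rewrite !ffunE !scalerA mulrC].
- rewrite mulrDl (_ : tensor _ v = tensor (z * u) v + tensor (w * u) v).
    by apply: killedD; [apply: hz|apply: hw].
  by apply/ffunP => i; rewrite !ffunE scalerDr.
- by rewrite -mulrA; apply: hz => v'; apply: hw.
Qed.

Lemma eval_mx_polyact q i j u :
  eval_mx q (Fpi p) i j * u = polyact q F_act (tensor u (delta_mx j 0)) i.
Proof.
have iterE k : iter k F_act (tensor u (delta_mx j 0)) = [ffun l => (Fpi p ^+ k) l j * u].
  elim: k => [|k IH] /=; apply/ffunP => l; rewrite !ffunE.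
    by rewrite expr0 !mxE andbT; case: eqP => _; rewrite ?scale1r ?mul1r ?scale0r ?mul0r.
  rewrite exprS mxE mulr_suml; apply: eq_bigr => n _; by rewrite IH ffunE mxE mulrA.
rewrite /eval_mx summxE mulr_suml /polyact sum_ffunE; apply: eq_bigr => k _.
by rewrite ffunE iterE ffunE !mxE scalerAl.
Qed.

(** * Reduction modulo the left ideal *)
Lemma lideal_pT x : x \in pT X Psi Theta -> U x - (lamTh x : K)%:A \in lideal J.
Proof.
move=> xp; apply/asboolP; exists 1%N, (fun=> 1), (fun=> U x - (lamTh x : K)%:A).
by split=> [_|]; [exists x|rewrite big_ord1 mul1r].
Qed.

Lemma gT_pT x : x \in gT Theta -> x \in pT X Psi Theta.
Proof. by move=> xg; rewrite /pT memvE (subv_trans _ (addvSl _ _)) // -memvE. Qed.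

Lemma U_cartan h : U (vsval h) - (B (vsval (hlam lam)) (vsval h))%:A \in lideal J.
Proof. by rewrite hlamP; apply/lideal_pT/gT_pT/cartan_gT/subvsP. Qed.

Lemma U_rootsT al : inT al -> U (X al) \in lideal J.
Proof.
move=> alT; have := lideal_pT (gT_pT (root_gT alT)).
by rewrite root_lamT // scale0r subr0.
Qed.

Lemma U_nil_roots al : al \in nil_roots -> U (X al) \in lideal J.
Proof.
move=> aln; have := @lideal_pT (X al); rewrite nil_roots_lamT // scale0r subr0; apply.
rewrite /pT memvE (subv_trans _ (addvSr _ _)) // -memvE.
by rewrite nT_span memv_span // map_f.
Qed.

(** Modulo the left ideal an element of [a] is the value of lambda at it, and the root
vectors of p_Theta are zero; what remains are the root vectors opposite to n_Theta. *)
Lemma U_entry i j : U (p (delta_mx i j)) - (pi (vsval (hlam lam)) j i)%:A -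
  \sum_(be <- nil_roots) (pi (X be) j i / root_pairing be) *: U (X (- be)) \in lideal J.
Proof.
have [h pE] := g_root_expansion (p (delta_mx i j)).
pose F be := (B (p (delta_mx i j)) (X (- be)) / root_pairing be) *: U (X be).
have UE : U (p (delta_mx i j)) = U (vsval h) + \sum_(be <- roots) F be.
  have US (r : seq (dual a)) (G : dual a -> g) : U (\sum_(k <- r) G k) = \sum_(k <- r) U (G k).
    by apply: linear_sum.
  have UD x y : U (x + y) = U x + U y by apply: linearD.
  rewrite {1}pE UD US; congr (_ + _); apply: eq_bigr => be _; exact: linearZ.
pose nn := [seq - be | be <- nil_roots].
have uN : uniq nn by rewrite map_inj_uniq ?nil_roots_uniq //; apply: oppr_inj.
have sN : {subset nn <= roots} by move=> _ /mapP[be /nil_roots_root/rootN/rootsP r ->].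
have FE : \sum_(be <- roots) F be =
    \sum_(be <- nil_roots) (pi (X be) j i / root_pairing be) *: U (X (- be)) +
    \sum_(be <- roots) (if be \in nn then 0 else F be).
  have -> : \sum_(be <- nil_roots) (pi (X be) j i / root_pairing be) *: U (X (- be)) =
      \sum_(be <- roots) (if be \in nn then F be else 0).
    rewrite (sum_subset roots_uniq uN sN) => [|be _ /negPf ->] //.
    rewrite [RHS](eq_big_seq F) => [|be ->] //.
    rewrite big_map; apply: eq_bigr => be _.
    by rewrite /F opprK root_pairingN (trform_projection p_proj) tr_delta_mul.
  by rewrite -big_split /=; apply: eq_bigr => be _; case: ifP => _; rewrite ?addr0 ?add0r.
have hE : B (vsval (hlam lam)) (vsval h) = pi (vsval (hlam lam)) j i.
  rewrite trformC (span_cartan_part _ pE) (trform_projection p_proj).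
  exact: tr_delta_mul.
have key (x1 x2 x3 x4 : Ug g) : x1 + (x2 + x3) - x4 - x2 = x1 - x4 + x3.
  by rewrite (addrC x2) addrA [LHS]addrAC addrK addrAC.
rewrite UE FE -hE key.
rewrite rpredD ?U_cartan // big_seq; apply: rpred_sum => be /[dup] ber /root_split bes.
have [|nbe] := boolP (be \in nn); first by rewrite rpred0.
apply: lidealZ; have [beT|nbeT] := pselect (inT be); first exact: U_rootsT.
apply: U_nil_roots; apply/nil_rootsP; split=> //; apply/negPn/negP => bep.
move: bes; rewrite (negPf bep) addFb => nbep; case/negP: nbe; apply/mapP.
exists (- be); rewrite ?opprK //; apply/nil_rootsP; split=> // /rootsTN.
by rewrite opprK.
Qed.

Local Notation Zlam := (layer_mx (hlam lam)).

(** In the expansion of [U_entry] each root vector [X (- be)] is replaced by its diagonal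
action plus a transposed matrix; these matrices add up to the transpose of
[nil_casimir]. *)
Lemma F_act_tensor1 v : inJ (F_act (tensor 1 v) - (tensor 1 (Zlam^T *m v) +
  \sum_(be <- nil_roots) (root_pairing be)^-1 *: diag_act (X (- be)) (tensor 1 ((pi (X be))^T *m v)))).
Proof.
have -> : tensor 1 (Zlam^T *m v) +
    \sum_(be <- nil_roots) (root_pairing be)^-1 *: diag_act (X (- be)) (tensor 1 ((pi (X be))^T *m v)) =
    tensor 1 ((pi (vsval (hlam lam)))^T *m v) +
    \sum_(be <- nil_roots) (root_pairing be)^-1 *: tensor (U (X (- be))) ((pi (X be))^T *m v).
  have TE : nil_casimir^T *m v = \sum_(be <- nil_roots)
      (root_pairing be)^-1 *: ((pi (X (- be)))^T *m ((pi (X be))^T *m v)).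
    rewrite /nil_casimir linear_sum mxsuml; apply: eq_bigr => be _.
    by rewrite linearZ /= -scalemxAl trmx_mul mulmxA.
  rewrite /layer_mx linearD /= mulmxDl tensorD TE tensor_sum -addrA; congr (_ + _).
  rewrite -big_split; apply: eq_bigr => be _ /=.
  by rewrite diag_act_tensor mulr1 scalerBr tensorZ addrC subrK.
move=> i; rewrite !ffunE sum_ffunE.
have -> : \sum_j U (p (delta_mx i j)) * tensor 1 v j - (((pi (vsval (hlam lam)))^T *m v) i 0 *: 1 +
     \sum_(be <- nil_roots) ((root_pairing be)^-1 *: tensor (U (X (- be))) ((pi (X be))^T *m v)) i) =
   \sum_j v j 0 *: (U (p (delta_mx i j)) - (pi (vsval (hlam lam)) j i)%:A -
     \sum_(be <- nil_roots) (pi (X be) j i / root_pairing be) *: U (X (- be))).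
  under [RHS]eq_bigr => j _ do rewrite !scalerBr.
  rewrite !sumrB opprD addrA; congr (_ - _ - _).
  - by apply: eq_bigr => j _; rewrite ffunE -scalerAr mulr1.
  - rewrite mxE scaler_suml; apply: eq_bigr => j _.
    by rewrite mxE scalerA mulrC.
  under [RHS]eq_bigr => j _ do rewrite scaler_sumr.
  rewrite exchange_big; apply: eq_bigr => be _ /=.
  rewrite !ffunE mxE scaler_suml scaler_sumr; apply: eq_bigr => j _.
  by rewrite !scalerA mxE; congr (_ *: _); rewrite mulrC mulrAC mulrC.
by apply: rpred_sum => j _; apply: lidealZ; apply: U_entry.
Qed.

(** * Induction on the layers *)
Variable H0 : subvs_of a.
Hypothesis H0T : vsval H0 \in aT Theta.
Hypothesis H0_grading : forall al, al \in nil_roots -> exists n : nat, (al H0 : K) = n.+1%:R.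

Definition layer (e : K) (v : 'cV[K]_N) := (pi (vsval H0))^T *m v = e *: v.

Lemma layer_Z e v : layer e v -> layer e (Zlam^T *m v).
Proof.
move=> lv; have c : (pi (vsval H0))^T *m Zlam^T = Zlam^T *m (pi (vsval H0))^T.
  by rewrite -!trmx_mul layer_mx_comm_cartan.
by rewrite /layer mulmxA c -mulmxA lv scalemxAr.
Qed.

Lemma layer_X e v be : is_root be -> layer e v ->
  layer (e - (be H0 : K)) ((pi (X be))^T *m v).
Proof.
move=> rbe lv; have := pi_rep (vsval H0) (X be).
rewrite -[lie _ _]/(ad _ _) (root_ad_weight rbe) piZ => /eqP.
rewrite eq_sym subr_eq addrC -subr_eq => /eqP E.
have c : (pi (vsval H0))^T *m (pi (X be))^T =
    (pi (X be))^T *m (pi (vsval H0))^T - (be H0 : K) *: (pi (X be))^T.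
  by rewrite -!trmx_mul -E linearB linearZ.
by rewrite /layer mulmxA c mulmxBl -mulmxA lv -scalemxAl -scalemxAr -scalerBl.
Qed.

(** The diagonal action maps killed columns to killed columns, so [F_act_tensor1] says
that modulo the columns killed by [r] the operators [F_act] and [Zlam^T] agree on the
layer. *)
Lemma layer_step r q e v :
  (forall be w, be \in nil_roots -> layer (e - (be H0 : K)) w -> killed r (tensor 1 w)) ->
  layer e v -> polyact q (mulmx Zlam^T : 'cV[K]_N -> 'cV[K]_N) v = 0 ->
  killed (r * q) (tensor 1 v).
Proof.
move=> lower lv qv; rewrite /killed polyactM -/(killed r _).
pose Zt : 'cV[K]_N -> 'cV[K]_N := mulmx Zlam^T.
have step w : layer e w -> killed r (F_act (tensor 1 w) - tensor 1 (Zlam^T *m w)).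
  move=> lw; pose S := \sum_(be <- nil_roots) (root_pairing be)^-1 *:
     diag_act (X (- be)) (tensor 1 ((pi (X be))^T *m w)).
  have -> : F_act (tensor 1 w) - tensor 1 (Zlam^T *m w) =
      F_act (tensor 1 w) - (tensor 1 (Zlam^T *m w) + S) + S by rewrite opprD addrA subrK.
  apply: killedD.
    exact/killed_inJ/F_act_tensor1.
  rewrite /S big_seq; apply: killed_sum => be ben; apply: killedZ; apply: killed_diag_act.
  by apply: (lower _ _ ben); apply: layer_X => //; apply: nil_roots_root.
have layer_iter k : layer e (iter k Zt v).
  by elim: k => //= k IH; apply: layer_Z.
have iterk k : killed r (iter k F_act (tensor 1 v) - tensor 1 (iter k Zt v)).
  elim: k => [|k IH] /=; first by rewrite subrr; apply: killed0.
  have -> : F_act (iter k F_act (tensor 1 v)) - tensor 1 (Zt (iter k Zt v)) =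
      F_act (iter k F_act (tensor 1 v) - tensor 1 (iter k Zt v)) +
      (F_act (tensor 1 (iter k Zt v)) - tensor 1 (Zlam^T *m iter k Zt v)).
    by rewrite [F_act (_ - _)]linearB /= addrA subrK.
  by apply: killedD; [exact: killed_F_act|exact: step].
have -> : polyact q F_act (tensor 1 v) = \sum_(k < size q) q`_k *:
    (iter k F_act (tensor 1 v) - tensor 1 (iter k Zt v)) + tensor 1 (polyact q Zt v).
  rewrite /polyact tensor_sum -big_split; apply: eq_bigr => k _ /=.
  by rewrite tensorZ -scalerDr subrK.
rewrite qv tensor0 addr0; apply: killed_sum => k _; apply: killedZ; exact: iterk.
Qed.

(** A nonzero row vector has a nonzero pairing with some weight vector of V. *)
Lemma layer_weight e v (ws : seq (dual a)) :
  (forall w, exists y : dual a -> 'cV[K]_N, (forall nu, pi_weight nu (y nu)) /\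
    w = \sum_(nu <- ws) y nu) ->
  v != 0 -> layer e v -> exists2 mu : dual a, mu \in ws & (mu H0 : K) = e.
Proof.
move=> dec v0 lv; apply: contrapT => nex; case/eqP: v0.
apply: trmx_inj; rewrite trmx0; apply/rowP => j; rewrite [RHS]mxE.
suff /matrixP/(_ 0 0) : v^T *m delta_mx j 0 = 0 :> 'M_1.
  by rewrite -colE [LHS]mxE => ->; rewrite mxE.
have [y [yw ->]] := dec (delta_mx j 0).
rewrite mulmx_sumr big_seq big1 // => nu nuws.
have re : v^T *m pi (vsval H0) = e *: v^T by rewrite -[pi _]trmxK -trmx_mul lv linearZ.
have := yw nu H0; rewrite /actV /= => wz.
have /eqP : e *: (v^T *m y nu) = (nu H0 : K) *: (v^T *m y nu).
  by rewrite (scalemxAr (nu H0 : K)) -wz mulmxA re scalemxAl.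
rewrite -subr_eq0 -scalerBl scaler_eq0 subr_eq0 => /orP[/eqP ee|/eqP //].
by case: nex; exists nu.
Qed.

Lemma lowest_weightsT_finite : finite_set (lowest_weightsT pi X Psi Theta).
Proof.
have [ws [wsP _]] := V_weight_decomp.
apply: (@sub_finite_set _ _ [set` ws]) (finite_seq ws).
by move=> nu [W _ [v [_ [v0 wv] _]]]; apply: wsP v0 wv.
Qed.

Local Notation Om := (fset_set (@Omega K g N pi a X Psi Theta pibar)).
Local Notation pairT := ('Hom(dual (aT Theta), K^o) * K)%type.
Local Notation fac mC := ('X - (mC.1 lam : K)%:P - mC.2%:P).

Lemma Omega_finite : finite_set (@Omega K g N pi a X Psi Theta pibar).
Proof. by apply: finite_image; apply: lowest_weightsT_finite. Qed.

Lemma q_prod : q_pi_Theta pi X Psi pibar lam = \prod_(mC <- Om) fac mC.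
Proof. by rewrite /q_pi_Theta fsbig_finite //; apply: Omega_finite. Qed.

(** Induction on the layers. The operators [pi (X be)^T] for [be] in n_Theta map a layer
to one with a smaller eigenvalue, and the factors of the polynomial are distributed
among the layers by the value of mu at [lam0]; so each factor is used for one layer. *)
Lemma killed_columns v : killed (q_pi_Theta pi X Psi pibar lam) (tensor 1 v).
Proof.
have [ws [_ dec]] := V_weight_decomp; have [lam0 lam0P] := restrT_grading H0T.
(* the order on K is partial, but the eigenvalues of two layers related by n_Theta differ
   by a positive integer *)
pose meas (e : K) := count (fun mu : dual a => (mu H0 : K) <= e) ws.
pose r n := \prod_(mC <- Om | (meas (mC.1 lam0) < n)%N) fac mC.
have layers n : forall e w, (meas e < n)%N -> layer e w -> killed (r n) (tensor 1 w).
  elim: n => // n IH e w; rewrite ltnS leq_eqVlt => en lw.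
  pose q := \prod_(mC <- Om | meas (mC.1 lam0) == n) fac mC.
  have rE : r n.+1 = r n * q.
    rewrite /r (bigID (fun mC : pairT => (meas (mC.1 lam0) < n)%N)) /=.
    congr (_ * _); apply: eq_bigl => mC; rewrite ltnS.
      by apply: andb_idl => /ltnW.
    by rewrite -leqNgt eqn_leq.
  move: en => /orP[/eqP en|en]; last by rewrite rE mulrC; apply: killedM; apply: IH lw.
  have [->|w0] := eqVneq w 0; first by rewrite tensor0; apply: killed0.
  (* [e] is an eigenvalue of [H0] on V, so that [meas] decreases strictly below it *)
  have [mu muws muH] := layer_weight dec w0 lw.
  rewrite rE; apply: (layer_step (e := e)) => //.
    move=> be x ben lx; apply: IH lx; rewrite -en; have [m ->] := H0_grading ben.
    have lt : e - m.+1%:R < e by rewrite ltrBlDr ltrDl ltr0n.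
    apply: (@ltn_count _ _ _ _ mu) => //=.
    - by move=> nu /= le; apply: le_trans le (ltW lt).
    - by rewrite muH.
    by rewrite muH (lt_geF lt).
  apply: (@layer_poly_row (hlam lam) (@hlam_central lam) H0 q e w H0T _ lw) => nu nuT nuH.
  have inO : (restrT pi X Psi Theta nu, Dpi pi Psi pibar nu) \in Om.
    rewrite (in_fset_set Omega_finite); apply/mem_set; by exists nu.
  rewrite /q horner_prod (big_rem _ inO) /= lam0P nuH en eqxx.
  by rewrite !hornerE restrT_hlam addrAC addrK subrr mul0r.
have [R [nus [Ru RE]]] := V_weight_rows.
have vE : v = \sum_j (v^T *m invmx R) 0 j *: (row j R)^T.
  rewrite -[LHS]trmxK -{1}[v^T](mulmxKV Ru) mulmx_sum_row linear_sum.
  by apply: eq_bigr => j _; rewrite linearZ.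
have -> : q_pi_Theta pi X Psi pibar lam = r (size ws).+1.
  by rewrite q_prod /r; apply: eq_bigl => mC; rewrite ltnS count_size.
rewrite vE tensor_sum; apply: killed_sum => j _; rewrite tensorZ; apply: killedZ.
apply: (layers _ (nus j H0 : K)); first by rewrite ltnS count_size.
by rewrite /layer -trmx_mul RE linearZ.
Qed.

End Enveloping.

Lemma q_pi_Theta_annihilates (lam : dual (aT Theta)) i j (m : MT pi X Psi lam) :
  eval_mx (q_pi_Theta pi X Psi pibar lam) (Fpi p) i j *: m = 0.
Proof.
have [H0 [H0T H0P _]] := nil_roots_grading.
pose J := JT pi X Psi lam.
have <- : \pi_(lquot J)%qT 0 = 0 :> lquot J by apply: raddf0.
rewrite -[m]reprK; set u := repr m.
have -> : eval_mx (q_pi_Theta pi X Psi pibar lam) (Fpi p) i j *: (\pi_(lquot J)%qT u : lquot J) =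
    \pi_(lquot J)%qT (eval_mx (q_pi_Theta pi X Psi pibar lam) (Fpi p) i j * u).
  exact: lquot_scale_pi.
apply/lquot_eqP; rewrite subr0 eval_mx_polyact.
exact: (killed_generate (killed_columns lam H0T H0P) u (delta_mx j 0) i).
Qed.

End Roots.

Local Open Scope fset_scope.

Theorem theorem2p24 (R : realType) (g : lieAlgType R[i]) (N : nat)
    (pi : 'Hom(g, 'M[R[i]]_N)) (p : 'Hom('M[R[i]]_N, g))
    (a : {vspace g}) (Psi Theta : {fset dual a}) (X : dual a -> g)
    (pibar : dual a) :
  reductive g ->
  representation pi -> faithful pi -> irreducible_for pi fullv fullv ->
  orthogonal_projection pi p ->
  cartan_subalgebra a ->
  simple_system Psi -> Theta `<` Psi ->
  (forall alpha, root_system alpha -> root_vector alpha (X alpha)) ->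
  lowest_weight pi X (positive_roots Psi) fullv pibar ->
  forall (lam : dual (aT Theta)) (i j : 'I_N) (m : MT pi X Psi lam),
    eval_mx (q_pi_Theta pi X Psi pibar lam) (Fpi p) i j *: m = 0.
Proof.
move=> _ pi_rep pi_faithful irr p_proj a_cartan Psi_simple Theta_proper X_root pibar_low.
have pibar_wt : exists v, weight_vector pi pibar v.
  by have [v [_ wv _]] := pibar_low; exists v.
have Theta_sub : {subset Theta <= Psi} := fsubsetP (fproper_sub Theta_proper).
exact: q_pi_Theta_annihilates.
Qed.
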